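(* Let $\chi$ be an odd Dirichlet character of modulus $q>1$. Then for any fixed $s\in\mathbb{C}$ and any integer $m\ge 0$, as $n\to\infty$, \[ L_n(s,\chi) = 2\sum_{k=0}^{m} b_k(s)\, L(1+2(s-k),\chi)\left(\frac{qn}{2\pi}\right)^{1+2(s-k)} + \mathcal{O}\!\left(n^{1+2(s-(m+1))}\right), \] where the functions $b_k(s)$ are polynomials in $s$ of degree $k$, defined by the Laurent expansion \[ \left(\frac{z/2}{\sin(z/2)}\right)^{2s}\cot(z/2) = \sum_{k\ge 0} b_k(s)\, z^{2k-1}. \]
   Context: For an odd Dirichlet character $\chi$ (i.e. $\chi(-1)=-1$) of modulus $q>1$ and an integer $n\ge1$, the discrete $L$-function is \[ L_n(s,\chi)=\sum_{j=1}^{qn-1}\chi(j)\,\frac{\cot\left(\frac{\pi j}{qn}\right)}{\left[4\sin^2\left(\frac{\pi j}{qn}\right)\right]^{s}},\qquad s\in\mathbb{C}, \] where powers of positive reals use the principal branch. $L(s,\chi)$ denotes the (entire, for non-principal $\chi$) Dirichlet $L$-function, the analytic continuation of $\sum_{n\ge1}\chi(n)n^{-s}$. The error term $\mathcal{O}(n^{w})$ for complex $w$ means $\mathcal{O}(n^{\operatorname{Re} w})$. *)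

(* Defs.v *)
From Stdlib Require Import Reals ZArith ClassicalEpsilon.
From Coquelicot Require Import Coquelicot.

Open Scope C_scope.

Definition Cexp (z : C) : C :=
  RtoC (exp (Re z)) * (cos (Im z), sin (Im z)).

Definition Csin (z : C) : C := (Cexp (Ci * z) - Cexp (- (Ci * z))) / (2 * Ci).
Definition Ccos (z : C) : C := (Cexp (Ci * z) + Cexp (- (Ci * z))) / 2.
Definition Ccot (z : C) : C := Ccos z / Csin z.

(* Principal argument, with values in (-PI, PI]; irrelevant at z = 0. *)
Definition Carg (z : C) : R :=
  if Rlt_dec (Im z) 0
  then (- acos (Re z / Cmod z))%R
  else acos (Re z / Cmod z).

Definition Clog (z : C) : C := (ln (Cmod z), Carg z).

(* Principal branch of z ^ w for z <> 0; Coquelicot's [Cpow], written [^], only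
   has natural exponents. *)
Definition Cpower (z w : C) : C := Cexp (w * Clog z).

Definition analytic_at (f : C -> C) (z0 : C) : Prop :=
  exists (a : nat -> C) (r : R), (0 < r)%R /\
    forall z : C, (Cmod (z - z0) < r)%R ->
      is_pseries (K := C_AbsRing) (V := C_NormedModule) a (z - z0) (f z).

Definition entire (f : C -> C) : Prop := forall z : C, analytic_at f z.

Definition polynomial_of_degree (k : nat) (f : C -> C) : Prop :=
  exists c : nat -> C, c k <> 0 /\
    forall s : C, f s = sum_n (fun i => c i * s ^ i) k.

Definition bigO (f : nat -> C) (g : nat -> R) : Prop :=
  exists (M : R) (N : nat), forall n : nat, (N <= n)%nat ->
    (Cmod (f n) <= M * g n)%R.

Record dirichlet_character (q : nat) (chi : Z -> C) : Prop := {
  dirichlet_mul : forall a b : Z, chi (a * b)%Z = chi a * chi b;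
  dirichlet_periodic : forall a : Z, chi (a + Z.of_nat q)%Z = chi a;
  dirichlet_support : forall a : Z, chi a <> 0 <-> Z.gcd a (Z.of_nat q) = 1%Z
}.

Definition odd_character (chi : Z -> C) : Prop := chi (-1)%Z = -1.

Definition dirichlet_L_continuation (chi : Z -> C) (L : C -> C) : Prop :=
  entire L /\
  forall s : C, (1 < Re s)%R ->
    is_series (K := C_AbsRing) (V := C_NormedModule)
      (fun n => chi (Z.of_nat (S n)) * Cpower (INR (S n)) (- s)) (L s).

(* The continuation is unique, and it exists for every non-principal character
   (in particular for every odd one); for other [chi] the value is arbitrary. *)
Definition dirichlet_L (chi : Z -> C) : C -> C :=
  epsilon (inhabits (fun _ : C => RtoC 0)) (dirichlet_L_continuation chi).

Definition discrete_L (q n : nat) (chi : Z -> C) (s : C) : C :=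
  sum_n_m
    (fun j : nat =>
       let x : R := (PI * INR j / INR (q * n))%R in
       chi (Z.of_nat j) *
       (RtoC (cos x / sin x)%R / Cpower (RtoC (4 * sin x ^ 2)%R) s))
    1 (q * n - 1).

Definition cot_generating (s z : C) : C :=
  Cpower ((z / 2) / Csin (z / 2)) (2 * s) * Ccot (z / 2).

(* The k-th term a k * z ^ (2 * k) / z is a_k z^(2k-1). Since (z/2) / sin (z/2)
   tends to 1 as z -> 0, the principal power is analytic near 0, so r exists. *)
Definition cot_laurent_coefficients (s : C) (a : nat -> C) : Prop :=
  exists r : R, (0 < r)%R /\
    forall z : C, z <> 0 -> (Cmod z < r)%R ->
      is_series (K := C_AbsRing) (V := C_NormedModule)
        (fun k => a k * z ^ (2 * k) / z) (cot_generating s z).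

Definition b (k : nat) (s : C) : C :=
  epsilon (inhabits (fun _ : nat => RtoC 0)) (cot_laurent_coefficients s) k.

(* Main.v *)
Require Import Defs.
From Stdlib Require Import Reals ZArith Lra Lia.
From Stdlib Require Import Classical_Prop ClassicalEpsilon FunctionalExtensionality.
From Coquelicot Require Import Coquelicot.

(* With z = 2 pi j / (q n) and lambda = q n / (2 pi), the j-th summand is
   chi(j) F(j / lambda) for F(z) = cot(z/2) / (4 sin^2(z/2))^s, and F(z) is
   asymptotic to sum_k b_k(s) z^(2k-1-2s) at 0. By the oddness of chi and of F
   about pi, the sum equals 2 sum_j chi(j) h(j / lambda), where h is F times a
   C^r cutoff.

   Since chi has mean zero over a period, it is the r-th difference of a bounded
   sequence A_r. Summation by parts then gives a meaning Lambda(f) = sum_j A_r(j)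
   (D^r f)(j) to "sum_j chi(j) f(j)" for every f with f^(i)(x) = O(x^(a-i)) for
   i <= r and a - r <= -2. This Lambda is the ordinary sum on h(. / lambda), and
   Lambda(x^-w) is entire in w, hence equals L(w, chi). Applied to
   U = h - sum_{k <= m} b_k(s) z^(2k-1-2s), which satisfies these bounds on the
   whole half-line with a = Re(2(m+1)-1-2s), it gives Lambda(U(. / lambda))
   = O(lambda^-a), which is the claim.

   The coefficients b_k come from Miller's recurrence for powers of the power
   series of sin(z/2)/(z/2), which shows both convergence and the degree in s. *)

Local Open Scope R_scope.

(** * Complex series and derivatives by components *)

(** The sums over j of chi(j) j^(-w) diverge as soon as Re w <= 0, so the expansion of the summand
    cannot be summed term by term; this is what forces the regularized functional. The summand is
    singular at both ends of its range; folding the end 2 pi onto 0 leaves a single singular point,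
    and the remainder is then governed by one power x^a on all of (0, oo): near 0 it is that power
    times a convergent series in x^2, and beyond the support of the cutoff only powers with smaller
    exponents are left. The bounds on derivatives are homogeneous, so that replacing x by x / lambda
    changes nothing but the constant, while the constant of the functional does not depend on n. The
    order r may be fixed from a alone, since the value of the functional does not depend on it, and
    a cutoff of finite smoothness built from truncated powers is enough. Complex differentiation is
    avoided: derivatives are taken in a real variable, and analyticity in w is obtained from an
    interchange of double series. *)

Definition Cseries (a : nat -> C) (l : C) : Prop :=
  is_series (fun n => Re (a n)) (Re l) /\ is_series (fun n => Im (a n)) (Im l).

Lemma C_eq (z w : C) : Re z = Re w -> Im z = Im w -> z = w.
Proof. intros H1 H2; apply injective_projections; assumption. Qed.

Lemma im_le_Cmod (c : C) : Rabs (Im c) <= Cmod c.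
Proof. eapply Rle_trans; [ | apply Rmax_Cmod ]. apply Rmax_r. Qed.

Lemma Cmod_le_add (c : C) : Cmod c <= Rabs (Re c) + Rabs (Im c).
Proof.
  replace c with (RtoC (Re c) + (RtoC (Im c)) * Ci)%C at 1
    by (apply C_eq; simpl; ring).
  eapply Rle_trans; [ apply Cmod_triangle | ].
  rewrite Cmod_mult, !Cmod_R, Cmod_Ci; lra.
Qed.

Lemma Re_sum_n (a : nat -> C) n : Re (sum_n a n) = sum_n (fun k => Re (a k)) n.
Proof.
  induction n; [ now rewrite !sum_O | ].
  rewrite !sum_Sn, <- IHn; reflexivity.
Qed.

Lemma Im_sum_n (a : nat -> C) n : Im (sum_n a n) = sum_n (fun k => Im (a k)) n.
Proof.
  induction n; [ now rewrite !sum_O | ].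
  rewrite !sum_Sn, <- IHn; reflexivity.
Qed.

Lemma Cseries_spec (a : nat -> C) (l : C) :
  is_series (K := C_AbsRing) (V := C_NormedModule) a l <-> Cseries a l.
Proof.
  split.
  - intros H; split.
    + apply filterlim_ext with (fun n => Re (sum_n a n)); [ intros; apply Re_sum_n | ].
      eapply filterlim_comp; [ exact H | ].
      apply (continuous_fst (U := R_UniformSpace) (V := R_UniformSpace) (fst l) (snd l)).
    + apply filterlim_ext with (fun n => Im (sum_n a n)); [ intros; apply Im_sum_n | ].
      eapply filterlim_comp; [ exact H | ].
      apply (continuous_snd (U := R_UniformSpace) (V := R_UniformSpace) (fst l) (snd l)).
  - intros [H1 H2].
    apply filterlim_locally; intros eps.
    generalize (filter_and _ _ (proj1 (filterlim_locally _ _) H1 eps)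
      (proj1 (filterlim_locally _ _) H2 eps)); apply filter_imp; intros n [h1 h2].
    split; [ change (ball (fst l) eps (Re (sum_n a n))); rewrite Re_sum_n; exact h1
           | change (ball (snd l) eps (Im (sum_n a n))); rewrite Im_sum_n; exact h2 ].
Qed.

Lemma Cseries_ext (a b : nat -> C) l : (forall n, a n = b n) -> Cseries a l -> Cseries b l.
Proof.
  intros H [H1 H2]; split;
    (eapply is_series_ext; [ intros n; simpl; rewrite <- H; reflexivity | assumption ]).
Qed.

Lemma Cseries_unique (a : nat -> C) l1 l2 : Cseries a l1 -> Cseries a l2 -> l1 = l2.
Proof.
  intros [A1 A2] [B1 B2]; apply C_eq.
  - rewrite <- (is_series_unique _ _ A1); apply is_series_unique, B1.
  - rewrite <- (is_series_unique _ _ A2); apply is_series_unique, B2.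
Qed.

Lemma Cseries_plus (a b : nat -> C) la lb :
  Cseries a la -> Cseries b lb -> Cseries (fun n => a n + b n)%C (la + lb)%C.
Proof.
  intros [A1 A2] [B1 B2]; split;
    [ exact (is_series_plus _ _ _ _ A1 B1) | exact (is_series_plus _ _ _ _ A2 B2) ].
Qed.

Lemma Cseries_scal (c : C) (a : nat -> C) l :
  Cseries a l -> Cseries (fun n => c * a n)%C (c * l)%C.
Proof.
  intros [A1 A2]; split.
  - exact (is_series_minus _ _ _ _
      (is_series_scal_l (fst c) _ _ A1) (is_series_scal_l (snd c) _ _ A2)).
  - exact (is_series_plus _ _ _ _
      (is_series_scal_l (fst c) _ _ A2) (is_series_scal_l (snd c) _ _ A1)).
Qed.

Lemma Cseries_zero : Cseries (fun _ => RtoC 0) (RtoC 0).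
Proof.
  split; simpl; apply is_series_Reals; intros eps He; exists 0%nat; intros n _;
    replace (sum_f_R0 _ n) with 0 by (induction n; simpl; lra);
    unfold Rdist; rewrite Rminus_0_r, Rabs_R0; assumption.
Qed.

Lemma Cseries_minus (a b : nat -> C) la lb :
  Cseries a la -> Cseries b lb -> Cseries (fun n => a n - b n)%C (la - lb)%C.
Proof.
  intros A B. replace (la - lb)%C with (la + (-1) * lb)%C by ring.
  eapply Cseries_ext; [ | exact (Cseries_plus _ _ _ _ A (Cseries_scal (-1)%C _ _ B)) ].
  intros n; simpl; ring.
Qed.

(** The two components are bounded by [lb] separately; hence the factor 2, which reappears in later
    constants. *)
Lemma Cseries_dominated (a : nat -> C) (b : nat -> R) lb :
  (forall n, Cmod (a n) <= b n) -> is_series b lb ->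
  exists l, Cseries a l /\ Cmod l <= 2 * lb.
Proof.
  intros H Hb.
  assert (Eb : ex_series b) by (exists lb; exact Hb).
  assert (H1 : forall n, Rabs (Re (a n)) <= b n)
    by (intros n; eapply Rle_trans; [ apply re_le_Cmod | apply H ]).
  assert (H2 : forall n, Rabs (Im (a n)) <= b n)
    by (intros n; eapply Rle_trans; [ apply im_le_Cmod | apply H ]).
  assert (E1 : ex_series (fun n => Rabs (Re (a n)))).
  { apply (ex_series_le (K := R_AbsRing) (V := R_CompleteNormedModule)) with b; [ | exact Eb ].
    intros n; change (Rabs (Rabs (Re (a n))) <= b n); rewrite Rabs_Rabsolu; apply H1. }
  assert (E2 : ex_series (fun n => Rabs (Im (a n)))).
  { apply (ex_series_le (K := R_AbsRing) (V := R_CompleteNormedModule)) with b; [ | exact Eb ].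
    intros n; change (Rabs (Rabs (Im (a n))) <= b n); rewrite Rabs_Rabsolu; apply H2. }
  exists (Series (fun n => Re (a n)), Series (fun n => Im (a n))); split.
  - split; simpl; apply Series_correct; apply ex_series_Rabs; assumption.
  - eapply Rle_trans; [ apply Cmod_le_add | simpl ].
    rewrite <- (is_series_unique _ _ Hb).
    assert (B1 : Rabs (Series (fun n => Re (a n))) <= Series b).
    { eapply Rle_trans; [ apply Series_Rabs; exact E1 | ].
      apply Series_le; [ intros n; split; [ apply Rabs_pos | apply H1 ] | exact Eb ]. }
    assert (B2 : Rabs (Series (fun n => Im (a n))) <= Series b).
    { eapply Rle_trans; [ apply Series_Rabs; exact E2 | ].
      apply Series_le; [ intros n; split; [ apply Rabs_pos | apply H2 ] | exact Eb ]. }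
    lra.
Qed.

(** The majorants [A] and [B] make all four component series absolutely convergent, so their real
    Cauchy products can be combined. *)
Lemma Cseries_mult (a b : nat -> C) la lb (A B : nat -> R) :
  Cseries a la -> Cseries b lb ->
  (forall n, Cmod (a n) <= A n) -> ex_series A ->
  (forall n, Cmod (b n) <= B n) -> ex_series B ->
  Cseries (fun n => sum_n (fun k => a k * b (n - k)%nat)%C n) (la * lb)%C.
Proof.
  intros [A1 A2] [B1 B2] HA EA HB EB.
  assert (dom : forall (f : C -> R) (u : nat -> C) (U : nat -> R),
    (forall c, Rabs (f c) <= Cmod c) -> (forall n, Cmod (u n) <= U n) -> ex_series U ->
    ex_series (fun n => Rabs (f (u n)))).
  { intros f u U Hf HU EU.
    apply (ex_series_le (K := R_AbsRing) (V := R_CompleteNormedModule)) with U; [ | exact EU ].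
    intros n; change (Rabs (Rabs (f (u n))) <= U n); rewrite Rabs_Rabsolu.
    eapply Rle_trans; [ apply Hf | apply HU ]. }
  assert (a1 := dom Re a A re_le_Cmod HA EA).
  assert (a2 := dom Im a A im_le_Cmod HA EA).
  assert (b1 := dom Re b B re_le_Cmod HB EB).
  assert (b2 := dom Im b B im_le_Cmod HB EB).
  split.
  - eapply is_series_ext; [ | exact (is_series_minus _ _ _ _
      (is_series_mult _ _ _ _ A1 B1 a1 b1) (is_series_mult _ _ _ _ A2 B2 a2 b2)) ].
    intros n; rewrite Re_sum_n, <- !sum_n_Reals.
    change (sum_n (fun k => (Re (a k) * Re (b (n - k)%nat))) n
      - sum_n (fun k => (Im (a k) * Im (b (n - k)%nat))) n
      = sum_n (fun k => Re (a k * b (n - k)%nat)%C) n).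
    rewrite !sum_n_Reals, <- minus_sum; reflexivity.
  - eapply is_series_ext; [ | exact (is_series_plus _ _ _ _
      (is_series_mult _ _ _ _ A1 B2 a1 b2) (is_series_mult _ _ _ _ A2 B1 a2 b1)) ].
    intros n; rewrite Im_sum_n, <- !sum_n_Reals.
    change (sum_n (fun k => (Re (a k) * Im (b (n - k)%nat))) n
      + sum_n (fun k => (Im (a k) * Re (b (n - k)%nat))) n
      = sum_n (fun k => Im (a k * b (n - k)%nat)%C) n).
    rewrite !sum_n_Reals, <- plus_sum; reflexivity.
Qed.

(** * Derivatives of complex-valued functions of a real variable *)

Definition is_Cderive (f : R -> C) (x : R) (l : C) : Prop :=
  is_derive (fun t => Re (f t)) x (Re l) /\ is_derive (fun t => Im (f t)) x (Im l).

Lemma is_Cderive_ext_loc (f g : R -> C) x l :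
  locally x (fun t => f t = g t) -> is_Cderive f x l -> is_Cderive g x l.
Proof.
  intros H [H1 H2]; split;
    (eapply is_derive_ext_loc; [ | eassumption ]);
    (eapply filter_imp; [ | exact H ]); intros t Ht; simpl; rewrite Ht; reflexivity.
Qed.

Lemma is_Cderive_eq (f : R -> C) x l l' : is_Cderive f x l -> l = l' -> is_Cderive f x l'.
Proof. intros H <-; exact H. Qed.

Lemma is_Cderive_const (c : C) x : is_Cderive (fun _ => c) x (RtoC 0).
Proof. split; simpl; apply @is_derive_const. Qed.

Lemma is_Cderive_RtoC (f : R -> R) x l :
  is_derive f x l -> is_Cderive (fun t => RtoC (f t)) x (RtoC l).
Proof. intros H; split; simpl; [ exact H | apply @is_derive_const ]. Qed.

Lemma is_Cderive_plus (f g : R -> C) x lf lg :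
  is_Cderive f x lf -> is_Cderive g x lg ->
  is_Cderive (fun t => f t + g t)%C x (lf + lg)%C.
Proof.
  intros [F1 F2] [G1 G2]; split;
    [ exact (is_derive_plus _ _ _ _ _ F1 G1) | exact (is_derive_plus _ _ _ _ _ F2 G2) ].
Qed.

Lemma is_derive_Rmult (f g : R -> R) x lf lg :
  is_derive f x lf -> is_derive g x lg ->
  is_derive (fun t => f t * g t) x (lf * g x + f x * lg).
Proof. intros F G; apply (is_derive_mult f g); try assumption; intros; apply Rmult_comm. Qed.

Lemma is_Cderive_mult (f g : R -> C) x lf lg :
  is_Cderive f x lf -> is_Cderive g x lg ->
  is_Cderive (fun t => f t * g t)%C x (lf * g x + f x * lg)%C.
Proof.
  intros [F1 F2] [G1 G2]; split.
  - eapply is_derive_ext; [ | replace (Re _) with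
      ((Re lf * Re (g x) + Re (f x) * Re lg) - (Im lf * Im (g x) + Im (f x) * Im lg));
      [ exact (is_derive_minus _ _ _ _ _ (is_derive_Rmult _ _ _ _ _ F1 G1)
          (is_derive_Rmult _ _ _ _ _ F2 G2)) | unfold Re, Im; simpl; ring ] ].
    intros t; reflexivity.
  - eapply is_derive_ext; [ | replace (Im _) with
      ((Re lf * Im (g x) + Re (f x) * Im lg) + (Im lf * Re (g x) + Im (f x) * Re lg));
      [ exact (is_derive_plus _ _ _ _ _ (is_derive_Rmult _ _ _ _ _ F1 G2)
          (is_derive_Rmult _ _ _ _ _ F2 G1)) | unfold Re, Im; simpl; ring ] ].
    intros t; reflexivity.
Qed.

Lemma is_Cderive_scal (c : C) (f : R -> C) x l :
  is_Cderive f x l -> is_Cderive (fun t => c * f t)%C x (c * l)%C.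
Proof.
  intros H. eapply is_Cderive_eq;
    [ exact (is_Cderive_mult _ _ _ _ _ (is_Cderive_const c x) H) | cbv beta; ring ].
Qed.

Lemma is_Cderive_comp (f : R -> C) (g : R -> R) x l dg :
  is_Cderive f (g x) l -> is_derive g x dg ->
  is_Cderive (fun t => f (g t)) x (RtoC dg * l)%C.
Proof.
  intros [F1 F2] G; split.
  - replace (Re _) with (scal dg (Re l)) by (unfold scal, Re, Im; simpl; unfold mult; simpl; ring).
    exact (is_derive_comp (fun t => Re (f t)) g x _ _ F1 G).
  - replace (Im _) with (scal dg (Im l)) by (unfold scal, Re, Im; simpl; unfold mult; simpl; ring).
    exact (is_derive_comp (fun t => Im (f t)) g x _ _ F2 G).
Qed.

Lemma is_Cderive_Cexp (f : R -> C) x l :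
  is_Cderive f x l -> is_Cderive (fun t => Cexp (f t)) x (l * Cexp (f x))%C.
Proof.
  intros [F1 F2].
  assert (E := is_derive_comp exp _ x _ _ (is_derive_exp _) F1).
  assert (Co := is_derive_comp cos _ x _ _ (is_derive_cos _) F2).
  assert (Si := is_derive_comp sin _ x _ _ (is_derive_sin _) F2).
  unfold scal in *; simpl in *; unfold mult in *; simpl in *.
  split.
  - eapply is_derive_ext; [ | replace (Re _) with
      ((Re l * exp (Re (f x))) * cos (Im (f x)) + exp (Re (f x)) * (Im l * - sin (Im (f x))));
      [ exact (is_derive_Rmult _ _ _ _ _ E Co) | unfold Cexp, Re, Im; simpl; ring ] ].
    intros t; unfold Cexp, Re, Im; simpl; ring.
  - eapply is_derive_ext; [ | replace (Im _) with
      ((Re l * exp (Re (f x))) * sin (Im (f x)) + exp (Re (f x)) * (Im l * cos (Im (f x))));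
      [ exact (is_derive_Rmult _ _ _ _ _ E Si) | unfold Cexp, Re, Im; simpl; ring ] ].
    intros t; unfold Cexp, Re, Im; simpl; ring.
Qed.

(** A complex-valued function need not have a common intermediate point for its two components, so
    each is treated alone; this costs the factor 2. *)
Lemma C_mean_value (f f' : R -> C) (a b M : R) : a <= b ->
  (forall x, a <= x <= b -> is_Cderive f x (f' x)) ->
  (forall x, a <= x <= b -> Cmod (f' x) <= M) ->
  Cmod (f b - f a)%C <= 2 * M * (b - a).
Proof.
  intros Hab Hd HM.
  assert (comp : forall (p : C -> R), (forall c, Rabs (p c) <= Cmod c) ->
    (forall x, a <= x <= b -> is_derive (fun t => p (f t)) x (p (f' x))) ->
    Rabs (p (f b) - p (f a)) <= M * (b - a)).
  { intros p Hp Hdp.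
    destruct (MVT_gen (fun t => p (f t)) a b (fun x => p (f' x))) as [c [Hc E]].
    - intros x Hx; rewrite Rmin_left, Rmax_right in Hx by lra; apply Hdp; lra.
    - intros x Hx; rewrite Rmin_left, Rmax_right in Hx by lra.
      apply derivable_continuous_pt; exists (p (f' x)); apply is_derive_Reals, Hdp; lra.
    - rewrite Rmin_left, Rmax_right in Hc by lra.
      simpl in E; rewrite E, Rabs_mult, (Rabs_pos_eq (b - a)) by lra.
      apply Rmult_le_compat_r; [ lra | ].
      eapply Rle_trans; [ apply Hp | apply HM; lra ]. }
  eapply Rle_trans; [ apply Cmod_le_add | ].
  assert (C1 := comp Re re_le_Cmod (fun x Hx => proj1 (Hd x Hx))).
  assert (C2 := comp Im im_le_Cmod (fun x Hx => proj2 (Hd x Hx))).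
  change (Re (f b - f a)%C) with (Re (f b) - Re (f a)).
  change (Im (f b - f a)%C) with (Im (f b) - Im (f a)).
  lra.
Qed.

(** * The complex exponential *)

Lemma Cexp_plus (z w : C) : Cexp (z + w)%C = (Cexp z * Cexp w)%C.
Proof.
  apply C_eq; unfold Cexp; simpl; unfold Re, Im;
    rewrite exp_plus, ?cos_plus, ?sin_plus; ring.
Qed.

Lemma Cexp_0 : Cexp 0 = RtoC 1.
Proof. apply C_eq; unfold Cexp; simpl; rewrite exp_0, ?cos_0, ?sin_0; ring. Qed.

Lemma Cmod_Cexp (z : C) : Cmod (Cexp z) = exp (Re z).
Proof.
  unfold Cexp; rewrite Cmod_mult, Cmod_R, Rabs_pos_eq by (left; apply exp_pos).
  unfold Cmod; simpl.
  replace (_ + _) with 1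
    by (rewrite !Rmult_1_r; generalize (sin2_cos2 (Im z)); unfold Rsqr; lra).
  rewrite sqrt_1; ring.
Qed.

Lemma Cexp_neq_0 (z : C) : Cexp z <> RtoC 0.
Proof.
  intros H; generalize (Cmod_Cexp z); rewrite H, Cmod_0.
  generalize (exp_pos (Re z)); lra.
Qed.

Lemma Cexp_opp (z : C) : Cexp (- z)%C = (/ Cexp z)%C.
Proof.
  assert (H := Cexp_neq_0 z).
  assert (E : (Cexp (- z) * Cexp z = 1)%C)
    by (rewrite <- Cexp_plus, <- Cexp_0; f_equal; ring).
  rewrite <- (Cmult_1_r (Cexp (- z)%C)), <- (Cinv_r (Cexp z)), Cmult_assoc, E by exact H; ring.
Qed.

(** * Complex powers of positive reals *)

Definition Rcpow (x : R) (w : C) : C := Cexp (w * RtoC (ln x))%C.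

Lemma Clog_RtoC (x : R) : 0 < x -> Clog (RtoC x) = RtoC (ln x).
Proof.
  intros Hx; unfold Clog, Carg; apply C_eq; simpl.
  - rewrite Cmod_R, Rabs_pos_eq by lra; reflexivity.
  - destruct (Rlt_dec 0 0) as [H|_]; [ lra | ].
    rewrite Cmod_R, Rabs_pos_eq by lra.
    replace (x / x) with 1 by (field; lra); apply acos_1.
Qed.

Lemma Cpower_RtoC (x : R) (w : C) : 0 < x -> Cpower (RtoC x) w = Rcpow x w.
Proof. intros Hx; unfold Cpower, Rcpow; rewrite Clog_RtoC by exact Hx; reflexivity. Qed.

Lemma Cmod_Rcpow (x : R) (w : C) : Cmod (Rcpow x w) = Rpower x (Re w).
Proof.
  unfold Rcpow, Rpower; rewrite Cmod_Cexp; f_equal; simpl; unfold Re; ring.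
Qed.

Lemma Rcpow_plus (x : R) (v w : C) : Rcpow x (v + w)%C = (Rcpow x v * Rcpow x w)%C.
Proof. unfold Rcpow; rewrite <- Cexp_plus; f_equal; ring. Qed.

Lemma Rcpow_opp (x : R) (w : C) : Rcpow x (- w)%C = (/ Rcpow x w)%C.
Proof. unfold Rcpow; rewrite <- Cexp_opp; f_equal; ring. Qed.

Lemma Rcpow_mult (x y : R) (w : C) : 0 < x -> 0 < y ->
  Rcpow (x * y) w = (Rcpow x w * Rcpow y w)%C.
Proof.
  intros Hx Hy; unfold Rcpow; rewrite ln_mult, <- Cexp_plus by assumption.
  f_equal; rewrite RtoC_plus; ring.
Qed.

Lemma Rcpow_inv (x : R) (w : C) : 0 < x -> Rcpow (/ x) w = (/ Rcpow x w)%C.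
Proof.
  intros Hx; unfold Rcpow; rewrite ln_Rinv, <- Cexp_opp by assumption.
  f_equal; rewrite RtoC_opp; ring.
Qed.

Lemma Rcpow_nat (x : R) (n : nat) : 0 < x -> Rcpow x (RtoC (INR n)) = RtoC (x ^ n).
Proof.
  intros Hx; unfold Rcpow, Cexp; rewrite <- Rpower_pow by exact Hx; unfold Rpower.
  apply C_eq; simpl; unfold Re, Im; simpl;
    rewrite ?Rmult_0_r, ?Rmult_0_l, ?Rplus_0_r, ?Rminus_0_r, ?cos_0, ?sin_0; ring.
Qed.

Lemma is_Cderive_Rcpow (x : R) (w : C) : 0 < x ->
  is_Cderive (fun t => Rcpow t w) x (w * Rcpow x (w - 1)%C)%C.
Proof.
  intros Hx.
  eapply is_Cderive_eq.
  - apply is_Cderive_Cexp, is_Cderive_scal, is_Cderive_RtoC, is_derive_Reals.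
    apply derivable_pt_lim_ln; exact Hx.
  - cbv beta; fold (Rcpow x w).
    assert (E : Rcpow x w = (Rcpow x (w - 1) * RtoC x)%C).
    { rewrite <- (pow_1 x) at 3; rewrite <- (Rcpow_nat x 1 Hx), <- Rcpow_plus.
      f_equal; simpl; ring. }
    rewrite E, RtoC_inv by lra; field.
    intros H; apply RtoC_inj in H; lra.
Qed.

(** * Symbol-type estimates *)

(* On D, the i-th derivative of f is at most C x^(a-i) for every i <= r. *)
Fixpoint derivs_le (D : R -> Prop) (r : nat) (a C0 : R) (f : R -> C) : Prop :=
  (forall x, D x -> Cmod (f x) <= C0 * Rpower x a) /\
  match r with
  | O => True
  | S r' => exists f' : R -> C,
      (forall x, D x -> is_Cderive f x (f' x)) /\ derivs_le D r' (a - 1) C0 f'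
  end.

Definition derivs_O (D : R -> Prop) (r : nat) (a : R) (f : R -> C) : Prop :=
  exists C0, 0 <= C0 /\ derivs_le D r a C0 f.

Lemma Rpower_pos (x a : R) : 0 < Rpower x a.
Proof. apply exp_pos. Qed.

Lemma derivs_le_bound D r a C0 f x : derivs_le D r a C0 f -> D x -> Cmod (f x) <= C0 * Rpower x a.
Proof. destruct r; intros [H _]; apply H. Qed.

Lemma derivs_le_mono D r : forall a C0 C1 f,
  C0 <= C1 -> derivs_le D r a C0 f -> derivs_le D r a C1 f.
Proof.
  induction r; intros a C0 C1 f Hc [H1 H2]; split.
  1, 3: intros x Hx; eapply Rle_trans; [ apply H1, Hx | ];
    apply Rmult_le_compat_r; [ left; apply Rpower_pos | exact Hc ].
  - exact I.
  - destruct H2 as [f' [Hd Hs]]; exists f'; split; [ exact Hd | eapply IHr; eassumption ].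
Qed.

Lemma derivs_le_restrict (D D' : R -> Prop) r : forall a C0 f,
  (forall x, D' x -> D x) -> derivs_le D r a C0 f -> derivs_le D' r a C0 f.
Proof.
  induction r; intros a C0 f HD [H1 H2]; (split; [ intros x Hx; apply H1, HD, Hx | ]).
  - exact I.
  - destruct H2 as [f' [Hd Hs]]; exists f'; split; [ intros x Hx; apply Hd, HD, Hx | ].
    apply IHr; assumption.
Qed.

Lemma derivs_le_pred D r : forall a C0 f, derivs_le D (S r) a C0 f -> derivs_le D r a C0 f.
Proof.
  induction r; intros a C0 f [H1 [f' [Hd Hs]]]; (split; [ exact H1 | ]); [ exact I | ].
  exists f'; split; [ exact Hd | apply IHr, Hs ].
Qed.

(** Each differentiation lowers both exponents by one, which multiplies both sides of the comparison
    by the same positive factor; one [K] therefore serves all orders. *)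
Lemma derivs_le_weaken D r K : forall a a' C0 f, 0 <= C0 ->
  (forall x, D x -> Rpower x a <= K * Rpower x a') ->
  derivs_le D r a C0 f -> derivs_le D r a' (C0 * K) f.
Proof.
  induction r; intros a a' C0 f HC HK [H1 H2].
  1, 2: split; [ intros x Hx; eapply Rle_trans; [ apply H1, Hx | ];
    rewrite Rmult_assoc; apply Rmult_le_compat_l; [ exact HC | apply HK, Hx ] | ].
  - exact I.
  - destruct H2 as [f' [Hd Hs]]; exists f'; split; [ exact Hd | ].
    apply IHr with (a - 1); [ exact HC | | exact Hs ].
    intros x Hx; specialize (HK x Hx).
    unfold Rminus; rewrite !Rpower_plus, <- Rmult_assoc.
    apply Rmult_le_compat_r; [ left; apply Rpower_pos | exact HK ].
Qed.

Lemma derivs_le_ext (D : R -> Prop) r : (forall x, D x -> locally x D) -> forall a C0 f g,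
  (forall x, D x -> f x = g x) -> derivs_le D r a C0 f -> derivs_le D r a C0 g.
Proof.
  intros HD; destruct r; intros a C0 f g E [H1 H2];
    (split; [ intros x Hx; rewrite <- E by exact Hx; apply H1, Hx | ]).
  - exact I.
  - destruct H2 as [f' [Hd Hs]]; exists f'; split; [ | exact Hs ].
    intros x Hx; apply is_Cderive_ext_loc with f; [ | apply Hd, Hx ].
    eapply filter_imp; [ exact E | apply HD, Hx ].
Qed.

Lemma derivs_le_zero D r : forall a, derivs_le D r a 0 (fun _ => RtoC 0).
Proof.
  induction r; intros a; (split; [ intros x _; rewrite Cmod_0; lra | ]).
  - exact I.
  - exists (fun _ => RtoC 0); split; [ intros; apply is_Cderive_const | apply IHr ].
Qed.

Lemma derivs_le_plus D r : forall a C1 C2 f g,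
  derivs_le D r a C1 f -> derivs_le D r a C2 g ->
  derivs_le D r a (C1 + C2) (fun x => f x + g x)%C.
Proof.
  induction r; intros a C1 C2 f g [F1 F2] [G1 G2]; split.
  1, 3: intros x Hx; eapply Rle_trans; [ apply Cmod_triangle | ];
    specialize (F1 x Hx); specialize (G1 x Hx); lra.
  - exact I.
  - destruct F2 as [f' [Fd Fs]], G2 as [g' [Gd Gs]].
    exists (fun x => f' x + g' x)%C; split.
    + intros x Hx; apply is_Cderive_plus; [ apply Fd, Hx | apply Gd, Hx ].
    + apply IHr; assumption.
Qed.

Lemma derivs_le_scal D r (c : C) : forall a C0 f,
  derivs_le D r a C0 f -> derivs_le D r a (Cmod c * C0) (fun x => c * f x)%C.
Proof.
  induction r; intros a C0 f [H1 H2]; split.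
  1, 3: intros x Hx; rewrite Cmod_mult, Rmult_assoc;
    apply Rmult_le_compat_l; [ apply Cmod_ge_0 | apply H1, Hx ].
  - exact I.
  - destruct H2 as [f' [Hd Hs]]; exists (fun x => c * f' x)%C; split.
    + intros x Hx; apply is_Cderive_scal, Hd, Hx.
    + apply IHr, Hs.
Qed.

(** Leibniz' rule: each differentiation doubles the number of products, which gives [2 ^ r]. *)
Lemma derivs_le_mult D r : forall a b C1 C2 f g, 0 <= C1 -> 0 <= C2 ->
  derivs_le D r a C1 f -> derivs_le D r b C2 g ->
  derivs_le D r (a + b) (2 ^ r * (C1 * C2)) (fun x => f x * g x)%C.
Proof.
  induction r; intros a b C1 C2 f g HC1 HC2 F G.
  - split; [ | exact I ].
    intros x Hx; destruct F as [F _], G as [G _].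
    rewrite Cmod_mult, Rpower_plus; simpl.
    replace (1 * (C1 * C2) * (Rpower x a * Rpower x b))
      with ((C1 * Rpower x a) * (C2 * Rpower x b)) by ring.
    apply Rmult_le_compat; try apply Cmod_ge_0; auto.
  - assert (HC : 0 <= C1 * C2) by (apply Rmult_le_pos; assumption).
    assert (H2 : 1 <= 2 ^ r) by (apply pow_R1_Rle; lra).
    split.
    + intros x Hx.
      eapply Rle_trans.
      { eapply (derivs_le_bound D r _ _ (fun t => f t * g t)%C); [ | exact Hx ].
        apply IHr; [ exact HC1 | exact HC2 | | ]; apply derivs_le_pred; eassumption. }
      apply Rmult_le_compat_r; [ left; apply Rpower_pos | simpl; nra ].
    + destruct F as [F1 [f' [Fd Fs]]], G as [G1 [g' [Gd Gs]]].
      exists (fun x => f' x * g x + f x * g' x)%C; split.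
      * intros x Hx; apply is_Cderive_mult; [ apply Fd, Hx | apply Gd, Hx ].
      * replace (2 ^ S r * (C1 * C2)) with (2 ^ r * (C1 * C2) + 2 ^ r * (C1 * C2))
          by (simpl; ring).
        apply derivs_le_plus.
        -- replace (a + b - 1) with ((a - 1) + b) by ring.
           apply IHr; try assumption; apply derivs_le_pred; split; [ exact G1 | ].
           exists g'; split; assumption.
        -- replace (a + b - 1) with (a + (b - 1)) by ring.
           apply IHr; try assumption; apply derivs_le_pred; split; [ exact F1 | ].
           exists f'; split; assumption.
Qed.

(** The chain rule gives lam^(-i) at the i-th derivative and (x / lam)^(a - i) gives lam^(i - a), so
    every order gains the same factor lam^(-a). This is the source of the power of n in the error
    term. *)
Lemma derivs_le_scale r lam : 0 < lam -> forall a C0 f,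
  derivs_le (fun x => 0 < x) r a C0 f ->
  derivs_le (fun x => 0 < x) r a (C0 * Rpower lam (- a)) (fun x => f (x / lam)).
Proof.
  intros Hl; induction r; intros a C0 f [H1 H2];
    (split; [ intros x Hx; assert (Hq : 0 < x / lam)
                by (apply Rdiv_lt_0_compat; assumption);
              eapply Rle_trans; [ apply H1, Hq | right ];
              unfold Rpower; rewrite ln_div, Rmult_assoc, <- exp_plus by assumption;
              do 2 f_equal; ring
            | ]).
  - exact I.
  - destruct H2 as [f' [Hd Hs]].
    exists (fun x : R => RtoC (/ lam) * f' (x / lam)%R)%C; split.
    + intros x Hx. apply (is_Cderive_comp f (fun t => t / lam)).
      * apply Hd, Rdiv_lt_0_compat; assumption.
      * auto_derive; [ exact I | field; lra ].
    + replace (C0 * Rpower lam (- a))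
        with (Cmod (RtoC (/ lam)) * (C0 * Rpower lam (- (a - 1)))).
      * apply derivs_le_scal, IHr, Hs.
      * rewrite Cmod_R, Rabs_pos_eq by (left; apply Rinv_0_lt_compat, Hl).
        replace (- (a - 1)) with (- a + 1) by ring.
        rewrite Rpower_plus, Rpower_1 by exact Hl; field; lra.
Qed.

(** On the overlap the two derivatives agree by uniqueness, so the function defined by cases on [D1]
    is a derivative on both sets and inherits both bounds. *)
Lemma derivs_le_glue (D1 D2 : R -> Prop) r :
  (forall x, {D1 x} + {~ D1 x}) -> (forall x, D1 x -> locally x D1) ->
  (forall x, D2 x -> locally x D2) -> forall a C0 f,
  derivs_le D1 r a C0 f -> derivs_le D2 r a C0 f -> 
  derivs_le (fun x => D1 x \/ D2 x) r a C0 f.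
Proof.
  intros dec O1 O2; induction r; intros a C0 f [F1 F2] [G1 G2];
    (split; [ intros x [Hx|Hx]; auto | ]).
  - exact I.
  - destruct F2 as [f' [Fd Fs]], G2 as [g' [Gd Gs]].
    exists (fun x => if dec x then f' x else g' x); split.
    + intros x Hx; destruct (dec x) as [H|H]; [ apply Fd, H | ].
      destruct Hx as [Hx|Hx]; [ contradiction | apply Gd, Hx ].
    + apply IHr.
      * apply derivs_le_ext with f'; [ exact O1 | | exact Fs ].
        intros x Hx; destruct (dec x); [ reflexivity | contradiction ].
      * apply derivs_le_ext with g'; [ exact O2 | | exact Gs ].
        intros x Hx; destruct (dec x) as [H|H]; [ | reflexivity ].
        apply C_eq;
          [ rewrite <- (is_derive_unique _ _ _ (proj1 (Gd x Hx)));
            apply is_derive_unique, (proj1 (Fd x H))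
          | rewrite <- (is_derive_unique _ _ _ (proj2 (Gd x Hx)));
            apply is_derive_unique, (proj2 (Fd x H)) ].
Qed.

Lemma derivs_O_restrict (D D' : R -> Prop) r a f :
  (forall x, D' x -> D x) -> derivs_O D r a f -> derivs_O D' r a f.
Proof.
  intros H [C0 [HC Hs]]; exists C0; split; [ exact HC | eapply derivs_le_restrict; eassumption ].
Qed.

Lemma derivs_O_pred D r a f : derivs_O D (S r) a f -> derivs_O D r a f.
Proof. intros [C0 [HC Hs]]; exists C0; split; [ exact HC | apply derivs_le_pred, Hs ]. Qed.

Lemma derivs_O_weaken D r a a' K f : 0 <= K ->
  (forall x, D x -> Rpower x a <= K * Rpower x a') -> derivs_O D r a f -> derivs_O D r a' f.
Proof.
  intros HK H [C0 [HC Hs]]; exists (C0 * K); split; [ apply Rmult_le_pos; assumption | ].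
  eapply derivs_le_weaken; eassumption.
Qed.

Lemma derivs_O_ext (D : R -> Prop) r a f g : (forall x, D x -> locally x D) ->
  (forall x, D x -> f x = g x) -> derivs_O D r a f -> derivs_O D r a g.
Proof.
  intros HD E [C0 [HC Hs]]; exists C0; split; [ exact HC | eapply derivs_le_ext; eassumption ].
Qed.

Lemma derivs_O_plus D r a f g :
  derivs_O D r a f -> derivs_O D r a g -> derivs_O D r a (fun x => f x + g x)%C.
Proof.
  intros [C1 [H1 F]] [C2 [H2 G]]; exists (C1 + C2); split; [ lra | ].
  apply derivs_le_plus; assumption.
Qed.

Lemma derivs_O_scal D r a (c : C) f :
  derivs_O D r a f -> derivs_O D r a (fun x => c * f x)%C.
Proof.
  intros [C1 [H1 F]]; exists (Cmod c * C1); split;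
    [ apply Rmult_le_pos; [ apply Cmod_ge_0 | exact H1 ] | apply derivs_le_scal; exact F ].
Qed.

Lemma derivs_O_mult D r a b f g :
  derivs_O D r a f -> derivs_O D r b g -> derivs_O D r (a + b) (fun x => f x * g x)%C.
Proof.
  intros [C1 [H1 F]] [C2 [H2 G]]; exists (2 ^ r * (C1 * C2)); split.
  - apply Rmult_le_pos; [ apply pow_le; lra | apply Rmult_le_pos; assumption ].
  - apply derivs_le_mult; assumption.
Qed.

Lemma derivs_O_zero D r a : derivs_O D r a (fun _ => RtoC 0).
Proof. exists 0; split; [ lra | apply derivs_le_zero ]. Qed.

Lemma derivs_O_S D r a f f' :
  (exists C0, forall x, D x -> Cmod (f x) <= C0 * Rpower x a) ->
  (forall x, D x -> is_Cderive f x (f' x)) -> derivs_O D r (a - 1) f' ->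
  derivs_O D (S r) a f.
Proof.
  intros [C0 H0] Hd [C1 [H1 Hs]]; exists (Rmax C0 C1); split.
  - eapply Rle_trans; [ exact H1 | apply Rmax_r ].
  - split.
    + intros x Hx; eapply Rle_trans; [ apply H0, Hx | ].
      apply Rmult_le_compat_r; [ left; apply Rpower_pos | apply Rmax_l ].
    + exists f'; split; [ exact Hd | ].
      eapply derivs_le_mono; [ apply Rmax_r | exact Hs ].
Qed.

Lemma derivs_O_0 D a f :
  (exists C0, forall x, D x -> Cmod (f x) <= C0 * Rpower x a) -> derivs_O D 0 a f.
Proof.
  intros [C0 H0]; exists (Rmax C0 0); split; [ apply Rmax_r | split; [ | exact I ] ].
  intros x Hx; eapply Rle_trans; [ apply H0, Hx | ].
  apply Rmult_le_compat_r; [ left; apply Rpower_pos | apply Rmax_l ].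
Qed.

Lemma derivs_O_glue (D1 D2 : R -> Prop) r a f :
  (forall x, {D1 x} + {~ D1 x}) -> (forall x, D1 x -> locally x D1) ->
  (forall x, D2 x -> locally x D2) -> 
  derivs_O D1 r a f -> derivs_O D2 r a f -> derivs_O (fun x => D1 x \/ D2 x) r a f.
Proof.
  intros dec O1 O2 [C1 [H1 F]] [C2 [H2 G]]; exists (Rmax C1 C2); split.
  - eapply Rle_trans; [ exact H1 | apply Rmax_l ].
  - apply derivs_le_glue; try assumption;
      (eapply derivs_le_mono; [ | eassumption ]); [ apply Rmax_l | apply Rmax_r ].
Qed.

Lemma derivs_O_const (D : R -> Prop) r (c : C) : (forall x, D x -> 0 < x) ->
  derivs_O D r 0 (fun _ => c).
Proof.
  intros HD; assert (B : exists C0, forall x, D x -> Cmod c <= C0 * Rpower x 0).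
  { exists (Cmod c); intros x Hx; rewrite Rpower_O by apply HD, Hx; lra. }
  destruct r; [ apply derivs_O_0, B | ].
  apply derivs_O_S with (fun _ => RtoC 0);
    [ exact B | intros; apply is_Cderive_const | apply derivs_O_zero ].
Qed.

Lemma derivs_O_Rcpow (D : R -> Prop) r : (forall x, D x -> 0 < x) -> forall w : C,
  derivs_O D r (Re w) (fun x => Rcpow x w).
Proof.
  intros HD; induction r; intros w;
    assert (B : exists C0, forall x, D x -> Cmod (Rcpow x w) <= C0 * Rpower x (Re w))
      by (exists 1; intros x _; rewrite Cmod_Rcpow; lra).
  - apply derivs_O_0, B.
  - eapply derivs_O_S; [ exact B | intros x Hx; apply is_Cderive_Rcpow, HD, Hx | ].
    apply derivs_O_scal; exact (IHr (w - 1)%C).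
Qed.

(** * Backward differences *)

(* The sequence is extended by 0 to negative indices, so that summation by
   parts produces no boundary term at 0. *)
Definition bdiff (f : nat -> C) (j : nat) : C :=
  match j with O => f O | S i => f (S i) - f i end%C.

Definition bdiffn (r : nat) (f : nat -> C) : nat -> C := Nat.iter r bdiff f.

(** The difference in a real variable, to which the mean value theorem applies. It agrees with
    [bdiffn] at the indices [j >= r], where the extension by 0 is not reached. *)
Definition rdiffn (r : nat) (f : R -> C) : R -> C :=
  Nat.iter r (fun g x => (g x - g (x - 1)%R)%C) f.

Lemma bdiffn_rdiffn r f : forall j, (r <= j)%nat ->
  bdiffn r (fun i => f (INR (S i))) j = rdiffn r f (INR (S j)).
Proof.
  induction r; intros j Hj; [ reflexivity | ].
  destruct j as [|j]; [ lia | ].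
  change (bdiffn (S r) ?g) with (bdiff (bdiffn r g)); simpl bdiff.
  rewrite !IHr by lia.
  change (rdiffn (S r) f ?x) with (rdiffn r f x - rdiffn r f (x - 1)%R)%C.
  do 2 f_equal; rewrite (S_INR (S j)); ring.
Qed.

Lemma is_Cderive_rdiffn r f f' : (forall x, 1 <= x -> is_Cderive f x (f' x)) ->
  forall x, INR r + 1 <= x -> is_Cderive (rdiffn r f) x (rdiffn r f' x).
Proof.
  intros Hd; induction r; intros x Hx; [ apply Hd; simpl in Hx; lra | ].
  rewrite S_INR in Hx.
  change (is_Cderive (fun x => rdiffn r f x - rdiffn r f (x - 1)%R)%C x
    (rdiffn r f' x - rdiffn r f' (x - 1)%R)%C).
  unfold Cminus; apply is_Cderive_plus; [ apply IHr; lra | ].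
  assert (H1 : is_Cderive (rdiffn r f) (x - 1) (rdiffn r f' (x - 1))) by (apply IHr; lra).
  assert (H2 : is_derive (fun t => t - 1) x 1) by (auto_derive; [ exact I | ring ]).
  generalize (is_Cderive_scal (-1)%C _ _ _ (is_Cderive_comp _ (fun t => t - 1) x _ _ H1 H2)).
  intros H; eapply is_Cderive_eq; [ | eapply eq_trans; [ | ] ].
  - eapply is_Cderive_ext_loc; [ | exact H ].
    apply filter_forall; intros t; simpl; ring.
  - reflexivity.
  - ring.
Qed.

Lemma Rpower_anti (x y e : R) : 0 < x <= y -> e <= 0 -> Rpower y e <= Rpower x e.
Proof.
  intros [Hx Hy] He; unfold Rpower.
  assert (ln x <= ln y) by (destruct Hy as [Hy| ->]; [ left; apply ln_increasing; lra | lra ]).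
  destruct (Req_dec (e * ln y) (e * ln x)) as [ ->|N]; [ lra | ].
  left; apply exp_increasing; nra.
Qed.

(** Each difference is bounded by the derivative on an interval of length 1, at the price of a
    factor 2. Since [a - r <= 0], the power is largest at the leftmost point reached, [x - r]. *)
Lemma rdiffn_bound r : forall a C0 f, 0 <= C0 -> a - INR r <= 0 ->
  derivs_le (fun x => 1 <= x) r a C0 f ->
  forall x, INR r + 1 <= x ->
  Cmod (rdiffn r f x) <= 2 ^ r * C0 * Rpower (x - INR r) (a - INR r).
Proof.
  induction r; intros a C0 f HC Ha Hf x Hx.
  - simpl in *; rewrite !Rminus_0_r, Rmult_1_l; apply Hf; lra.
  - destruct Hf as [_ [f' [Hd Hs]]].
    rewrite S_INR in *.
    assert (Hb : forall y, x - 1 <= y <= x ->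
      Cmod (rdiffn r f' y) <= 2 ^ r * C0 * Rpower (x - (INR r + 1)) (a - (INR r + 1))).
    { intros y Hy; eapply Rle_trans;
        [ apply (IHr (a - 1) C0 f'); [ exact HC | lra | exact Hs | lra ] | ].
      apply Rmult_le_compat_l; [ apply Rmult_le_pos; [ apply pow_le; lra | exact HC ] | ].
      replace (a - 1 - INR r) with (a - (INR r + 1)) by ring.
      apply Rpower_anti; lra. }
    change (rdiffn (S r) f x) with (rdiffn r f x - rdiffn r f (x - 1)%R)%C.
    eapply Rle_trans; [ apply C_mean_value with (f' := rdiffn r f'); [ lra | | exact Hb ] | ].
    + intros y Hy; apply is_Cderive_rdiffn; [ exact Hd | lra ].
    + right; simpl; ring.
Qed.

(** Serves the indices below [r], whose differences involve the zero extension and are not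
    controlled by derivatives. *)
Lemma bdiffn_bound_crude r (f : nat -> C) M : forall j,
  (forall i, (i <= j)%nat -> Cmod (f i) <= M) -> Cmod (bdiffn r f j) <= 2 ^ r * M.
Proof.
  induction r; intros j H; [ simpl; rewrite Rmult_1_l; apply H; lia | ].
  change (bdiffn (S r) f j) with (bdiff (bdiffn r f) j).
  assert (H0 := IHr j H).
  assert (Hp : 0 <= 2 ^ r * M) by (eapply Rle_trans; [ apply Cmod_ge_0 | exact H0 ]).
  destruct j as [|j]; simpl.
  - eapply Rle_trans; [ exact H0 | nra ].
  - assert (H1 : Cmod (bdiffn r f j) <= 2 ^ r * M) by (apply IHr; intros i Hi; apply H; lia).
    unfold Cminus; eapply Rle_trans; [ apply Cmod_triangle | rewrite Cmod_opp; nra ].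
Qed.

(** [K] is chosen before [f] and [C0], because the estimate is applied to functions that vary with
    n. *)
Lemma bdiffn_bound (a : R) (r : nat) : a - INR r <= -2 ->
  exists K, 0 <= K /\ forall C0 f, 0 <= C0 ->
    derivs_le (fun x => 1 <= x) r a C0 f ->
    forall j, Cmod (bdiffn r (fun i => f (INR (S i))) j) <= K * C0 * / (INR (S j)) ^ 2.
Proof.
  intros Ha.
  (* An upper bound of x^a on [1, r + 1] for either sign of [a]; it serves the finitely many indices
     below [r]. *)
  set (P := Rpower (INR r + 1) (Rabs a)).
  assert (HP : 0 <= P) by (left; apply Rpower_pos).
  assert (H2 : 1 <= 2 ^ r) by (apply pow_R1_Rle; lra).
  assert (Hr : 0 <= INR r) by apply pos_INR.
  exists (2 ^ r * (P + 1) * (INR r + 1) ^ 2); split.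
  { apply Rmult_le_pos; [ apply Rmult_le_pos; lra | apply pow2_ge_0 ]. }
  intros C0 f HC Hf j.
  assert (Hj : 0 < INR (S j)) by (apply lt_0_INR; lia).
  assert (Hj2 : 0 < / INR (S j) ^ 2) by (apply Rinv_0_lt_compat, pow_lt, Hj).
  destruct (Nat.le_gt_cases r j) as [L|L].
  - assert (Hx : INR r + 1 <= INR (S j)) by (rewrite S_INR; apply le_INR in L; lra).
    rewrite bdiffn_rdiffn by exact L.
    eapply Rle_trans; [ apply rdiffn_bound with (a := a) (C0 := C0); try assumption; lra | ].
    set (y := INR (S j)) in *; set (e := INR r) in *.
    assert (Hb : Rpower (y - e) (a - e) <= (e + 1) ^ 2 * / y ^ 2).
    (* Since y >= e + 1, the difference y - e is at least y / (e + 1), so the shift by e costs only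
       the factor (e + 1)^2. *)
    { apply Rle_trans with (Rpower (y - e) (-2)).
      - destruct (Req_dec (y - e) 1) as [ ->|N].
        + unfold Rpower; rewrite ln_1, !Rmult_0_r; lra.
        + apply Rle_Rpower; lra.
      - replace (-2) with (- INR 2) by (simpl; ring).
        rewrite Rpower_Ropp, Rpower_pow by lra.
        replace ((e + 1) ^ 2 * / y ^ 2) with (/ (y / (e + 1)) ^ 2) by (field; lra).
        apply Rinv_le_contravar; [ apply pow_lt, Rdiv_lt_0_compat; lra | ].
        apply pow_incr; split; [ left; apply Rdiv_lt_0_compat; lra | ].
        apply Rmult_le_reg_r with (e + 1); [ lra | ].
        replace (y / (e + 1) * (e + 1)) with y by (field; lra); nra. }
    apply Rle_trans with (2 ^ r * C0 * ((e + 1) ^ 2 * / y ^ 2)).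
    + apply Rmult_le_compat_l; [ apply Rmult_le_pos; lra | exact Hb ].
    + assert (0 <= 2 ^ r * C0 * ((e + 1) ^ 2 * / y ^ 2) * P).
      { apply Rmult_le_pos; [ | exact HP ].
        apply Rmult_le_pos; [ apply Rmult_le_pos; lra | ].
        apply Rmult_le_pos; [ apply pow2_ge_0 | left; exact Hj2 ]. }
      lra.
  - apply Rle_trans with (2 ^ r * (C0 * P)).
    + apply bdiffn_bound_crude; intros i Hi.
      assert (H1 : 1 <= INR (S i)) by (rewrite S_INR; generalize (pos_INR i); lra).
      eapply Rle_trans; [ apply (derivs_le_bound _ _ _ _ _ _ Hf); exact H1 | ].
      apply Rmult_le_compat_l; [ exact HC | ].
      assert (H3 : INR (S i) <= INR r + 1).
      { rewrite S_INR; apply Rplus_le_compat_r, le_INR; lia. }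
      unfold P, Rpower.
      assert (L0 : 0 <= ln (INR (S i))) by (rewrite <- ln_1; apply ln_le; lra).
      assert (L1 : ln (INR (S i)) <= ln (INR r + 1)) by (apply ln_le; lra).
      assert (A1 := Rle_abs a); assert (A2 := Rabs_pos a).
      assert (LL : a * ln (INR (S i)) <= Rabs a * ln (INR r + 1)) by nra.
      destruct LL as [LL| ->]; [ left; apply exp_increasing, LL | lra ].
    + assert (Hq : 1 <= (INR r + 1) ^ 2 * / INR (S j) ^ 2).
      { assert (H3 : INR (S j) <= INR r + 1).
        { rewrite S_INR; apply Rplus_le_compat_r, le_INR; lia. }
        apply Rmult_le_reg_r with (INR (S j) ^ 2); [ apply pow_lt, Hj | ].
        rewrite Rmult_assoc, Rinv_l by (apply pow_nonzero; lra).
        rewrite Rmult_1_l, Rmult_1_r; apply pow_incr; lra. }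
      assert (Hc : 0 <= 2 ^ r * (P + 1) * C0)
        by (apply Rmult_le_pos; [ apply Rmult_le_pos; lra | exact HC ]).
      assert (Hd : 0 <= 2 ^ r * C0) by (apply Rmult_le_pos; lra).
      apply Rle_trans with (2 ^ r * (P + 1) * C0 * 1); [ lra | ].
      eapply Rle_trans; [ apply Rmult_le_compat_l; [ exact Hc | exact Hq ] | lra ].
Qed.

(** Comparison with a telescoping series: 1/y^2 <= 2 (1/y - 1/(y + 1)) for y >= 1. *)
Lemma ex_series_inv_square : ex_series (fun j => / INR (S j) ^ 2).
Proof.
  assert (T : is_series (fun j => 2 * (/ INR (S j) - / INR (S (S j)))) (2 * (1 - 0))).
  { apply (is_series_scal_l 2 (fun j => / INR (S j) - / INR (S (S j)))).
    change (is_lim_seq (sum_n (fun j => / INR (S j) - / INR (S (S j)))) (1 - 0)).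
    apply is_lim_seq_ext with (fun n => 1 - / INR (S (S n))).
    - induction n; [ rewrite sum_O; simpl; field | ].
      rewrite sum_Sn, <- IHn; unfold plus; simpl; ring.
    - apply is_lim_seq_minus'; [ apply is_lim_seq_const | ].
      apply (is_lim_seq_incr_1 (fun n => / INR (S n))), (is_lim_seq_incr_1 (fun n => / INR n)).
      replace (Finite 0) with (Rbar_inv p_infty) by reflexivity.
      apply is_lim_seq_inv; [ apply is_lim_seq_INR | discriminate ]. }
  apply (ex_series_le (K := R_AbsRing) (V := R_CompleteNormedModule))
    with (fun j => 2 * (/ INR (S j) - / INR (S (S j)))); [ | eexists; exact T ].
  intros j; change (Rabs (/ INR (S j) ^ 2) <= 2 * (/ INR (S j) - / INR (S (S j)))).
  assert (Hj : 1 <= INR (S j)) by (rewrite S_INR; generalize (pos_INR j); lra).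
  rewrite (S_INR (S j)); set (y := INR (S j)) in *.
  rewrite Rabs_pos_eq by (left; apply Rinv_0_lt_compat, pow_lt; lra).
  apply Rmult_le_reg_r with (y ^ 2 * (y + 1)); [ apply Rmult_lt_0_compat; [ apply pow_lt | ]; lra | ].
  replace (/ y ^ 2 * (y ^ 2 * (y + 1))) with (y + 1) by (field; lra).
  replace (2 * (/ y - / (y + 1)) * (y ^ 2 * (y + 1))) with (2 * y) by (field; lra).
  lra.
Qed.

Lemma bdiffn_ext r f g : (forall j, f j = g j) -> forall j, bdiffn r f j = bdiffn r g j.
Proof.
  intros H; induction r; intros j; [ apply H | ].
  change (bdiff (bdiffn r f) j = bdiff (bdiffn r g) j).
  destruct j; simpl; rewrite ?IHr; reflexivity.
Qed.

Lemma bdiffn_plus r f g j : bdiffn r (fun i => f i + g i)%C j = (bdiffn r f j + bdiffn r g j)%C.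
Proof.
  revert j; induction r; intros j; [ reflexivity | ].
  change (bdiff (bdiffn r (fun i => f i + g i)%C) j
    = (bdiff (bdiffn r f) j + bdiff (bdiffn r g) j)%C).
  destruct j; simpl; rewrite ?IHr; ring.
Qed.

Lemma bdiffn_scal r c f j : bdiffn r (fun i => c * f i)%C j = (c * bdiffn r f j)%C.
Proof.
  revert j; induction r; intros j; [ reflexivity | ].
  change (bdiff (bdiffn r (fun i => c * f i)%C) j = (c * bdiff (bdiffn r f) j)%C).
  destruct j; simpl; rewrite ?IHr; ring.
Qed.

Lemma Cseries_bdiffn r (g : nat -> nat -> C) (f : nat -> C) :
  (forall j, Cseries (fun k => g k j) (f j)) ->
  forall j, Cseries (fun k => bdiffn r (g k) j) (bdiffn r f j).
Proof.
  intros H; induction r; intros j; [ apply H | ].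
  destruct j; [ exact (IHr 0%nat) | ].
  exact (Cseries_minus _ _ _ _ (IHr (S j)) (IHr j)).
Qed.

(** * Power series with complex coefficients in a real variable *)

Definition CPSeries (a : nat -> C) (t : R) : C :=
  (PSeries (fun k => Re (a k)) t, PSeries (fun k => Im (a k)) t).

Definition Cradius_gt (a : nat -> C) (rho : R) : Prop :=
  Rbar_lt rho (CV_radius (fun k => Re (a k))) /\ Rbar_lt rho (CV_radius (fun k => Im (a k))).

Definition CPS_derive (a : nat -> C) (k : nat) : C := (RtoC (INR (S k)) * a (S k))%C.

Lemma Cradius_gt_bounded (a : nat -> C) (rho rho' M : R) : 0 <= rho' -> rho < rho' ->
  (forall k, Cmod (a k) * rho' ^ k <= M) -> Cradius_gt a rho.
Proof.
  intros H0 Hr HM.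
  assert (B : forall (p : C -> R), (forall c, Rabs (p c) <= Cmod c) ->
    Rbar_lt rho (CV_radius (fun k => p (a k)))).
  { intros p Hp; apply Rbar_lt_le_trans with rho'; [ exact Hr | ].
    apply (proj1 (CV_radius_bounded (fun k => p (a k)))).
    exists M; intros n; rewrite Rabs_mult, (Rabs_pos_eq (rho' ^ n)) by (apply pow_le, H0).
    eapply Rle_trans; [ | apply HM ].
    apply Rmult_le_compat_r; [ apply pow_le, H0 | apply Hp ]. }
  split; apply B; [ apply re_le_Cmod | apply im_le_Cmod ].
Qed.

Lemma Cradius_gt_le a rho rho' : rho' <= rho -> Cradius_gt a rho -> Cradius_gt a rho'.
Proof.
  intros H [H1 H2]; split; (eapply Rbar_le_lt_trans; [ | eassumption ]); exact H.
Qed.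

Lemma RtoC_pow_Re (a : C) (t : R) k : Re (a * RtoC t ^ k)%C = Re a * t ^ k.
Proof. rewrite <- RtoC_pow, re_scal_r; reflexivity. Qed.

Lemma RtoC_pow_Im (a : C) (t : R) k : Im (a * RtoC t ^ k)%C = Im a * t ^ k.
Proof. rewrite <- RtoC_pow, im_scal_r; reflexivity. Qed.

Lemma Cseries_CPSeries (a : nat -> C) (t : R) : Cradius_gt a (Rabs t) ->
  Cseries (fun k => a k * RtoC t ^ k)%C (CPSeries a t).
Proof.
  intros [H1 H2]; split.
  - eapply is_series_ext; [ | apply PSeries_correct, CV_radius_inside, H1 ].
    intros n; rewrite RtoC_pow_Re, Rmult_comm, <- pow_n_pow; reflexivity.
  - eapply is_series_ext; [ | apply PSeries_correct, CV_radius_inside, H2 ].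
    intros n; rewrite RtoC_pow_Im, Rmult_comm, <- pow_n_pow; reflexivity.
Qed.

Lemma Cradius_gt_derive a rho : Cradius_gt a rho -> Cradius_gt (CPS_derive a) rho.
Proof.
  intros [H1 H2]; split.
  - rewrite (CV_radius_ext _ (PS_derive (fun k => Re (a k)))), CV_radius_derive; [ exact H1 | ].
    intros n; unfold CPS_derive; rewrite re_scal_l; reflexivity.
  - rewrite (CV_radius_ext _ (PS_derive (fun k => Im (a k)))), CV_radius_derive; [ exact H2 | ].
    intros n; unfold CPS_derive; rewrite im_scal_l; reflexivity.
Qed.

Lemma is_Cderive_CPSeries (a : nat -> C) (t : R) : Cradius_gt a (Rabs t) ->
  is_Cderive (CPSeries a) t (CPSeries (CPS_derive a) t).
Proof.
  intros [H1 H2]; split.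
  - change (is_derive (PSeries (fun k => Re (a k))) t
      (PSeries (fun k => Re (CPS_derive a k)) t)).
    rewrite (PSeries_ext _ (PS_derive (fun k => Re (a k)))); [ apply is_derive_PSeries, H1 | ].
    intros n; unfold CPS_derive; rewrite re_scal_l; reflexivity.
  - change (is_derive (PSeries (fun k => Im (a k))) t
      (PSeries (fun k => Im (CPS_derive a k)) t)).
    rewrite (PSeries_ext _ (PS_derive (fun k => Im (a k)))); [ apply is_derive_PSeries, H2 | ].
    intros n; unfold CPS_derive; rewrite im_scal_l; reflexivity.
Qed.

Lemma CPSeries_0 (a : nat -> C) : CPSeries a 0 = a O.
Proof. apply C_eq; simpl; apply PSeries_0. Qed.

Lemma Cradius_gt_abs (a : nat -> C) (rho : R) : 0 <= rho -> Cradius_gt a rho ->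
  ex_series (fun k => Cmod (a k) * rho ^ k).
Proof.
  intros H0 [H1 H2].
  rewrite <- (Rabs_pos_eq rho) in H1, H2 by exact H0.
  apply CV_disk_inside in H1; apply CV_disk_inside in H2.
  apply (ex_series_le (K := R_AbsRing) (V := R_CompleteNormedModule))
    with (fun k => Rabs (Re (a k) * rho ^ k) + Rabs (Im (a k) * rho ^ k)).
  - intros n; change (Rabs (Cmod (a n) * rho ^ n) <= Rabs (Re (a n) * rho ^ n)
      + Rabs (Im (a n) * rho ^ n)).
    assert (P := pow_le rho n H0).
    rewrite !Rabs_mult, (Rabs_pos_eq (rho ^ n)), (Rabs_pos_eq (Cmod _)) by
      (assumption || apply Cmod_ge_0).
    rewrite <- Rmult_plus_distr_r; apply Rmult_le_compat_r; [ exact P | apply Cmod_le_add ].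
  - apply (ex_series_plus _ _ H1 H2).
Qed.

Lemma CPSeries_bounded (a : nat -> C) (rho : R) : 0 <= rho -> Cradius_gt a rho ->
  exists M, forall t, Rabs t <= rho -> Cmod (CPSeries a t) <= M.
Proof.
  intros H0 H; destruct (Cradius_gt_abs a rho H0 H) as [l Hl].
  exists (2 * l); intros t Ht.
  destruct (Cseries_dominated (fun k => a k * RtoC t ^ k)%C
    (fun k => Cmod (a k) * rho ^ k) l) as [v [Hv Hb]].
  - intros n; rewrite Cmod_mult, <- RtoC_pow, Cmod_R, <- RPow_abs.
    apply Rmult_le_compat_l; [ apply Cmod_ge_0 | apply pow_incr; split; [ apply Rabs_pos | exact Ht ] ].
  - exact Hl.
  - rewrite <- (Cseries_unique _ _ _ Hv (Cseries_CPSeries a t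
      (Cradius_gt_le _ _ _ Ht H))); exact Hb.
Qed.

(** Continuity of the sum at 0 gives a_0 = 0, and dividing by t repeats the argument for the shifted
    series. One-sidedness matters later, where t is a square and where agreement is known only to
    the right of a point. *)
Lemma pseries_right_zero (n : nat) : forall (a : nat -> R) (rho : R), 0 < rho ->
  (forall t, 0 < t < rho -> is_series (fun k => a k * t ^ k) 0) -> a n = 0.
Proof.
  assert (base : forall (a : nat -> R) (rho : R), 0 < rho ->
    (forall t, 0 < t < rho -> is_series (fun k => a k * t ^ k) 0) -> a O = 0).
  { intros a rho Hr H.
    assert (R0 : Rbar_lt (Rabs 0) (CV_radius a)).
    { rewrite Rabs_R0; apply Rbar_lt_le_trans with (Rabs (rho / 2)).
      - rewrite Rabs_pos_eq by lra; simpl; lra.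
      - apply Rbar_not_lt_le; intros Hc; apply CV_disk_outside in Hc; apply Hc.
        apply ex_series_lim_0; exists 0; apply H; lra. }
    assert (Cn := PSeries_continuity a 0 R0).
    destruct (Req_dec (a O) 0) as [E|N]; [ exact E | exfalso ].
    destruct (Cn (Rabs (a O))) as [d [Hd Hc]]; [ apply Rabs_pos_lt, N | ].
    set (t := Rmin (d / 2) (rho / 2)).
    assert (Ht : 0 < t) by (apply Rmin_pos; lra).
    assert (T1 : t <= d / 2) by apply Rmin_l; assert (T2 : t <= rho / 2) by apply Rmin_r.
    assert (E : PSeries a t = 0).
    { apply is_series_unique; eapply is_series_ext; [ | apply (H t); lra ]; intros k; reflexivity. }
    specialize (Hc t); rewrite E, PSeries_0 in Hc.
    assert (K : Rabs (0 - a O) < Rabs (a O)).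
    { apply Hc; split; [ split; [ exact I | lra ] | ].
      simpl; unfold Rdist; rewrite Rminus_0_r, Rabs_pos_eq; lra. }
    rewrite Rminus_0_l, Rabs_Ropp in K; lra. }
  induction n; intros a rho Hr H; [ eapply base; eassumption | ].
  apply (IHn (fun k => a (S k)) rho Hr).
  intros t Ht.
  assert (E0 : a O = 0) by (eapply base; eassumption).
  assert (S1 : is_series (fun k => a (S k) * t ^ S k) 0).
  { apply (is_series_incr_1 (fun k => a k * t ^ k)).
    rewrite E0, Rmult_0_l; change (plus 0 0) with (0 + 0); rewrite Rplus_0_l; apply H, Ht. }
  replace 0 with (/ t * 0) by ring.
  eapply is_series_ext; [ | apply (is_series_scal_l (/ t) _ _ S1) ].
  intros k; change (/ t * (a (S k) * (t * t ^ k)) = a (S k) * t ^ k); field; lra.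
Qed.

Lemma CPS_right_zero (a : nat -> C) (rho : R) : 0 < rho ->
  (forall t, 0 < t < rho -> Cseries (fun k => a k * RtoC t ^ k)%C (RtoC 0)) ->
  forall n, a n = RtoC 0.
Proof.
  intros Hr H n; apply C_eq; simpl.
  - apply (pseries_right_zero n (fun k => Re (a k)) rho Hr); intros t Ht.
    eapply is_series_ext; [ | exact (proj1 (H t Ht)) ]; intros k; apply RtoC_pow_Re.
  - apply (pseries_right_zero n (fun k => Im (a k)) rho Hr); intros t Ht.
    eapply is_series_ext; [ | exact (proj2 (H t Ht)) ]; intros k; apply RtoC_pow_Im.
Qed.

(** * The exponential series *)

Lemma C_constant (f : R -> C) :
  (forall t, 0 <= t <= 1 -> is_Cderive f t (RtoC 0)) -> f 1 = f 0.
Proof.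
  intros H.
  assert (B : Cmod (f 1 - f 0)%C <= 2 * 0 * (1 - 0)).
  { apply C_mean_value with (fun _ => RtoC 0); [ lra | exact H | ].
    intros; rewrite Cmod_0; lra. }
  assert (E : (f 1 - f 0 = 0)%C) by (apply Cmod_eq_0; generalize (Cmod_ge_0 (f 1 - f 0)%C); lra).
  replace (f 1) with (f 1 - f 0 + f 0)%C by ring; rewrite E; ring.
Qed.

Lemma pow_fact_le_exp (x : R) (k : nat) : 0 <= x -> x ^ k / INR (fact k) <= exp x.
Proof.
  intros Hx.
  assert (P : forall i, 0 <= x ^ i / INR (fact i)).
  { intros i; apply Rdiv_le_0_compat; [ apply pow_le, Hx | apply INR_fact_lt_0 ]. }
  assert (H : is_series (fun i => x ^ i / INR (fact i)) (exp x)).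
  { eapply is_series_ext; [ | exact (is_exp_Reals x) ].
    intros n; rewrite pow_n_pow; reflexivity. }
  assert (L : is_lim_seq (sum_n (fun i => x ^ i / INR (fact i))) (exp x)) by exact H.
  apply Rle_trans with (sum_n (fun i => x ^ i / INR (fact i)) k).
  - destruct k; [ rewrite sum_O; lra | ].
    rewrite sum_Sn.
    change (x ^ S k / INR (fact (S k)) <= sum_n (fun i => x ^ i / INR (fact i)) k
      + x ^ S k / INR (fact (S k))).
    assert (0 <= sum_n (fun i => x ^ i / INR (fact i)) k); [ | lra ].
    induction k; [ rewrite sum_O; apply P | ].
    rewrite sum_Sn; apply Rplus_le_le_0_compat; [ exact IHk | apply P ].
  - apply (is_lim_seq_incr_compare _ _ L).
    intros n; rewrite sum_Sn; change (sum_n (fun i => x ^ i / INR (fact i)) n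
      <= sum_n (fun i => x ^ i / INR (fact i)) n + x ^ S n / INR (fact (S n))).
    generalize (P (S n)); lra.
Qed.

Lemma INR_fact_neq_C (k : nat) : RtoC (INR (fact k)) <> RtoC 0.
Proof. intros H; apply RtoC_inj in H; revert H; apply INR_fact_neq_0. Qed.

Lemma Cmod_pow (z : C) k : Cmod (z ^ k)%C = Cmod z ^ k.
Proof.
  induction k; simpl; [ apply Cmod_1 | rewrite Cmod_mult, IHk; reflexivity ].
Qed.

Lemma Cradius_gt_exp (z : C) (rho : R) :
  Cradius_gt (fun k => z ^ k / RtoC (INR (fact k)))%C rho.
Proof.
  set (rho' := Rmax 0 rho + 1).
  assert (H0 : 0 <= rho' /\ rho < rho')
    by (unfold rho'; generalize (Rmax_l 0 rho) (Rmax_r 0 rho); lra).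
  apply Cradius_gt_bounded with rho' (exp (Cmod z * rho')); [ tauto | tauto | ].
  intros k; rewrite Cmod_div, Cmod_pow, Cmod_R, Rabs_pos_eq by
    (apply INR_fact_neq_C || apply pos_INR).
  eapply Rle_trans; [ right | apply (pow_fact_le_exp _ k) ].
  - rewrite Rpow_mult_distr; unfold Rdiv; ring.
  - apply Rmult_le_pos; [ apply Cmod_ge_0 | tauto ].
Qed.

Lemma CPSeries_scal (c : C) (a b : nat -> C) (t : R) : Cradius_gt a (Rabs t) ->
  Cradius_gt b (Rabs t) -> (forall k, b k = c * a k)%C -> CPSeries b t = (c * CPSeries a t)%C.
Proof.
  intros Ha Hb H.
  eapply Cseries_unique; [ apply Cseries_CPSeries, Hb | ].
  eapply Cseries_ext; [ | apply Cseries_scal, Cseries_CPSeries, Ha ].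
  intros k; simpl; rewrite H; ring.
Qed.

(** The product of the series at tz with exp(-tz) has derivative 0 for t in [0, 1]; its values at 0
    and 1 are compared. *)
Lemma Cexp_series (z : C) : Cseries (fun k => z ^ k / RtoC (INR (fact k)))%C (Cexp z).
Proof.
  set (a := fun k => (z ^ k / RtoC (INR (fact k)))%C).
  assert (R0 : forall rho, Cradius_gt a rho) by (intros; apply Cradius_gt_exp).
  assert (E : (CPSeries a 1 * Cexp (RtoC (- (1)) * z) = CPSeries a 0 * Cexp (RtoC (- (0)) * z))%C).
  { apply (C_constant (fun t => CPSeries a t * Cexp (RtoC (- t) * z))%C).
    intros t _.
    eapply is_Cderive_eq.
    - apply is_Cderive_mult; [ apply is_Cderive_CPSeries, R0 | ].
      apply is_Cderive_Cexp.
      apply (is_Cderive_ext_loc (fun t => z * RtoC (- t))%C);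
        [ apply filter_forall; intros u; ring | ].
      apply is_Cderive_scal, is_Cderive_RtoC; instantiate (1 := (-1)).
      auto_derive; [ exact I | ring ].
    - rewrite (CPSeries_scal z a (CPS_derive a)); [ rewrite RtoC_opp; ring
        | apply R0 | apply Cradius_gt_derive, R0 | ].
      intros k; unfold CPS_derive, a.
      change (fact (S k)) with (S k * fact k)%nat; rewrite mult_INR, RtoC_mult; simpl Cpow.
      field; split; [ apply INR_fact_neq_C | ].
      intros H; apply RtoC_inj in H; revert H; apply not_0_INR; lia. }
  rewrite CPSeries_0, Ropp_0, Cmult_0_l, Cexp_0, RtoC_opp in E.
  replace (- RtoC 1 * z)%C with (- z)%C in E by ring; rewrite Cexp_opp in E.
  assert (V : CPSeries a 1 = Cexp z).
  { assert (N := Cexp_neq_0 z).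
    replace (CPSeries a 1) with (CPSeries a 1 * / Cexp z * Cexp z)%C by (field; exact N).
    rewrite E; unfold a; simpl; field. }
  rewrite <- V; eapply Cseries_ext; [ | apply Cseries_CPSeries, R0 ].
  intros k; simpl; rewrite Cpow_1_l; ring.
Qed.

(** The paired partial sums are a subsequence of the original ones. In the sum or difference of the
    series of exp(iz) and exp(-iz) one term of each pair cancels, which leaves the series of cosine
    and sine. *)
Lemma Cseries_pairs (a : nat -> C) l : Cseries a l ->
  Cseries (fun k => a (2 * k)%nat + a (S (2 * k)))%C l.
Proof.
  assert (G : forall (u : nat -> R) v, is_series u v ->
    is_series (fun k => u (2 * k)%nat + u (S (2 * k))) v).
  { intros u v H.
    assert (L : is_lim_seq (sum_n u) v) by exact H.
    apply (is_lim_seq_subseq _ _ (fun n => S (2 * n))) in L;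
      [ | apply eventually_subseq; intros; lia ].
    apply (is_lim_seq_ext _ (sum_n (fun k => u (2 * k)%nat + u (S (2 * k))))) in L;
      [ exact L | ].
    induction n; [ rewrite sum_Sn, !sum_O; reflexivity | ].
    replace (S (2 * S n)) with (S (S (S (2 * n)))) by lia.
    rewrite 2!sum_Sn, IHn, (sum_Sn _ n).
    replace (2 * S n)%nat with (S (S (2 * n))) by lia.
    unfold plus; simpl; ring. }
  intros [H1 H2]; split; [ exact (G _ _ H1) | exact (G _ _ H2) ].
Qed.

(** * Iterated primitives of an odd character *)

Fixpoint csum (f : nat -> C) (n : nat) : C :=
  match n with O => RtoC 0 | S m => csum f m + f m end%C.

Lemma csum_ext f g n : (forall i, (i < n)%nat -> f i = g i) -> csum f n = csum g n.
Proof.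
  induction n; intros H; [ reflexivity | simpl ].
  rewrite IHn, H; [ reflexivity | lia | intros; apply H; lia ].
Qed.

Lemma csum_sub f g n : csum (fun i => f i - g i)%C n = (csum f n - csum g n)%C.
Proof. induction n; simpl; [ ring | rewrite IHn; ring ]. Qed.

Lemma csum_plus f g n : csum (fun i => f i + g i)%C n = (csum f n + csum g n)%C.
Proof. induction n; simpl; [ ring | rewrite IHn; ring ]. Qed.

Lemma csum_scal c f n : csum (fun i => c * f i)%C n = (c * csum f n)%C.
Proof. induction n; simpl; [ ring | rewrite IHn; ring ]. Qed.

Lemma csum_const c n : csum (fun _ => c) n = (RtoC (INR n) * c)%C.
Proof.
  induction n; [ simpl; ring | ].
  simpl csum; rewrite IHn, S_INR, RtoC_plus; ring.
Qed.

Lemma csum_split_first f n : csum f (S n) = (f O + csum (fun i => f (S i)) n)%C.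
Proof. induction n; simpl in *; [ ring | rewrite IHn; ring ]. Qed.

Lemma csum_rev n : forall f, csum f n = csum (fun i => f (n - 1 - i)%nat) n.
Proof.
  induction n; intros f; [ reflexivity | ].
  rewrite csum_split_first, (IHn (fun i => f (S i))); simpl csum.
  rewrite Cplus_comm; f_equal.
  - apply csum_ext; intros i Hi; f_equal; lia.
  - f_equal; lia.
Qed.

Lemma sum_n_csum (f : nat -> C) n : sum_n f n = csum f (S n).
Proof.
  induction n; [ rewrite sum_O; simpl; ring | ].
  rewrite sum_Sn, IHn; reflexivity.
Qed.

Lemma Cmod_csum (f : nat -> C) M n : (forall i, (i < n)%nat -> Cmod (f i) <= M) ->
  Cmod (csum f n) <= INR n * M.
Proof.
  induction n; intros H; [ simpl; rewrite Cmod_0; lra | ].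
  rewrite S_INR; simpl csum; eapply Rle_trans; [ apply Cmod_triangle | ].
  assert (H1 := H n (Nat.lt_succ_diag_r n)).
  assert (H2 : Cmod (csum f n) <= INR n * M) by (apply IHn; intros; apply H; lia).
  lra.
Qed.

(** Minus the partial sums, shifted by the constant that gives mean 0 over a period; this
    normalization keeps the next primitive periodic, hence bounded. *)
Definition mean_zero_primitive (q : nat) (a : nat -> C) (j : nat) : C :=
  (/ RtoC (INR q) * csum (csum a) q - csum a j)%C.

Lemma csum_periodic (q : nat) (a : nat -> C) : (forall j, a (j + q)%nat = a j) ->
  forall j, csum a (j + q) = (csum a j + csum a q)%C.
Proof.
  intros P; induction j; [ simpl; ring | ].
  simpl; rewrite IHj, P; ring.
Qed.

Lemma mean_zero_primitive_spec (q : nat) (a : nat -> C) : (0 < q)%nat ->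
  (forall j, a (j + q)%nat = a j) -> csum a q = RtoC 0 ->
  (forall j, mean_zero_primitive q a (j + q) = mean_zero_primitive q a j) /\
  csum (mean_zero_primitive q a) q = RtoC 0.
Proof.
  intros Hq P Z; split.
  - intros j; unfold mean_zero_primitive; rewrite csum_periodic, Z by exact P; ring.
  - unfold mean_zero_primitive; rewrite csum_sub, csum_const; field.
    intros H; apply RtoC_inj in H; revert H; apply not_0_INR; lia.
Qed.

Lemma periodic_bounded (q : nat) (a : nat -> C) : (0 < q)%nat ->
  (forall j, a (j + q)%nat = a j) -> exists M, 0 <= M /\ forall j, Cmod (a j) <= M.
Proof.
  intros Hq P.
  assert (B : forall n, exists M, 0 <= M /\ forall j, (j < n)%nat -> Cmod (a j) <= M).
  { induction n; [ exists 0; split; [ lra | intros; lia ] | ].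
    destruct IHn as [M [M0 HM]]; exists (M + Cmod (a n)).
    assert (C0 := Cmod_ge_0 (a n)); split; [ lra | ].
    intros j Hj; destruct (Nat.eq_dec j n) as [ -> |N]; [ lra | ].
    specialize (HM j ltac:(lia)); lra. }
  destruct (B q) as [M [M0 HM]]; exists M; split; [ exact M0 | ].
  induction j as [j IH] using (well_founded_induction Nat.lt_wf_0).
  destruct (Nat.lt_ge_cases j q) as [L|L]; [ apply HM, L | ].
  replace j with (j - q + q)%nat by lia; rewrite P; apply IH; lia.
Qed.

(** [A r] is the [r]-th primitive, with the sign for which summation by parts introduces no minus
    sign. Index [j] stands for the integer [j + 1]. *)
Definition character_primitives (chi : Z -> C) (A : nat -> nat -> C) : Prop :=
  (forall j, A O j = chi (Z.of_nat (S j))) /\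
  (forall r j, A r j = A (S r) j - A (S r) (S j))%C /\
  (forall r, exists M, 0 <= M /\ forall j, Cmod (A r j) <= M).

Lemma odd_character_reflect (q : nat) (chi : Z -> C) (n : nat) (j : Z) :
  dirichlet_character q chi -> odd_character chi ->
  chi (Z.of_nat (q * n) - j)%Z = (- chi j)%C.
Proof.
  intros hchi hodd.
  assert (P : forall n a, chi (a + Z.of_nat (q * n))%Z = chi a).
  { induction n0; intros a; [ f_equal; lia | ].
    replace (a + Z.of_nat (q * S n0))%Z with (a + Z.of_nat (q * n0) + Z.of_nat q)%Z by lia.
    rewrite (dirichlet_periodic q chi hchi); apply IHn0. }
  replace (Z.of_nat (q * n) - j)%Z with ((-1) * j + Z.of_nat (q * n))%Z by lia.
  rewrite P, (dirichlet_mul q chi hchi), hodd; ring.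
Qed.

Lemma odd_character_0 (q : nat) (chi : Z -> C) : (1 < q)%nat ->
  dirichlet_character q chi -> chi 0%Z = RtoC 0.
Proof.
  intros hq hchi; destruct (Ceq_dec (chi 0%Z) (RtoC 0)) as [E|N]; [ exact E | ].
  apply (dirichlet_support q chi hchi) in N; rewrite Z.gcd_0_l, Z.abs_eq in N; lia.
Qed.

Lemma exists_character_primitives (q : nat) (chi : Z -> C) : (1 < q)%nat ->
  dirichlet_character q chi -> odd_character chi -> exists A, character_primitives chi A.
Proof.
  intros hq hchi hodd.
  set (a := fun j => chi (Z.of_nat (S j))).
  assert (Z0 : csum a q = RtoC 0).
  { destruct q as [|p]; [ lia | ].
    (* The integers j and q - j contribute opposite values, so the sum over 1, ..., q - 1 equals its
       own negative. *)
    assert (E : csum a p = (- csum a p)%C).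
    { rewrite csum_rev at 1.
      rewrite (csum_ext _ (fun i => (-1) * a i)%C); [ rewrite csum_scal; ring | ].
      intros i Hi; unfold a.
      replace (Z.of_nat (S (p - 1 - i))) with (Z.of_nat (S p * 1) - Z.of_nat (S i))%Z by lia.
      rewrite (odd_character_reflect (S p)) by assumption; ring. }
    assert (E0 : csum a p = RtoC 0).
    { replace (csum a p) with ((csum a p - - csum a p) / 2)%C by (field; intros H; apply RtoC_inj in H; lra).
      rewrite <- E; field; intros H; apply RtoC_inj in H; lra. }
    (* The remaining term of the period is chi(q) = - chi(0) = 0. *)
    simpl csum; rewrite E0; unfold a.
    replace (Z.of_nat (S p)) with (Z.of_nat (S p * 1) - 0)%Z by lia.
    rewrite (odd_character_reflect (S p)), (odd_character_0 (S p)) by assumption; ring. }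
  assert (P0 : forall j, a (j + q)%nat = a j).
  { intros j; unfold a; rewrite <- (dirichlet_periodic q chi hchi (Z.of_nat (S j))); f_equal; lia. }
  assert (I : forall r, let A := Nat.iter r (mean_zero_primitive q) a in
    (forall j, A (j + q)%nat = A j) /\ csum A q = RtoC 0).
  { induction r; [ split; assumption | ].
    apply (mean_zero_primitive_spec q (Nat.iter r (mean_zero_primitive q) a)); [ lia | | ]; apply IHr. }
  exists (fun r => Nat.iter r (mean_zero_primitive q) a); split; [ reflexivity | split ].
  - intros r j; simpl; unfold mean_zero_primitive at 2 4; simpl; ring.
  - intros r; apply (periodic_bounded q); [ lia | apply (I r) ].
Qed.

(** * Summation by parts *)

Definition Cvanishes (f : nat -> C) : Prop := is_lim_seq (fun j => Cmod (f j)) 0.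

Lemma Cseries_perturb (a b e : nat -> C) l :
  (forall n, csum a (S n) = csum b (S n) + e n)%C -> Cvanishes e -> Cseries b l -> Cseries a l.
Proof.
  intros H He [B1 B2].
  assert (V : forall p : C -> R, (forall c, Rabs (p c) <= Cmod c) -> is_lim_seq (fun n => p (e n)) 0).
  { intros p Hp; apply is_lim_seq_abs_0.
    apply is_lim_seq_le_le with (fun _ => 0) (fun n => Cmod (e n));
      [ intros n; split; [ apply Rabs_pos | apply Hp ] | apply is_lim_seq_const | exact He ]. }
  split.
  - change (is_lim_seq (sum_n (fun n => Re (a n))) (Re l)).
    apply is_lim_seq_ext with (fun n => sum_n (fun k => Re (b k)) n + Re (e n)).
    + intros n; rewrite <- !Re_sum_n, !sum_n_csum, H; reflexivity.
    + replace (Finite (Re l)) with (Finite (Re l + 0)) by (f_equal; ring).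
      apply is_lim_seq_plus'; [ exact B1 | apply V, re_le_Cmod ].
  - change (is_lim_seq (sum_n (fun n => Im (a n))) (Im l)).
    apply is_lim_seq_ext with (fun n => sum_n (fun k => Im (b k)) n + Im (e n)).
    + intros n; rewrite <- !Im_sum_n, !sum_n_csum, H; reflexivity.
    + replace (Finite (Im l)) with (Finite (Im l + 0)) by (f_equal; ring).
      apply is_lim_seq_plus'; [ exact B2 | apply V, im_le_Cmod ].
Qed.

Lemma Cvanishes_le (f : nat -> C) (u : nat -> R) :
  (forall j, Cmod (f j) <= u j) -> is_lim_seq u 0 -> Cvanishes f.
Proof.
  intros H Hu; apply is_lim_seq_le_le with (fun _ => 0) u;
    [ intros n; split; [ apply Cmod_ge_0 | apply H ] | apply is_lim_seq_const | exact Hu ].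
Qed.

Lemma Cvanishes_bdiff f : Cvanishes f -> Cvanishes (bdiff f).
Proof.
  intros H; apply (proj2 (is_lim_seq_incr_1 (fun j => Cmod (bdiff f j)) 0)).
  apply (Cvanishes_le (fun j => bdiff f (S j)) (fun j => Cmod (f (S j)) + Cmod (f j))).
  - intros j; simpl; unfold Cminus; eapply Rle_trans; [ apply Cmod_triangle | ].
    rewrite Cmod_opp; lra.
  - replace (Finite 0) with (Finite (0 + 0)) by (f_equal; ring).
    apply is_lim_seq_plus'; [ apply (is_lim_seq_incr_1 (fun j => Cmod (f j))) | ]; exact H.
Qed.

Lemma Cvanishes_bounded_mult (a f : nat -> C) M : (forall j, Cmod (a j) <= M) ->
  Cvanishes f -> Cvanishes (fun j => a j * f j)%C.
Proof.
  intros HM H; apply Cvanishes_le with (fun j => M * Cmod (f j)).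
  - intros j; rewrite Cmod_mult; apply Rmult_le_compat_r; [ apply Cmod_ge_0 | apply HM ].
  - replace (Finite 0) with (Rbar_mult M 0) by (simpl; f_equal; ring).
    apply is_lim_seq_scal_l, H.
Qed.

(** The only boundary term is the upper one, [A (S r) (S n) * g n], because [bdiff] extends by 0; it
    tends to 0 since the primitives are bounded. *)
Lemma abel_step chi A r (g : nat -> C) l : character_primitives chi A -> Cvanishes g ->
  Cseries (fun j => A r j * g j)%C l <-> Cseries (fun j => A (S r) j * bdiff g j)%C l.
Proof.
  intros [_ [H1 H2]] Hg; destruct (H2 (S r)) as [M [_ HM]].
  assert (V : Cvanishes (fun j => A (S r) (S j) * g j)%C)
    by (apply Cvanishes_bounded_mult with M; [ intros; apply HM | exact Hg ]).
  assert (E : forall n, csum (fun j => A r j * g j)%C (S n)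
    = (csum (fun j => A (S r) j * bdiff g j) (S n) - A (S r) (S n) * g n)%C).
  { induction n; [ simpl; rewrite (H1 r O); ring | ].
    change (csum ?f (S (S n))) with (csum f (S n) + f (S n))%C.
    rewrite IHn, (H1 r (S n)); simpl bdiff; ring. }
  split; intros H.
  - apply Cseries_perturb with (3 := H) (e := fun n => (A (S r) (S n) * g n)%C);
      [ intros n; rewrite E; ring | exact V ].
  - apply Cseries_perturb with (3 := H) (e := fun n => ((-1) * (A (S r) (S n) * g n))%C);
      [ intros n; rewrite E; ring | ].
    apply Cvanishes_bounded_mult with (Cmod (-1)%C); [ intros; lra | exact V ].
Qed.

(** This is the independence of the regularized sum from its order. Once the differences of order
    [r] tend to 0, those of higher order do so as well. *)
Lemma abel_iter chi A r d f l : character_primitives chi A -> Cvanishes (bdiffn r f) ->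
  Cseries (fun j => A r j * bdiffn r f j)%C l <->
  Cseries (fun j => A (d + r)%nat j * bdiffn (d + r) f j)%C l.
Proof.
  intros HA Hf; induction d; [ reflexivity | ].
  rewrite IHd; apply (abel_step chi A (d + r) (bdiffn (d + r) f)); [ exact HA | ].
  clear IHd; induction d; [ exact Hf | apply Cvanishes_bdiff, IHd ].
Qed.

(** The continuity estimate for the functional: [K] depends only on [A], [a] and [r], so the bound
    is uniform in [f]. The termwise bound is kept for the interchange of sums in the proof of
    analyticity. *)
Lemma regularized_sum_bound chi A (a : R) (r : nat) : character_primitives chi A ->
  a - INR r <= -2 -> exists K, 0 <= K /\ forall C0 f, 0 <= C0 ->
    derivs_le (fun x => 1 <= x) r a C0 f ->
    (forall j, Cmod (A r j * bdiffn r (fun i => f (INR (S i))) j)%C <= K * C0 * / INR (S j) ^ 2) /\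
    exists l, Cseries (fun j => A r j * bdiffn r (fun i => f (INR (S i))) j)%C l /\
      Cmod l <= K * C0.
Proof.
  intros [_ [_ H2]] Ha; destruct (H2 r) as [M [M0 HM]].
  destruct (bdiffn_bound a r Ha) as [K [K0 HK]].
  destruct ex_series_inv_square as [S0 HS].
  assert (S1 : 0 <= S0).
  { rewrite <- (is_series_unique _ _ HS); rewrite <- (Rmult_0_l (Series (fun _ => 0))).
    rewrite <- Series_scal_l; apply Series_le; [ | exists S0; exact HS ].
    intros n; rewrite Rmult_0_l; split; [ lra | ].
    left; apply Rinv_0_lt_compat, pow_lt, lt_0_INR; lia. }
  assert (MK : 0 <= M * K) by (apply Rmult_le_pos; assumption).
  (* The 1 serves the termwise bound; [2 * S0] serves the sum, with the 2 of [Cseries_dominated]. *)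
  exists (M * K * (1 + 2 * S0)); split; [ apply Rmult_le_pos; lra | ].
  intros C0 f HC Hf.
  assert (B : forall j, Cmod (A r j * bdiffn r (fun i => f (INR (S i))) j)%C
    <= M * K * C0 * / INR (S j) ^ 2).
  { intros j; rewrite Cmod_mult.
    replace (M * K * C0 * / INR (S j) ^ 2) with (M * (K * C0 * / INR (S j) ^ 2)) by ring.
    apply Rmult_le_compat; try apply Cmod_ge_0; [ apply HM | apply HK; assumption ]. }
  assert (MC : 0 <= M * K * C0) by (apply Rmult_le_pos; assumption).
  split.
  - intros j; eapply Rle_trans; [ apply B | ].
    apply Rmult_le_compat_r; [ left; apply Rinv_0_lt_compat, pow_lt, lt_0_INR; lia | nra ].
  - destruct (Cseries_dominated _ (fun j => M * K * C0 * / INR (S j) ^ 2) (M * K * C0 * S0) B)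
      as [l [Hl Hb]]; [ exact (is_series_scal_l (M * K * C0) _ _ HS) | ].
    exists l; split; [ exact Hl | nra ].
Qed.

(** * Analytic continuation of the Dirichlet series *)

Lemma Cseries_tail (a : nat -> C) l n : Cseries a l ->
  Cseries (fun k => a (n + k)%nat) (l - csum a n)%C.
Proof.
  assert (one : forall (b : nat -> C) v, Cseries b v -> Cseries (fun k => b (S k)) (v - b O)%C).
  { intros b v [H1 H2]; split.
    - apply (is_series_incr_1 (fun k => Re (b k))).
      replace (plus _ _) with (Re v); [ exact H1 | unfold Re; simpl; unfold plus; simpl; ring ].
    - apply (is_series_incr_1 (fun k => Im (b k))).
      replace (plus _ _) with (Im v); [ exact H2 | unfold Im; simpl; unfold plus; simpl; ring ]. }
  intros H; induction n.
  - simpl; replace (l - 0)%C with l by ring; exact H.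
  - replace (l - csum a (S n))%C with (l - csum a n - a (n + 0)%nat)%C
      by (simpl; rewrite Nat.add_0_r; ring).
    eapply Cseries_ext; [ | apply (one _ _ IHn) ].
    intros k; simpl; f_equal; lia.
Qed.

Lemma Cseries_csum (G : nat -> nat -> C) (l : nat -> C) n :
  (forall k, Cseries (G k) (l k)) -> Cseries (fun j => csum (fun k => G k j) n) (csum l n).
Proof.
  intros H; induction n; simpl; [ apply Cseries_zero | apply Cseries_plus; auto ].
Qed.

(** What is left of the k-series after n terms is at most a multiple of [M j * theta ^ n], which can
    be summed over j; the two iterated sums then differ by O(theta^n) after n terms. *)
Lemma Cseries_swap (G : nat -> nat -> C) (M : nat -> R) (m theta : R) (g l : nat -> C) (v : C) :
  0 <= theta < 1 -> (forall j k, Cmod (G k j) <= M j * theta ^ k) -> is_series M m ->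
  (forall j, Cseries (fun k => G k j) (g j)) -> (forall k, Cseries (G k) (l k)) ->
  Cseries g v -> Cseries l v.
Proof.
  intros Ht HG HM Hg Hl Hv.
  (* [v] is presented as a series with zeros after its first term, so that it remains to show that
     the partial sums minus [v] tend to 0. *)
  apply Cseries_perturb with (b := fun k => match k with O => v | S _ => RtoC 0 end)
    (e := fun n => (csum l (S n) - v)%C).
  - intros n; assert (E : csum (fun k => match k with O => v | S _ => RtoC 0 end) (S n) = v).
    { induction n; [ simpl; ring | ].
      change (csum ?f (S (S n))) with (csum f (S n) + RtoC 0)%C; rewrite IHn; ring. }
    rewrite E; ring.
  - apply Cvanishes_le with (fun n => (4 * m / (1 - theta) * theta) * theta ^ n).
    + intros n.
      assert (T : forall j, Cmod (csum (fun k => G k j) (S n) - g j)%C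
        <= (2 * theta ^ S n / (1 - theta)) * M j).
      { intros j.
        destruct (Cseries_dominated (fun k => G (S n + k)%nat j)
          (fun k => M j * theta ^ S n * theta ^ k) (M j * theta ^ S n * / (1 - theta)))
          as [t [Ht1 Ht2]].
        - intros k; eapply Rle_trans; [ apply HG | right; rewrite pow_add; ring ].
        - apply (is_series_scal_l (M j * theta ^ S n) (fun k => theta ^ k)).
          apply is_series_geom; rewrite Rabs_pos_eq; lra.
        - rewrite (Cseries_unique _ _ _ Ht1 (Cseries_tail _ _ (S n) (Hg j))) in Ht2.
          rewrite <- Cmod_opp; replace (- _)%C with (g j - csum (fun k => G k j) (S n))%C by ring.
          eapply Rle_trans; [ exact Ht2 | right; field; lra ]. }
      destruct (Cseries_dominated _ _ (2 * theta ^ S n / (1 - theta) * m) T) as [t [Ht1 Ht2]].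
      { apply (is_series_scal_l (2 * theta ^ S n / (1 - theta)) M), HM. }
      rewrite (Cseries_unique _ _ _ Ht1 (Cseries_minus _ _ _ _
        (Cseries_csum G l (S n) Hl) Hv)) in Ht2.
      eapply Rle_trans; [ exact Ht2 | right; simpl; field; lra ].
    + replace (Finite 0) with (Rbar_mult (4 * m / (1 - theta) * theta) 0) by (simpl; f_equal; ring).
      apply is_lim_seq_scal_l, is_lim_seq_geom; rewrite Rabs_pos_eq; lra.
  - apply Cseries_spec, is_series_decr_1.
    change (plus v (opp v)) with (v - v)%C; replace (v - v)%C with (RtoC 0) by ring.
    apply Cseries_spec, Cseries_zero.
Qed.

(** * Power series expansions and the identity theorem *)

Lemma pow_n_Cpow (z : C) k : pow_n (K := C_AbsRing) z k = (z ^ k)%C.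
Proof. induction k; [ reflexivity | simpl; rewrite IHk; reflexivity ]. Qed.

Lemma pseries_spec (a : nat -> C) (z l : C) :
  is_pseries (K := C_AbsRing) (V := C_NormedModule) a z l <-> Cseries (fun k => a k * z ^ k)%C l.
Proof.
  assert (E : forall k, scal (K := C_AbsRing) (V := C_NormedModule) (pow_n z k) (a k)
    = (a k * z ^ k)%C).
  { intros k; transitivity (pow_n (K := C_AbsRing) z k * a k)%C; [ reflexivity | ].
    rewrite pow_n_Cpow; apply Cmult_comm. }
  unfold is_pseries; rewrite Cseries_spec; split; apply Cseries_ext; intros k;
    [ apply E | symmetry; apply E ].
Qed.

(** The two expansions at the boundary point agree to its right, hence coefficientwise, hence also
    on a piece to its left. *)
Lemma analytic_agree_left (f g : C -> C) (T y d : R) : 0 < d ->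
  analytic_at f (T, y) -> analytic_at g (T, y) ->
  (forall t, T < t < T + d -> f (t, y) = g (t, y)) ->
  exists r, 0 < r /\ forall t, T - r < t < T + r -> f (t, y) = g (t, y).
Proof.
  intros Hd [a [ra [Ha Fa]]] [b [rb [Hb Fb]]] E.
  set (r := Rmin d (Rmin ra rb)).
  assert (Hr : 0 < r) by (unfold r; repeat apply Rmin_pos; assumption).
  assert (R1 : r <= d) by apply Rmin_l.
  assert (R2 : r <= ra) by (eapply Rle_trans; [ apply Rmin_r | apply Rmin_l ]).
  assert (R3 : r <= rb) by (eapply Rle_trans; [ apply Rmin_r | apply Rmin_r ]).
  assert (D : forall u, Rabs u < r ->
    Cseries (fun k => (a k - b k) * RtoC u ^ k)%C (f ((T + u)%R, y) - g ((T + u)%R, y))%C).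
  { intros u Hu.
    assert (Z : (((T + u)%R, y) - (T, y) = RtoC u)%C) by (apply C_eq; simpl; ring).
    assert (Hm : Cmod (((T + u)%R, y) - (T, y))%C < r) by (rewrite Z, Cmod_R; exact Hu).
    assert (A1 := Fa ((T + u)%R, y) ltac:(lra)); assert (B1 := Fb ((T + u)%R, y) ltac:(lra)).
    rewrite pseries_spec, Z in A1, B1.
    eapply Cseries_ext; [ | exact (Cseries_minus _ _ _ _ A1 B1) ].
    intros k; simpl; ring. }
  assert (Zero : forall k, (a k - b k)%C = RtoC 0).
  { apply CPS_right_zero with r; [ exact Hr | ].
    intros u Hu; replace (RtoC 0) with (f ((T + u)%R, y) - g ((T + u)%R, y))%C.
    - apply D; rewrite Rabs_pos_eq; lra.
    - rewrite E by lra; ring. }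
  exists r; split; [ exact Hr | ].
  intros t Ht; assert (D1 := D (t - T) ltac:(apply Rabs_def1; lra)).
  replace (T + (t - T)) with t in D1 by ring.
  apply (Cseries_ext _ (fun _ => RtoC 0)) in D1; [ | intros k; rewrite Zero; ring ].
  assert (D2 := Cseries_unique _ _ _ D1 Cseries_zero).
  replace (f (t, y)) with (f (t, y) - g (t, y) + g (t, y))%C by ring; rewrite D2; ring.
Qed.

Lemma entire_eq_of_half_plane (f g : C -> C) : entire f -> entire g ->
  (forall s, 1 < Re s -> f s = g s) -> forall s, f s = g s.
Proof.
  intros Hf Hg H [x y].
  (* A connectedness argument on the horizontal line through the given point. The sign of [u] turns
     the leftmost abscissa of agreement into a supremum, as [completeness] provides. *)
  set (E := fun u => forall t, - u < t -> f (t, y) = g (t, y)).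
  assert (E1 : E (-1)) by (intros t Ht; apply H; simpl; lra).
  destruct (classic (exists u, E u /\ - u < x)) as [[u [Hu Hx]]|N];
    [ apply Hu, Hx | exfalso ].
  assert (ub : forall u, E u -> u <= - x).
  { intros u Hu; apply Rnot_lt_le; intros L; apply N; exists u; split; [ exact Hu | lra ]. }
  destruct (completeness E) as [U [HU1 HU2]];
    [ exists (- x); exact ub | exists (-1); exact E1 | ].
  assert (A : forall t, - U < t -> f (t, y) = g (t, y)).
  { intros t Ht; destruct (classic (exists u, E u /\ - u < t)) as [[u [Hu Hx]]|M];
      [ apply Hu, Hx | exfalso ].
    assert (U <= - t); [ | lra ].
    apply HU2; intros u Hu; apply Rnot_lt_le; intros L; apply M; exists u; split; [ exact Hu | lra ]. }
  destruct (analytic_agree_left f g (- U) y 1) as [r [Hr HE]];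
    [ lra | apply Hf | apply Hg | intros t Ht; apply A; lra | ].
  assert (K : E (U + r / 2)).
  { intros t Ht; destruct (Rlt_le_dec (- U) t) as [L|L]; [ apply A, L | apply HE; lra ]. }
  specialize (HU1 _ K); lra.
Qed.

(** * The regularized L-function *)

Definition dirichlet_seq (s : C) (i : nat) : C := Rcpow (INR (S i)) (- s)%C.

Definition regularizing_order (s : C) : nat := Z.to_nat (up (2 - Re s)).

(** The order jumps with [s], so analyticity is not visible here; [regularized_L_spec] gives the
    same value for any sufficient order, and one order can then be used on a whole disk. *)
Definition regularized_L (A : nat -> nat -> C) (s : C) : C :=
  let r := regularizing_order s in
  (Series (fun j => Re (A r j * bdiffn r (dirichlet_seq s) j)%C),
   Series (fun j => Im (A r j * bdiffn r (dirichlet_seq s) j)%C)).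

Lemma INR_up_ge (x : R) : x <= INR (Z.to_nat (up x)).
Proof.
  destruct (archimed x) as [H _].
  destruct (Z.le_gt_cases 0 (up x)) as [L|L].
  - rewrite INR_IZR_INZ, Z2Nat.id by exact L; lra.
  - apply IZR_lt in L; generalize (pos_INR (Z.to_nat (up x))); lra.
Qed.

Lemma bdiffn_dirichlet_vanishes (s : C) (r : nat) : - Re s - INR r <= -2 ->
  Cvanishes (bdiffn r (dirichlet_seq s)).
Proof.
  intros Hr; destruct (bdiffn_bound (- Re s) r Hr) as [K [_ HK]].
  destruct (derivs_O_Rcpow (fun x => 1 <= x) r ltac:(intros; lra) (- s)%C) as [C0 [HC Hs]].
  apply Cvanishes_le with (fun j => K * C0 * / INR (S j) ^ 2).
  - exact (HK C0 _ HC Hs).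
  - replace (Finite 0) with (Rbar_mult (K * C0) 0) by (simpl; f_equal; ring).
    apply is_lim_seq_scal_l, ex_series_lim_0, ex_series_inv_square.
Qed.

(** The order [r] and the order of the definition are both raised to their sum, where the two values
    can be compared. *)
Lemma regularized_L_spec chi A (s : C) (r : nat) : character_primitives chi A ->
  - Re s - INR r <= -2 ->
  Cseries (fun j => A r j * bdiffn r (dirichlet_seq s) j)%C (regularized_L A s).
Proof.
  intros HA.
  assert (ex : forall r, - Re s - INR r <= -2 ->
    exists l, Cseries (fun j => A r j * bdiffn r (dirichlet_seq s) j)%C l).
  { intros r' Hr; destruct (regularized_sum_bound chi A (- Re s) r' HA Hr) as [K [_ HK]].
    destruct (derivs_O_Rcpow (fun x => 1 <= x) r' ltac:(intros; lra) (- s)%C) as [C0 [HC Hs]].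
    destruct (HK C0 _ HC Hs) as [_ [l [Hl _]]]; exists l; exact Hl. }
  assert (H0 : - Re s - INR (regularizing_order s) <= -2)
    by (unfold regularizing_order; generalize (INR_up_ge (2 - Re s)); lra).
  assert (S0 : Cseries (fun j => A (regularizing_order s) j
    * bdiffn (regularizing_order s) (dirichlet_seq s) j)%C (regularized_L A s)).
  { destruct (ex _ H0) as [l [H1 H2]]; split; simpl; apply Series_correct; eexists; eassumption. }
  intros Hr; destruct (ex r Hr) as [l Hl].
  assert (L1 := proj1 (abel_iter chi A r (regularizing_order s) _ _ HA
    (bdiffn_dirichlet_vanishes s r Hr)) Hl).
  assert (L2 := proj1 (abel_iter chi A (regularizing_order s) r _ _ HA
    (bdiffn_dirichlet_vanishes s _ H0)) S0).
  rewrite Nat.add_comm in L2; rewrite <- (Cseries_unique _ _ _ L1 L2); exact Hl.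
Qed.

Lemma regularized_L_series chi A (s : C) : character_primitives chi A -> 1 < Re s ->
  Cseries (fun n => chi (Z.of_nat (S n)) * Cpower (RtoC (INR (S n))) (- s))%C (regularized_L A s).
Proof.
  intros HA Hs.
  assert (V : Cvanishes (dirichlet_seq s)).
  { apply Cvanishes_le with (fun j => / INR (S j)).
    - intros j; unfold dirichlet_seq; rewrite Cmod_Rcpow.
      assert (Hj : 1 <= INR (S j)) by (rewrite S_INR; generalize (pos_INR j); lra).
      replace (Re (- s)%C) with (- Re s) by reflexivity.
      rewrite Rpower_Ropp; apply Rinv_le_contravar; [ lra | ].
      rewrite <- (Rpower_1 (INR (S j))) at 1 by lra.
      destruct (Req_dec (INR (S j)) 1) as [ -> |N];
        [ unfold Rpower; rewrite ln_1, !Rmult_0_r; lra | apply Rle_Rpower; lra ].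
    - apply (is_lim_seq_incr_1 (fun n => / INR n)).
      replace (Finite 0) with (Rbar_inv p_infty) by reflexivity.
      apply is_lim_seq_inv; [ apply is_lim_seq_INR | discriminate ]. }
  set (r := regularizing_order s).
  assert (Hr : - Re s - INR r <= -2)
    by (unfold r, regularizing_order; generalize (INR_up_ge (2 - Re s)); lra).
  assert (S0 := regularized_L_spec chi A s r HA Hr).
  (* The order is lowered to 0, where the primitive is the character itself. *)
  rewrite <- (Nat.add_0_r r) in S0.
  apply (abel_iter chi A 0 r _ _ HA V) in S0.
  eapply Cseries_ext; [ | exact S0 ].
  intros n; cbv beta; rewrite (proj1 HA), Cpower_RtoC by (apply lt_0_INR; lia); reflexivity.
Qed.

(** The coefficient of v^k in x^(w + v). *)
Definition power_log (w : C) (k : nat) (x : R) : C :=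
  (Rcpow x w * RtoC (ln x ^ k / INR (fact k)))%C.

(** The constant is uniform in [k] because (ln x)^k / k! is a term of the series of exp(ln x) = x;
    this costs one power of x. Differentiation leads to the same family with [w - 1] and the indices
    [k] and [k - 1], so the induction closes. *)
Lemma derivs_le_power_log r : forall w : C, exists C0, 0 <= C0 /\
  forall k, derivs_le (fun x => 1 <= x) r (Re w + 1) C0 (power_log w k).
Proof.
  assert (B : forall w k x, 1 <= x -> Cmod (power_log w k x) <= 1 * Rpower x (Re w + 1)).
  { intros w k x Hx; unfold power_log.
    assert (L : 0 <= ln x) by (rewrite <- ln_1; apply ln_le; lra).
    rewrite Cmod_mult, Cmod_Rcpow, Cmod_R, Rpower_plus, Rmult_1_l.
    apply Rmult_le_compat_l; [ left; apply Rpower_pos | ].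
    rewrite Rabs_pos_eq by (apply Rdiv_le_0_compat; [ apply pow_le, L | apply INR_fact_lt_0 ]).
    unfold Rpower; rewrite Rmult_1_l; apply pow_fact_le_exp, L. }
  induction r; intros w.
  - exists 1; split; [ lra | intros k; split; [ apply B | exact I ] ].
  - destruct (IHr (w - 1)%C) as [C1 [H1 Hs]].
    replace (Re (w - 1)%C + 1) with (Re w + 1 - 1) in Hs by (unfold Re; simpl; ring).
    assert (Cw := Cmod_ge_0 w).
    exists (1 + (Cmod w * C1 + C1)); split; [ nra | ].
    intros k; split.
    + intros x Hx; eapply Rle_trans; [ apply B, Hx | ].
      apply Rmult_le_compat_r; [ left; apply Rpower_pos | nra ].
    + exists (fun x => w * power_log (w - 1) k x
        + match k with O => 0 | S k' => power_log (w - 1) k' x end)%C; split.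
      * intros x Hx.
        assert (Dl : is_derive (fun x => ln x ^ k / INR (fact k)) x
          (/ x * match k with O => 0 | S k' => ln x ^ k' / INR (fact k') end)).
        { auto_derive; [ lra | ].
          destruct k as [|k]; [ simpl; ring | ].
          change (fact (S k)) with (S k * fact k)%nat; rewrite mult_INR; simpl pred.
          field; repeat split; [ apply INR_fact_neq_0 | lra | apply not_0_INR; lia ]. }
        eapply is_Cderive_eq;
          [ apply is_Cderive_mult; [ apply is_Cderive_Rcpow; lra | apply is_Cderive_RtoC, Dl ] | ].
        unfold power_log.
        assert (E : Rcpow x w = (Rcpow x (w - 1) * RtoC x)%C).
        { rewrite <- (pow_1 x) at 3; rewrite <- (Rcpow_nat x 1), <- Rcpow_plus by lra.
          f_equal; simpl; ring. }
        rewrite E, RtoC_mult, RtoC_inv by lra.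
        assert (Nx : RtoC x <> RtoC 0) by (intros H; apply RtoC_inj in H; lra).
        destruct k; field; exact Nx.
      * apply derivs_le_mono with (Cmod w * C1 + C1); [ lra | ].
        apply derivs_le_plus; [ apply derivs_le_scal, Hs | ].
        destruct k; [ | apply Hs ].
        apply derivs_le_mono with 0; [ exact H1 | apply derivs_le_zero ].
Qed.

Lemma power_log_series (w v : C) (x : R) :
  Cseries (fun k => v ^ k * power_log w k x)%C (Rcpow x (w + v)%C).
Proof.
  rewrite Rcpow_plus; eapply Cseries_ext; [ | apply Cseries_scal, Cexp_series ].
  intros k; unfold power_log; simpl; rewrite Cpow_mult_l.
  unfold Rdiv; rewrite RtoC_mult, RtoC_inv, RtoC_pow by apply INR_fact_neq_0.
  unfold Cdiv; ring.
Qed.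

Lemma regularized_L_entire chi A : character_primitives chi A -> entire (regularized_L A).
Proof.
  intros HA s0.
  (* 3 instead of 2: the extra unit pays for the additional power of x in [derivs_le_power_log], and
     it also makes the order sufficient for all z with |z - s0| < 1. *)
  set (r := Z.to_nat (up (3 - Re s0))).
  assert (Hr : 3 - Re s0 <= INR r) by apply INR_up_ge.
  destruct (derivs_le_power_log r (- s0)%C) as [C0 [HC Hs]].
  replace (Re (- s0)%C + 1) with (- Re s0 + 1) in Hs by reflexivity.
  destruct (regularized_sum_bound chi A (- Re s0 + 1) r HA ltac:(lra)) as [K [K0 HK]].
  set (G0 := fun k j => (A r j * bdiffn r (fun i => power_log (- s0) k (INR (S i))) j)%C).
  assert (exl : forall k, exists l, Cseries (G0 k) l).
  { intros k; destruct (HK C0 _ HC (Hs k)) as [_ [l [Hl _]]]; exists l; exact Hl. }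
  assert (BG : forall k j, Cmod (G0 k j) <= K * C0 * / INR (S j) ^ 2).
  { intros k j; apply (proj1 (HK C0 _ HC (Hs k))). }
  destruct ex_series_inv_square as [S0 HS].
  (* The sign comes from expanding x^(-z) in powers of s0 - z; radius 1 keeps the ratio |z - s0| of
     the geometric majorant below 1. *)
  exists (fun k => (-1) ^ k * epsilon (inhabits (RtoC 0)) (Cseries (G0 k)))%C, 1; split; [ lra | ].
  intros z Hz; set (w := (z - s0)%C) in *.
  assert (Hw : Re s0 - 1 <= Re z).
  { assert (Q := re_le_Cmod w).
    assert (Q1 : Rabs (Re w) < 1) by lra; apply Rabs_def2 in Q1.
    change (Re w) with (Re z - Re s0) in Q1; lra. }
  rewrite pseries_spec.
  apply Cseries_swap with (G := fun k j => ((- w) ^ k * G0 k j)%C)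
    (M := fun j => K * C0 * / INR (S j) ^ 2) (m := K * C0 * S0) (theta := Cmod w)
    (g := fun j => (A r j * bdiffn r (dirichlet_seq z) j)%C).
  - split; [ apply Cmod_ge_0 | exact Hz ].
  - intros j k; rewrite Cmod_mult, Cmod_pow, Cmod_opp, Rmult_comm.
    apply Rmult_le_compat_r; [ apply pow_le, Cmod_ge_0 | apply BG ].
  - exact (is_series_scal_l (K * C0) _ _ HS).
  - intros j; unfold G0.
    eapply Cseries_ext; [ | apply (Cseries_scal (A r j)), (Cseries_bdiffn r
      (fun k i => (- w) ^ k * power_log (- s0) k (INR (S i)))%C) ].
    + intros k; simpl; rewrite bdiffn_scal; ring.
    + intros i; unfold dirichlet_seq; replace (- z)%C with (- s0 + - w)%C by (unfold w; ring).
      apply power_log_series.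
  - intros k; replace ((-1) ^ k * epsilon (inhabits (RtoC 0)) (Cseries (G0 k)) * w ^ k)%C
      with ((- w) ^ k * epsilon (inhabits (RtoC 0)) (Cseries (G0 k)))%C.
    + apply Cseries_scal; apply epsilon_spec, exl.
    + replace (- w)%C with ((-1) * w)%C by ring; rewrite Cpow_mult_l; ring.
  - apply (regularized_L_spec chi); [ exact HA | lra ].
Qed.

(** Exhibiting one continuation makes the choice in [dirichlet_L] a continuation too, and the
    identity theorem shows that it is the same function. *)
Lemma dirichlet_L_regularized chi A : character_primitives chi A ->
  forall s, dirichlet_L chi s = regularized_L A s.
Proof.
  intros HA.
  assert (C1 : dirichlet_L_continuation chi (regularized_L A)).
  { split; [ eapply regularized_L_entire; exact HA | ].
    intros s Hs; apply Cseries_spec, regularized_L_series; assumption. }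
  assert (C2 : dirichlet_L_continuation chi (dirichlet_L chi))
    by (unfold dirichlet_L; apply epsilon_spec; exists (regularized_L A); exact C1).
  apply entire_eq_of_half_plane; [ apply C2 | apply C1 | ].
  intros s Hs; eapply Cseries_unique; apply Cseries_spec; [ apply C2, Hs | apply C1, Hs ].
Qed.

(** * Powers of power series *)

Lemma RtoC_neq_0 (x : R) : x <> 0 -> RtoC x <> RtoC 0.
Proof. intros H E; apply RtoC_inj in E; contradiction. Qed.

(** In the right half-plane the case distinction of [Carg] disappears, and the arctangent form is
    differentiable across the real axis. *)
Lemma Clog_right_half_plane (z : C) : 0 < Re z ->
  Clog z = (ln (sqrt (Re z ^ 2 + Im z ^ 2)), atan (Im z / Re z)).
Proof.
  intros Hx; unfold Clog; f_equal; unfold Carg.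
  change (Cmod z) with (sqrt (Re z ^ 2 + Im z ^ 2)).
  set (x := Re z) in *; set (y := Im z) in *; set (n := sqrt (x ^ 2 + y ^ 2)).
  assert (Hn2 : n ^ 2 = x ^ 2 + y ^ 2) by (unfold n; rewrite pow2_sqrt; nra).
  assert (Hn : 0 < n) by (apply sqrt_lt_R0; nra).
  assert (E : acos (x / n) = atan (Rabs y / x)).
  { rewrite acos_atan by (apply Rdiv_lt_0_compat; assumption).
    f_equal; unfold Rsqr.
    replace (1 - x / n * (x / n)) with ((Rabs y / n) ^ 2).
    - rewrite <- Rsqr_pow2, sqrt_Rsqr
        by (apply Rdiv_le_0_compat; [ apply Rabs_pos | exact Hn ]).
      field; lra.
    - unfold Rdiv; rewrite Rpow_mult_distr, pow2_abs.
      replace (y ^ 2) with (n ^ 2 - x ^ 2) by lra; field; lra. }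
  destruct (Rlt_dec y 0) as [L|L]; rewrite E.
  - rewrite Rabs_left, <- atan_opp by exact L; f_equal; field; lra.
  - rewrite Rabs_pos_eq by lra; reflexivity.
Qed.

(** The right half-plane is stable under inversion and avoids the cut. The lemma turns a power of
    1/S into a power of S, whose coefficients the recurrence provides. *)
Lemma Clog_inv (z : C) : 0 < Re z -> Clog (/ z)%C = (- Clog z)%C.
Proof.
  intros Hx.
  assert (Hn : 0 < Re z ^ 2 + Im z ^ 2) by nra.
  assert (R1 : Re (/ z)%C = Re z / (Re z ^ 2 + Im z ^ 2)) by reflexivity.
  assert (I1 : Im (/ z)%C = - Im z / (Re z ^ 2 + Im z ^ 2)) by reflexivity.
  assert (H1 : 0 < Re (/ z)%C) by (rewrite R1; apply Rdiv_lt_0_compat; assumption).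
  rewrite !Clog_right_half_plane, R1, I1 by assumption.
  apply C_eq; simpl Re; simpl Im.
  - assert (Hs : 0 < sqrt (Re z ^ 2 + Im z ^ 2)) by (apply sqrt_lt_R0, Hn).
    change (ln (sqrt ((Re z / (Re z ^ 2 + Im z ^ 2)) ^ 2 + (- Im z / (Re z ^ 2 + Im z ^ 2)) ^ 2))
      = - ln (sqrt (Re z ^ 2 + Im z ^ 2))).
    rewrite <- ln_Rinv, <- sqrt_inv by exact Hs.
    do 2 f_equal; field; lra.
  - change (atan (- Im z / (Re z ^ 2 + Im z ^ 2) / (Re z / (Re z ^ 2 + Im z ^ 2)))
      = - atan (Im z / Re z)).
    rewrite <- atan_opp; f_equal; field; split; lra.
Qed.

Lemma is_Cderive_Clog (v : R -> C) (t : R) (l : C) : is_Cderive v t l -> 0 < Re (v t) ->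
  is_Cderive (fun u => Clog (v u)) t (l / v t)%C.
Proof.
  intros [H1 H2] Hp.
  assert (Cx : continuous (fun u => Re (v u)) t) by (apply (ex_derive_continuous (fun u => Re (v u))); eexists; exact H1).
  assert (L : locally t (fun u => 0 < Re (v u))).
  { apply (Cx (fun y => 0 < y)), (locally_open (fun y => 0 < y)); [ apply open_gt | auto | exact Hp ]. }
  apply (is_Cderive_ext_loc (fun u => (ln (sqrt (Re (v u) ^ 2 + Im (v u) ^ 2)), atan (Im (v u) / Re (v u))))).
  { eapply filter_imp; [ | exact L ]; intros u Hu; symmetry; apply Clog_right_half_plane, Hu. }
  assert (Nz : v t <> RtoC 0) by (intros E; rewrite E in Hp; simpl in Hp; lra).
  assert (Hn : 0 < Re (v t) ^ 2 + Im (v t) ^ 2) by nra.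
  assert (Hs : 0 < sqrt (Re (v t) ^ 2 + Im (v t) ^ 2)) by (apply sqrt_lt_R0, Hn).
  assert (Hs2 : sqrt (Re (v t) ^ 2 + Im (v t) ^ 2) ^ 2 = Re (v t) ^ 2 + Im (v t) ^ 2)
    by (apply pow2_sqrt; lra).
  set (X := fun u => Re (v u)) in *; set (Y := fun u => Im (v u)) in *.
  assert (Dx := is_derive_unique _ _ _ H1); assert (Dy := is_derive_unique _ _ _ H2).
  split.
  - change (is_derive (fun u => ln (sqrt (X u ^ 2 + Y u ^ 2))) t (Re (l / v t)%C)).
    change (0 < X t ^ 2 + Y t ^ 2) in Hn; change (0 < sqrt (X t ^ 2 + Y t ^ 2)) in Hs.
    auto_derive.
    + repeat split; try (eexists; eassumption); simpl in *; try lra.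
    + change (Derive (fun u => X u) t) with (Derive X t); change (Derive (fun u => Y u) t) with (Derive Y t).
      change (Derive X t = Re l) in Dx; change (Derive Y t = Im l) in Dy; rewrite Dx, Dy.
      change (sqrt (X t ^ 2 + Y t ^ 2) ^ 2 = X t ^ 2 + Y t ^ 2) in Hs2.
      replace (Re (l / v t)%C) with ((Re l * X t + Im l * Y t) / (X t ^ 2 + Y t ^ 2))
        by (unfold X, Y, Re, Im; simpl; field; simpl in Hn; unfold X, Y, Re, Im in Hn; lra).
      simpl in Hs2, Hs, Hn |- *.
      set (n := sqrt (X t * (X t * 1) + Y t * (Y t * 1))) in *.
      rewrite <- Hs2; field; lra.
  - change (is_derive (fun u => atan (Y u / X u)) t (Im (l / v t)%C)).
    change (0 < X t ^ 2 + Y t ^ 2) in Hn; change (0 < X t) in Hp.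
    assert (DY : is_derive (fun u => Y u / X u) t ((Im l * X t - Y t * Re l) / X t ^ 2))
      by (apply is_derive_div; [ exact H2 | exact H1 | lra ]).
    assert (DA : is_derive atan (Y t / X t) (/ (1 + (Y t / X t) ^ 2))).
    { apply is_derive_Reals, derivable_pt_lim_atan. }
    assert (E : Im (l / v t)%C = (Im l * X t - Y t * Re l) / X t ^ 2 * / (1 + (Y t / X t) ^ 2)).
    { replace (Im (l / v t)%C) with ((Im l * X t - Re l * Y t) / (X t ^ 2 + Y t ^ 2))
        by (unfold X, Y, Re, Im; simpl; field; simpl in Hn; unfold X, Y, Re, Im in Hn; lra).
      field; repeat split; nra. }
    rewrite E; exact (is_derive_comp atan _ t _ _ DA DY).
Qed.

(* Coefficients of (sum c_k x^k)^w for c_0 = 1, from J.C.P. Miller's recurrence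
   k q_k = sum_{i=1}^k (w i - (k - i)) c_i q_(k-i). *)
Fixpoint power_table (c : nat -> C) (w : C) (n : nat) : nat -> C :=
  match n with
  | O => fun _ => RtoC 1
  | S m => fun k =>
      if Nat.eqb k (S m)
      then (/ RtoC (INR (S m)) * csum (fun i => (w * RtoC (INR (S i)) - RtoC (INR (m - i)))
             * c (S i) * power_table c w m (m - i)%nat) (S m))%C
      else power_table c w m k
  end.

Definition power_coef (c : nat -> C) (w : C) (k : nat) : C := power_table c w k k.

Lemma power_table_stable c w n : forall k, (k <= n)%nat ->
  power_table c w n k = power_coef c w k.
Proof.
  induction n; intros k Hk; [ replace k with O by lia; reflexivity | ].
  destruct (Nat.eq_dec k (S n)) as [ -> |N]; [ reflexivity | ].
  simpl; destruct (Nat.eqb_spec k (S n)); [ contradiction | apply IHn; lia ].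
Qed.

Lemma power_coef_S c w m : power_coef c w (S m) =
  (/ RtoC (INR (S m)) * csum (fun i => (w * RtoC (INR (S i)) - RtoC (INR (m - i)))
     * c (S i) * power_coef c w (m - i)%nat) (S m))%C.
Proof.
  unfold power_coef at 1; unfold power_table; fold power_table.
  rewrite Nat.eqb_refl; f_equal; apply csum_ext; intros i Hi.
  rewrite power_table_stable by lia; reflexivity.
Qed.

Lemma Cmod_csum_telescope (f : nat -> C) (U : nat -> R) n :
  (forall i, (i < n)%nat -> Cmod (f i) <= U i - U (S i)) -> Cmod (csum f n) <= U O - U n.
Proof.
  induction n; intros H; [ simpl; rewrite Cmod_0; lra | ].
  simpl csum; eapply Rle_trans; [ apply Cmod_triangle | ].
  assert (H1 := H n (Nat.lt_succ_diag_r n)).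
  assert (H2 : Cmod (csum f n) <= U O - U n) by (apply IHn; intros; apply H; lia).
  lra.
Qed.

(** With B = |w| + 2 the factor |w i - (k - i)| is at most k (B - 1), and the sum of (B - 1) B^(k -
    i) over i = 1, ..., k telescopes to B^k - 1. *)
Lemma power_coef_bound (c : nat -> C) (w : C) : (forall i, Cmod (c i) <= 1) ->
  forall k, Cmod (power_coef c w k) <= (Cmod w + 2) ^ k.
Proof.
  intros Hc; set (B := Cmod w + 2); assert (Hw := Cmod_ge_0 w).
  assert (HB : 0 < B) by (unfold B; lra).
  induction k as [k IH] using (well_founded_induction Nat.lt_wf_0).
  destruct k as [|m]; [ unfold power_coef; simpl; rewrite Cmod_1; lra | ].
  assert (Hm : 0 < INR (S m)) by (apply lt_0_INR; lia).
  rewrite power_coef_S, Cmod_mult, Cmod_inv, Cmod_R, Rabs_pos_eq by (try apply RtoC_neq_0; lra).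
  apply Rmult_le_reg_l with (INR (S m)); [ exact Hm | ].
  rewrite <- Rmult_assoc, Rinv_r, Rmult_1_l by lra.
  apply Rle_trans with (INR (S m) * B ^ (S m - 0) - INR (S m) * B ^ (S m - S m)).
  - apply (Cmod_csum_telescope _ (fun i => INR (S m) * B ^ (S m - i))).
    intros i Hi.
    replace (S m - i)%nat with (S (m - i)) by lia.
    replace (S m - S i)%nat with (m - i)%nat by lia.
    rewrite !Cmod_mult.
    assert (H1 : Cmod (w * RtoC (INR (S i)) - RtoC (INR (m - i)))%C <= INR (S m) * (B - 1)).
    { unfold Cminus; eapply Rle_trans; [ apply Cmod_triangle | ].
      rewrite Cmod_opp, Cmod_mult, !Cmod_R, !Rabs_pos_eq by apply pos_INR.
      assert (E : INR (S m) = INR (S i) + INR (m - i)) by (rewrite <- plus_INR; f_equal; lia).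
      rewrite E; unfold B; generalize (pos_INR (S i)) (pos_INR (m - i)); intros; nra. }
    assert (H2 := IH (m - i)%nat ltac:(lia)).
    assert (HP : 0 < B ^ (m - i)) by (apply pow_lt, HB).
    apply Rle_trans with (INR (S m) * (B - 1) * 1 * B ^ (m - i)).
    + apply Rmult_le_compat; [ apply Rmult_le_pos; apply Cmod_ge_0 | apply Cmod_ge_0 | | exact H2 ].
      apply Rmult_le_compat; [ apply Cmod_ge_0 | apply Cmod_ge_0 | exact H1 | apply Hc ].
    + right; simpl; ring.
  - rewrite Nat.sub_0_r; assert (0 < B ^ (S m - S m)) by (apply pow_lt, HB); nra.
Qed.

(* S Q' = w S' Q, coefficientwise. *)
Lemma power_coef_ode (c : nat -> C) (w : C) (k : nat) : c O = RtoC 1 ->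
  csum (fun i => c i * (RtoC (INR (S (k - i))) * power_coef c w (S (k - i)))%C)%C (S k)
  = (w * csum (fun i => RtoC (INR (S i)) * c (S i) * power_coef c w (k - i)%nat) (S k))%C.
Proof.
  intros H0; rewrite csum_split_first, H0, Nat.sub_0_r, power_coef_S.
  assert (Hk : RtoC (INR (S k)) <> RtoC 0) by (apply RtoC_neq_0, not_0_INR; lia).
  set (q := power_coef c w).
  assert (E : csum (fun i => (w * RtoC (INR (S i)) - RtoC (INR (k - i))) * c (S i) * q (k - i)%nat)%C (S k)
    = (w * csum (fun i => RtoC (INR (S i)) * c (S i) * q (k - i)%nat) (S k)
      - csum (fun i => RtoC (INR (k - i)) * c (S i) * q (k - i)%nat) (S k))%C).
  { rewrite <- csum_scal, <- csum_sub; apply csum_ext; intros i _; cbv beta; ring. }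
  rewrite E.
  assert (E2 : csum (fun i => c (S i) * (RtoC (INR (S (k - S i))) * q (S (k - S i))))%C k
    = csum (fun i => RtoC (INR (k - i)) * c (S i) * q (k - i)%nat)%C (S k)).
  { change (csum ?f (S k)) with (csum f k + f k)%C; cbv beta; rewrite Nat.sub_diag; change (INR 0) with 0.
    rewrite (csum_ext _ (fun i => RtoC (INR (k - i)) * c (S i) * q (k - i)%nat)%C); [ ring | ].
    intros i Hi; replace (S (k - S i)) with (k - i)%nat by lia. ring. }
  rewrite E2; field; exact Hk.
Qed.

Lemma csum_scal_r c f n : csum (fun i => f i * c)%C n = (csum f n * c)%C.
Proof. induction n; simpl; [ ring | rewrite IHn; ring ]. Qed.

Lemma CPSeries_mult (a b d : nat -> C) (t : R) :
  Cradius_gt a (Rabs t) -> Cradius_gt b (Rabs t) ->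
  (forall k, d k = csum (fun i => a i * b (k - i)%nat)%C (S k)) ->
  Cseries (fun k => d k * RtoC t ^ k)%C (CPSeries a t * CPSeries b t)%C.
Proof.
  intros Ha Hb Hd.
  assert (dom : forall (u : nat -> C) n, Cmod (u n * RtoC t ^ n)%C <= Cmod (u n) * Rabs t ^ n)
    by (intros; rewrite Cmod_mult, Cmod_pow, Cmod_R; lra).
  eapply Cseries_ext; [ | apply (Cseries_mult _ _ _ _ _ _
    (Cseries_CPSeries a t Ha) (Cseries_CPSeries b t Hb) (dom a)
    (Cradius_gt_abs a _ (Rabs_pos t) Ha) (dom b) (Cradius_gt_abs b _ (Rabs_pos t) Hb)) ].
  intros k; cbv beta; rewrite sum_n_csum, Hd, <- csum_scal_r; apply csum_ext; intros i Hi.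
  replace (RtoC t ^ k)%C with (RtoC t ^ i * RtoC t ^ (k - i))%C; [ ring | ].
  rewrite <- Cpow_add_r; f_equal; lia.
Qed.

(** Along the segment from 0 to x the recurrence says S Q' = w S' Q, so Q exp(-w log S) is constant.
    The smallness of [x] gives both series in the segment parameter a radius of at least 2 and keeps
    S in the right half-plane, where [Clog] is differentiable. *)
Lemma power_series_power (c : nat -> C) (w x : C) : c O = RtoC 1 ->
  (forall i, Cmod (c i) <= 1) -> 2 * ((Cmod w + 2) * Cmod x) <= 1 ->
  let S0 := CPSeries (fun k => c k * x ^ k)%C 1 in
  let Q0 := CPSeries (fun k => power_coef c w k * x ^ k)%C 1 in
  Cradius_gt (fun k => c k * x ^ k)%C 1 /\ Cradius_gt (fun k => power_coef c w k * x ^ k)%C 1 /\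
  0 < Re S0 /\ Q0 = Cexp (w * Clog S0)%C.
Proof.
  intros H0 Hc Hx S0 Q0.
  assert (Hw := Cmod_ge_0 w); assert (Hx0 := Cmod_ge_0 x).
  set (a := fun k => (c k * x ^ k)%C) in *.
  set (d := fun k => (power_coef c w k * x ^ k)%C) in *.
  assert (Hx1 : Cmod x <= / 4) by nra.
  assert (Ra : Cradius_gt a 1).
  { apply Cradius_gt_bounded with 2 1; [ lra | lra | ].
    intros k; unfold a; rewrite Cmod_mult, Cmod_pow, Rmult_assoc, <- Rpow_mult_distr.
    replace 1 with (1 * 1 ^ k) by (rewrite pow1; ring).
    apply Rmult_le_compat; [ apply Cmod_ge_0 | apply pow_le; lra | apply Hc | apply pow_incr; lra ]. }
  assert (Rd : Cradius_gt d 1).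
  { apply Cradius_gt_bounded with 2 1; [ lra | lra | ].
    intros k; unfold d; rewrite Cmod_mult, Cmod_pow, Rmult_assoc, <- Rpow_mult_distr.
    apply Rle_trans with ((Cmod w + 2) ^ k * (Cmod x * 2) ^ k).
    - apply Rmult_le_compat_r; [ apply pow_le; lra | apply power_coef_bound, Hc ].
    - rewrite <- Rpow_mult_distr, <- (pow1 k); apply pow_incr; split; [ | lra ].
      apply Rmult_le_pos; lra. }
  assert (Rt : forall u t, 0 <= t <= 1 -> Cradius_gt u 1 -> Cradius_gt u (Rabs t))
    by (intros u t Ht; apply Cradius_gt_le; rewrite Rabs_pos_eq; lra).
  (* Since |x| <= 1/4, the terms after the leading 1 have a majorant with sum 1/3, so with the
     factor 2 of [Cseries_dominated] they add up to at most 2/3. *)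
  assert (Pos : forall t, 0 <= t <= 1 -> 0 < Re (CPSeries a t)).
  { intros t Ht.
    assert (T := Cseries_tail _ _ 1 (Cseries_CPSeries a t (Rt a t Ht Ra))).
    destruct (Cseries_dominated (fun k => a (1 + k)%nat * RtoC t ^ (1 + k))%C
      (fun k => / 4 * (/ 4) ^ k) (/ 4 * / (1 - / 4))) as [l [Hl Hb]].
    - intros k; unfold a; rewrite !Cmod_mult, !Cmod_pow, Cmod_R, Rabs_pos_eq by lra.
      change (/ 4 * (/ 4) ^ k) with ((/ 4) ^ (1 + k)).
      replace ((/ 4) ^ (1 + k)) with (1 * (/ 4) ^ (1 + k) * 1 ^ (1 + k)) by (rewrite pow1; ring).
      apply Rmult_le_compat; [ apply Rmult_le_pos; [ apply Cmod_ge_0 | apply pow_le; lra ]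
        | apply pow_le; lra | | apply pow_incr; lra ].
      apply Rmult_le_compat; [ apply Cmod_ge_0 | apply pow_le; lra | apply Hc | apply pow_incr; lra ].
    - apply (is_series_scal_l (/ 4) (fun k => (/ 4) ^ k)), is_series_geom; rewrite Rabs_pos_eq; lra.
    - rewrite (Cseries_unique _ _ _ Hl T) in Hb.
      assert (E : csum (fun k => a k * RtoC t ^ k)%C 1 = RtoC 1) by (simpl; unfold a; rewrite H0; simpl; ring).
      rewrite E in Hb; assert (Hb2 := re_le_Cmod (CPSeries a t - 1)%C).
      assert (Hb3 : Rabs (Re (CPSeries a t) - 1) <= 2 / 3).
      { change (Re (CPSeries a t) - 1) with (Re (CPSeries a t - 1)%C); lra. }
      apply Rabs_le_between in Hb3; lra. }
  assert (Ode : forall t, 0 <= t <= 1 -> (CPSeries a t * CPSeries (CPS_derive d) t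
    = w * CPSeries (CPS_derive a) t * CPSeries d t)%C).
  { intros t Ht.
    assert (M1 := CPSeries_mult a (CPS_derive d) _ t (Rt a t Ht Ra)
      (Rt _ t Ht (Cradius_gt_derive d 1 Rd)) (fun k => eq_refl)).
    assert (M2 := CPSeries_mult (CPS_derive a) d _ t
      (Rt _ t Ht (Cradius_gt_derive a 1 Ra)) (Rt d t Ht Rd) (fun k => eq_refl)).
    apply (Cseries_scal w) in M2; rewrite <- Cmult_assoc.
    eapply Cseries_unique; [ exact M1 | eapply Cseries_ext; [ | exact M2 ] ].
    intros k; cbv beta.
    assert (E1 : csum (fun i => a i * CPS_derive d (k - i)%nat)%C (S k)
      = (csum (fun i => c i * (RtoC (INR (S (k - i))) * power_coef c w (S (k - i)))) (S k) * x ^ S k)%C).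
    { rewrite <- csum_scal_r; apply csum_ext; intros i Hi; unfold a, CPS_derive, d.
      replace (S k) with (i + S (k - i))%nat by lia; rewrite Cpow_add_r; ring. }
    assert (E2 : csum (fun i => CPS_derive a i * d (k - i)%nat)%C (S k)
      = (csum (fun i => RtoC (INR (S i)) * c (S i) * power_coef c w (k - i)%nat) (S k) * x ^ S k)%C).
    { rewrite <- csum_scal_r; apply csum_ext; intros i Hi; unfold a, CPS_derive, d.
      replace (S k) with (S i + (k - i))%nat by lia; rewrite Cpow_add_r; ring. }
    rewrite E1, E2, power_coef_ode by exact H0; ring. }
  split; [ exact Ra | split; [ exact Rd | split; [ apply Pos; lra | ] ] ].
  assert (K : (CPSeries d 1 * Cexp (- w * Clog (CPSeries a 1))
    = CPSeries d 0 * Cexp (- w * Clog (CPSeries a 0)))%C).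
  { apply (C_constant (fun t => CPSeries d t * Cexp (- w * Clog (CPSeries a t)))%C).
    intros t Ht.
    assert (Nz : CPSeries a t <> RtoC 0)
      by (intros E; assert (P := Pos t Ht); rewrite E in P; simpl in P; lra).
    eapply is_Cderive_eq.
    - apply is_Cderive_mult; [ apply is_Cderive_CPSeries, (Rt d t Ht Rd) | ].
      apply is_Cderive_Cexp, is_Cderive_scal, is_Cderive_Clog;
        [ apply is_Cderive_CPSeries, (Rt a t Ht Ra) | apply Pos, Ht ].
    - cbv beta; replace (CPSeries (CPS_derive d) t)
        with (CPSeries a t * CPSeries (CPS_derive d) t / CPSeries a t)%C by (field; exact Nz).
      rewrite Ode by exact Ht; field; exact Nz. }
  rewrite !CPSeries_0 in K.
  assert (Ea : a O = RtoC 1) by (unfold a; rewrite H0; simpl; ring).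
  assert (Ed : d O = RtoC 1) by (unfold d, power_coef; simpl; ring).
  rewrite Ea, Ed, Clog_RtoC, ln_1, Cmult_0_r, Cexp_0, Cmult_1_l in K by lra.
  replace (- w * Clog (CPSeries a 1))%C with (- (w * Clog (CPSeries a 1)))%C in K by ring.
  rewrite Cexp_opp in K.
  assert (N := Cexp_neq_0 (w * Clog (CPSeries a 1))%C).
  unfold Q0, S0; replace (CPSeries d 1) with (CPSeries d 1 * / Cexp (w * Clog (CPSeries a 1))
    * Cexp (w * Clog (CPSeries a 1)))%C by (field; exact N).
  rewrite K; ring.
Qed.

(** * The Laurent coefficients *)

Lemma Cexp_Clog (z : C) : 0 < Re z -> Cexp (Clog z) = z.
Proof.
  intros Hx; rewrite Clog_right_half_plane by exact Hx.
  set (x := Re z) in *; set (y := Im z).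
  assert (Hn : 0 < sqrt (x ^ 2 + y ^ 2)) by (apply sqrt_lt_R0; nra).
  assert (E : sqrt (1 + (y / x)²) = sqrt (x ^ 2 + y ^ 2) / x).
  { replace (1 + (y / x)²) with ((x ^ 2 + y ^ 2) / x ^ 2) by (unfold Rsqr; field; lra).
    rewrite sqrt_div_alt by nra; rewrite sqrt_pow2 by lra; reflexivity. }
  unfold Cexp; change (Re (?a, ?c)) with a; change (Im (?a, ?c)) with c.
  rewrite exp_ln, cos_atan, sin_atan, E by exact Hn.
  apply C_eq; rewrite ?re_scal_l, ?im_scal_l; [ fold x; change (Re (?a, ?c)) with a
    | fold y; change (Im (?a, ?c)) with c ]; field; split; lra.
Qed.

(** The coefficients in z^2 of sin(z/2) / (z/2); those of [cos_coef] belong to cos(z/2). *)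
Definition sinc_coef (k : nat) : C := RtoC ((-1 / 4) ^ k / INR (fact (S (2 * k)))).
Definition cos_coef (k : nat) : C := RtoC ((-1 / 4) ^ k / INR (fact (2 * k))).

Lemma coef_bound (k n : nat) : Cmod (RtoC ((-1 / 4) ^ k / INR (fact n))) <= 1.
Proof.
  assert (F : 1 <= INR (fact n)) by (apply (le_INR 1), lt_O_fact).
  unfold Rdiv at 1; rewrite Cmod_R, Rabs_mult, <- RPow_abs, Rabs_inv, (Rabs_pos_eq (INR _)) by lra.
  replace (Rabs (-1 / 4)) with (1 / 4) by (rewrite Rabs_left; lra).
  apply Rle_trans with (1 ^ k * / 1); [ | rewrite pow1; lra ].
  apply Rmult_le_compat.
  - apply pow_le; lra.
  - left; apply Rinv_0_lt_compat; lra.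
  - apply pow_incr; lra.
  - apply Rinv_le_contravar; lra.
Qed.

Lemma RtoC_coef (k n : nat) :
  RtoC ((-1 / 4) ^ k / INR (fact n)) = ((- (1 / 4)) ^ k / RtoC (INR (fact n)))%C.
Proof.
  unfold Rdiv at 1; rewrite RtoC_mult, RtoC_inv, RtoC_pow by apply INR_fact_neq_0.
  replace (RtoC (-1 / 4)) with (- (1 / 4))%C; [ reflexivity | ].
  replace (-1 / 4) with (- (1 / 4)) by field; rewrite RtoC_opp, RtoC_div by lra; reflexivity.
Qed.

Lemma Ci_half_pow (z : C) k : ((Ci * (z / 2)) ^ (2 * k) = (- (1 / 4)) ^ k * (z ^ 2) ^ k)%C.
Proof.
  rewrite Cpow_mult_r, <- Cpow_mult_l; f_equal.
  replace ((Ci * (z / 2)) ^ 2)%C with ((Ci * Ci) * (z * z) / 4)%C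
    by (simpl; field; split; apply RtoC_neq_0; lra).
  replace (Ci * Ci)%C with (- (1))%C by (apply C_eq; simpl; ring).
  simpl; field; apply RtoC_neq_0; lra.
Qed.

Lemma Ci_half_pow_opp (z : C) k : ((- (Ci * (z / 2))) ^ (2 * k) = (Ci * (z / 2)) ^ (2 * k))%C.
Proof. rewrite !Cpow_mult_r; f_equal; simpl; ring. Qed.

Lemma Ci_neq_0 : Ci <> RtoC 0.
Proof. intros E; assert (H := f_equal snd E); simpl in H; lra. Qed.

Lemma Csin_series (z : C) :
  Cseries (fun k => z / 2 * (sinc_coef k * (z ^ 2) ^ k))%C (Csin (z / 2)%C).
Proof.
  assert (H := Cseries_scal (/ (2 * Ci))%C _ _ (Cseries_minus _ _ _ _ (Cexp_series (Ci * (z / 2))%C)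
    (Cexp_series (- (Ci * (z / 2)))%C))).
  apply Cseries_pairs in H.
  unfold Csin; replace ((Cexp (Ci * (z / 2)) - Cexp (- (Ci * (z / 2)))) / (2 * Ci))%C
    with (/ (2 * Ci) * (Cexp (Ci * (z / 2)) - Cexp (- (Ci * (z / 2)))))%C
    by (unfold Cdiv; ring).
  eapply Cseries_ext; [ | exact H ].
  intros k; unfold sinc_coef; rewrite RtoC_coef, !(Cpow_S _ (2 * k)), !Ci_half_pow_opp, !Ci_half_pow.
  assert (N1 := INR_fact_neq_C (2 * k)); assert (N2 := INR_fact_neq_C (S (2 * k))).
  assert (N3 := Ci_neq_0); assert (N4 : RtoC 2 <> RtoC 0) by (apply RtoC_neq_0; lra).
  field; repeat split; assumption.
Qed.

Lemma Ccos_series (z : C) : Cseries (fun k => cos_coef k * (z ^ 2) ^ k)%C (Ccos (z / 2)%C).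
Proof.
  assert (H := Cseries_scal (/ 2)%C _ _ (Cseries_plus _ _ _ _ (Cexp_series (Ci * (z / 2))%C)
    (Cexp_series (- (Ci * (z / 2)))%C))).
  apply Cseries_pairs in H.
  unfold Ccos; replace ((Cexp (Ci * (z / 2)) + Cexp (- (Ci * (z / 2)))) / 2)%C
    with (/ 2 * (Cexp (Ci * (z / 2)) + Cexp (- (Ci * (z / 2)))))%C
    by (unfold Cdiv; ring).
  eapply Cseries_ext; [ | exact H ].
  intros k; unfold cos_coef; rewrite RtoC_coef, !(Cpow_S _ (2 * k)), !Ci_half_pow_opp, !Ci_half_pow.
  assert (N1 := INR_fact_neq_C (2 * k)); assert (N2 := INR_fact_neq_C (S (2 * k))).
  assert (N4 : RtoC 2 <> RtoC 0) by (apply RtoC_neq_0; lra).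
  field; repeat split; assumption.
Qed.

Definition laurent_coef (s : C) (k : nat) : C :=
  (2 * csum (fun i => cos_coef i * power_coef sinc_coef (- (2) * s - 1) (k - i)%nat) (S k))%C.

(* With S = sin(z/2)/(z/2) the generating function is 2 cos(z/2) S^(-2s-1) / z. *)
Lemma laurent_coef_spec (s : C) : cot_laurent_coefficients s (laurent_coef s).
Proof.
  set (w := (- (2) * s - 1)%C); set (B := Cmod w + 2).
  assert (Hw := Cmod_ge_0 w).
  assert (HB : 2 <= B) by (unfold B; lra).
  (* With B >= 2 this radius gives 2 B |z|^2 <= 1, the smallness that [power_series_power] requires
     at x = z^2. *)
  exists (/ (2 * B)); split; [ apply Rinv_0_lt_compat; lra | ].
  intros z Nz Hz.
  assert (Hz0 := Cmod_ge_0 z).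
  assert (Hx : 2 * (B * Cmod (z ^ 2)%C) <= 1).
  { rewrite Cmod_pow.
    assert (Q : Cmod z * (2 * B) < 1).
    { apply Rmult_lt_reg_r with (/ (2 * B)); [ apply Rinv_0_lt_compat; lra | ].
      rewrite Rmult_assoc, Rinv_r, Rmult_1_l, Rmult_1_r by lra; exact Hz. }
    nra. }
  assert (C0 : sinc_coef 0 = RtoC 1) by (unfold sinc_coef; simpl; f_equal; field).
  destruct (power_series_power sinc_coef w (z ^ 2)%C C0 (fun i => coef_bound i _) Hx)
    as [Ra [Rd [Pos EQ]]].
  set (S0 := CPSeries (fun k => sinc_coef k * (z ^ 2) ^ k)%C 1) in *.
  set (Q0 := CPSeries (fun k => power_coef sinc_coef w k * (z ^ 2) ^ k)%C 1) in *.
  assert (R1 : Rabs 1 = 1) by (apply Rabs_pos_eq; lra).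
  assert (at1 : forall u, Cradius_gt u 1 -> Cseries u (CPSeries u 1)).
  { intros u Hu; eapply Cseries_ext; [ | apply Cseries_CPSeries; rewrite R1; exact Hu ].
    intros k; cbv beta; rewrite Cpow_1_l; ring. }
  assert (N2 : RtoC 2 <> RtoC 0) by (apply RtoC_neq_0; lra).
  assert (NS : S0 <> RtoC 0) by (intros E; rewrite E in Pos; simpl in Pos; lra).
  assert (ES : Csin (z / 2)%C = (z / 2 * S0)%C).
  { eapply Cseries_unique; [ apply Csin_series | ].
    apply (Cseries_scal (z / 2)%C (fun k => sinc_coef k * (z ^ 2) ^ k)%C), (at1 _ Ra). }
  assert (Rc : Cradius_gt (fun k => cos_coef k * (z ^ 2) ^ k)%C 1).
  { apply Cradius_gt_bounded with 2 1; [ lra | lra | ].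
    intros k; unfold cos_coef; rewrite Cmod_mult, Cmod_pow, Rmult_assoc, <- Rpow_mult_distr.
    assert (Hx0 := Cmod_ge_0 (z ^ 2)%C).
    replace 1 with (1 * 1 ^ k) by (rewrite pow1; ring).
    apply Rmult_le_compat; [ apply Cmod_ge_0 | apply pow_le; lra | apply coef_bound
      | apply pow_incr; nra ]. }
  assert (EC : Ccos (z / 2)%C = CPSeries (fun k => cos_coef k * (z ^ 2) ^ k)%C 1).
  { eapply Cseries_unique; [ apply Ccos_series | apply (at1 _ Rc) ]. }
  assert (EG : cot_generating s z = (2 / z * (Ccos (z / 2) * Q0))%C).
  { unfold cot_generating, Ccot, Cpower; rewrite ES.
    replace (z / 2 / (z / 2 * S0))%C with (/ S0)%C by (field; repeat split; assumption).
    rewrite Clog_inv by exact Pos.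
    (* -2s = w + 1; the extra factor S cancels the one in the denominator of the cotangent. *)
    replace (2 * s * - Clog S0)%C with (w * Clog S0 + Clog S0)%C by (unfold w; ring).
    rewrite Cexp_plus, <- EQ, Cexp_Clog by exact Pos.
    field; repeat split; assumption. }
  apply Cseries_spec; rewrite EG, EC.
  eapply Cseries_ext; [ | apply Cseries_scal, (CPSeries_mult _ _
    (fun k => csum (fun i => cos_coef i * power_coef sinc_coef w (k - i)%nat) (S k)
      * (z ^ 2) ^ k)%C 1) ].
  - intros k; cbv beta; rewrite Cpow_1_l, Cpow_mult_r; unfold laurent_coef; fold w.
    field; exact Nz.
  - rewrite R1; exact Rc.
  - rewrite R1; exact Rd.
  - intros k; cbv beta; rewrite <- csum_scal_r; apply csum_ext; intros i Hi; cbv beta.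
    replace ((z ^ 2) ^ k)%C with ((z ^ 2) ^ i * (z ^ 2) ^ (k - i))%C; [ ring | ].
    rewrite <- Cpow_add_r; f_equal; lia.
Qed.

Lemma laurent_coef_unique (s : C) (a a' : nat -> C) :
  cot_laurent_coefficients s a -> cot_laurent_coefficients s a' -> forall k, a k = a' k.
Proof.
  intros [r [Hr Ha]] [r' [Hr' Ha']].
  set (d := Rmin r r').
  assert (Hd : 0 < d) by (apply Rmin_pos; assumption).
  assert (Z : forall k, (a k - a' k)%C = RtoC 0).
  { apply CPS_right_zero with (d ^ 2); [ apply pow_lt, Hd | ].
    intros t Ht.
    (* Evaluating at z = sqrt t makes the difference of the expansions, multiplied by z, a power
       series in t that vanishes for small t > 0. *)
    assert (Hs : 0 < sqrt t) by (apply sqrt_lt_R0; lra).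
    assert (Hsd : sqrt t < d).
    { rewrite <- (sqrt_pow2 d) by lra; apply sqrt_lt_1_alt; lra. }
    assert (D1 : d <= r) by apply Rmin_l; assert (D2 : d <= r') by apply Rmin_r.
    assert (N := RtoC_neq_0 (sqrt t) ltac:(lra)).
    assert (M : Cmod (RtoC (sqrt t)) = sqrt t) by (rewrite Cmod_R, Rabs_pos_eq; lra).
    assert (A := proj1 (Cseries_spec _ _) (Ha (RtoC (sqrt t)) N ltac:(rewrite M; lra))).
    assert (A' := proj1 (Cseries_spec _ _) (Ha' (RtoC (sqrt t)) N ltac:(rewrite M; lra))).
    assert (D := Cseries_scal (RtoC (sqrt t)) _ _ (Cseries_minus _ _ _ _ A A')).
    replace (RtoC 0) with (RtoC (sqrt t) * (cot_generating s (RtoC (sqrt t))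
      - cot_generating s (RtoC (sqrt t))))%C by ring.
    eapply Cseries_ext; [ | exact D ].
    intros k; cbv beta; rewrite Cpow_mult_r, <- RtoC_pow, pow2_sqrt by lra.
    field; exact N. }
  intros k; replace (a k) with (a k - a' k + a' k)%C by ring; rewrite Z; ring.
Qed.

Lemma b_laurent_coef (k : nat) (s : C) : b k s = laurent_coef s k.
Proof.
  unfold b; apply (laurent_coef_unique s); [ | apply laurent_coef_spec ].
  apply epsilon_spec; exists (laurent_coef s); apply laurent_coef_spec.
Qed.

Lemma b_spec (s : C) : cot_laurent_coefficients s (fun k => b k s).
Proof.
  destruct (laurent_coef_spec s) as [r [Hr H]]; exists r; split; [ exact Hr | ].
  intros z Nz Hz; apply Cseries_spec; eapply Cseries_ext;
    [ | apply Cseries_spec; exact (H z Nz Hz) ].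
  intros k; cbv beta; rewrite b_laurent_coef; reflexivity.
Qed.

(** * Degrees of the Laurent coefficients *)

(** [l] may be 0, and then the degree is less than [k]; lower terms can thus be added without
    tracking their degrees. *)
Definition poly_lead (k : nat) (l : C) (f : C -> C) : Prop :=
  exists c : nat -> C, c k = l /\ forall s, f s = csum (fun i => c i * s ^ i)%C (S k).

Lemma poly_lead_ext k l l' f g : l = l' -> (forall s, f s = g s) ->
  poly_lead k l f -> poly_lead k l' g.
Proof. intros <- E [c [H1 H2]]; exists c; split; [ exact H1 | intros s; rewrite <- E; apply H2 ]. Qed.

Lemma poly_lead_plus k l l' f g : poly_lead k l f -> poly_lead k l' g ->
  poly_lead k (l + l')%C (fun s => f s + g s)%C.
Proof.
  intros [c [H1 H2]] [d [G1 G2]]; exists (fun i => c i + d i)%C; split; [ congruence | ].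
  intros s; rewrite H2, G2, <- csum_plus; apply csum_ext; intros; ring.
Qed.

Lemma poly_lead_scal k l f u : poly_lead k l f -> poly_lead k (u * l)%C (fun s => u * f s)%C.
Proof.
  intros [c [H1 H2]]; exists (fun i => u * c i)%C; split; [ congruence | ].
  intros s; rewrite H2, <- csum_scal; apply csum_ext; intros; ring.
Qed.

Lemma poly_lead_zero k : poly_lead k (RtoC 0) (fun _ => RtoC 0).
Proof.
  exists (fun _ => RtoC 0); split; [ reflexivity | ].
  intros s; rewrite (csum_ext _ (fun _ => RtoC 0)) by (intros; ring); rewrite csum_const; ring.
Qed.

Lemma poly_lead_raise k n l f : (k < n)%nat -> poly_lead k l f -> poly_lead n (RtoC 0) f.
Proof.
  intros Hn [c [H1 H2]]; exists (fun i => if Nat.leb i k then c i else RtoC 0); split.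
  - destruct (Nat.leb_spec n k); [ lia | reflexivity ].
  - intros s; rewrite H2; replace (S n) with (S k + (n - k))%nat by lia.
    induction (n - k)%nat as [|d IH].
    + rewrite Nat.add_0_r; apply csum_ext; intros i Hi.
      destruct (Nat.leb_spec i k); [ reflexivity | lia ].
    + rewrite Nat.add_succ_r.
      change (csum ?g (S (S k + d))) with (csum g (S k + d) + g (S k + d)%nat)%C; cbv beta.
      rewrite <- IH; destruct (Nat.leb_spec (S k + d) k); [ lia | ring ].
Qed.

Lemma poly_lead_linear k l f u v : poly_lead k l f ->
  poly_lead (S k) (u * l)%C (fun s => (u * s + v) * f s)%C.
Proof.
  intros Hf; assert (Hr := poly_lead_scal _ _ _ v (poly_lead_raise k (S k) l f ltac:(lia) Hf)).
  apply (poly_lead_ext _ (u * l + v * 0)%C _ (fun s => u * s * f s + v * f s)%C);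
    [ ring | intros; ring | ].
  apply poly_lead_plus; [ | exact Hr ].
  destruct Hf as [c [H1 H2]]; exists (fun i => match i with O => RtoC 0 | S j => u * c j end)%C; split;
    [ congruence | ].
  intros s; rewrite csum_split_first, H2; cbv beta iota.
  rewrite Cmult_0_l, Cplus_0_l, <- csum_scal; apply csum_ext; intros i Hi; simpl; ring.
Qed.

Lemma poly_lead_csum k (F : C -> nat -> C) n :
  (forall i, (i < n)%nat -> poly_lead k (RtoC 0) (fun s => F s i)) ->
  poly_lead k (RtoC 0) (fun s => csum (F s) n).
Proof.
  induction n; intros H; [ apply poly_lead_zero | simpl ].
  apply (poly_lead_ext k (0 + 0)%C _ (fun s => csum (F s) n + F s n)%C); [ ring | reflexivity | ].
  apply poly_lead_plus; [ apply IHn; intros; apply H; lia | apply H; lia ].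
Qed.

(** In the recurrence for the index m + 1 only the term i = 0 has degree m + 1; it makes the leading
    coefficient -2 c_1 l / (m + 1), where l is the leading coefficient for the index m. *)
Lemma power_coef_poly_lead (c : nat -> C) : c 1%nat <> RtoC 0 ->
  forall k, exists l, l <> RtoC 0 /\
    poly_lead k l (fun s => power_coef c (- (2) * s - 1)%C k).
Proof.
  intros Hc k; induction k as [k IH] using (well_founded_induction Nat.lt_wf_0).
  destruct k as [|m].
  - exists (RtoC 1); split; [ apply RtoC_neq_0; lra | ].
    exists (fun _ => RtoC 1); split; [ reflexivity | intros s; unfold power_coef; simpl; ring ].
  - assert (T : forall i, (i <= m)%nat -> exists l, l <> RtoC 0 /\ poly_lead (S (m - i))
      (- (2) * RtoC (INR (S i)) * c (S i) * l)%C
      (fun s => (((- (2) * s - 1) * RtoC (INR (S i)) - RtoC (INR (m - i)))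
        * c (S i) * power_coef c (- (2) * s - 1) (m - i)%nat)%C)).
    { intros i Hi; destruct (IH (m - i)%nat ltac:(lia)) as [l [Nl Hl]]; exists l; split; [ exact Nl | ].
      eapply poly_lead_ext; [ reflexivity | | apply (poly_lead_linear _ _ _
        (- (2) * RtoC (INR (S i)) * c (S i))%C
        (- (RtoC (INR (S i)) + RtoC (INR (m - i))) * c (S i))%C Hl) ].
      intros s; cbv beta; ring. }
    destruct (T O ltac:(lia)) as [l [Nl Hl]].
    assert (Hm : RtoC (INR (S m)) <> RtoC 0) by (apply RtoC_neq_0, not_0_INR; lia).
    exists (/ RtoC (INR (S m)) * (- (2) * c 1%nat * l + 0))%C; split.
    + intros E; apply Nl.
      replace l with ((- / (2) * / c 1%nat * RtoC (INR (S m)))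
        * (/ RtoC (INR (S m)) * (- (2) * c 1%nat * l + 0)))%C
        by (field; repeat split; try assumption; apply RtoC_neq_0; lra).
      rewrite E; ring.
    + eapply poly_lead_ext; [ reflexivity | intros s; symmetry; apply power_coef_S | ].
      apply poly_lead_scal.
      eapply poly_lead_ext; [ reflexivity | intros s; symmetry; apply csum_split_first | ].
      apply poly_lead_plus.
      * rewrite Nat.sub_0_r in Hl; eapply poly_lead_ext; [ | | exact Hl ];
          [ simpl INR; ring | intros s; rewrite Nat.sub_0_r; reflexivity ].
      * apply (poly_lead_csum (S m) (fun s i => ((- (2) * s - 1) * RtoC (INR (S (S i)))
          - RtoC (INR (m - S i))) * c (S (S i)) * power_coef c (- (2) * s - 1) (m - S i)%nat)%C).
        intros i Hi; destruct (T (S i) ltac:(lia)) as [l' [_ Hl']].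
        eapply poly_lead_raise; [ | exact Hl' ]; lia.
Qed.

(** In the Cauchy product only the term with [cos_coef 0], which is 1, reaches degree [k]. *)
Lemma b_polynomial (k : nat) : polynomial_of_degree k (b k).
Proof.
  assert (Hc : sinc_coef 1 <> RtoC 0) by (unfold sinc_coef; apply RtoC_neq_0; simpl; lra).
  destruct (power_coef_poly_lead sinc_coef Hc k) as [l [Nl Hl]].
  assert (P : poly_lead k (2 * (l + 0))%C (b k)).
  { eapply poly_lead_ext; [ reflexivity | intros s; symmetry; apply b_laurent_coef | ].
    apply poly_lead_scal.
    eapply poly_lead_ext; [ reflexivity | intros s; symmetry; apply csum_split_first | ].
    apply poly_lead_plus.
    - eapply poly_lead_ext; [ reflexivity | | exact Hl ].
      intros s; rewrite Nat.sub_0_r; unfold cos_coef; simpl.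
      replace (1 / 1) with 1 by field; ring.
    - apply (poly_lead_csum k (fun s i => cos_coef (S i)
        * power_coef sinc_coef (- (2) * s - 1) (k - S i)%nat)%C).
      intros i Hi; destruct (power_coef_poly_lead sinc_coef Hc (k - S i)) as [l' [_ Hl']].
      eapply poly_lead_raise with (k := (k - S i)%nat); [ lia | apply poly_lead_scal, Hl' ]. }
  destruct P as [c [H1 H2]]; exists c; split.
  - rewrite H1; intros E; apply Nl.
    replace l with (/ 2 * (2 * (l + 0)))%C by (field; apply RtoC_neq_0; lra); rewrite E; ring.
  - intros s; rewrite sum_n_csum; apply H2.
Qed.

(** * Smoothness away from 0, and the cutoff *)

Definition compact_range (D : R -> Prop) : Prop :=
  exists lo hi, 0 < lo /\ forall x, D x -> lo <= x <= hi.

(** Away from 0 and infinity all powers of x are comparable, so the exponent carries no information;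
    0 serves as the standard one. *)
Lemma derivs_O_any (D : R -> Prop) r a a' f : compact_range D ->
  derivs_O D r a f -> derivs_O D r a' f.
Proof.
  intros [lo [hi [Hlo HD]]].
  set (L := Rabs (ln lo) + Rabs (ln hi)).
  apply derivs_O_weaken with (exp (Rabs (a - a') * L)); [ left; apply exp_pos | ].
  intros x Hx; specialize (HD x Hx).
  replace a with ((a - a') + a') at 1 by ring; rewrite Rpower_plus.
  apply Rmult_le_compat_r; [ left; apply Rpower_pos | ].
  assert (L1 : ln lo <= ln x) by (apply ln_le; lra).
  assert (L2 : ln x <= ln hi) by (apply ln_le; lra).
  assert (HL : Rabs (ln x) <= L).
  { unfold L; apply Rabs_le; generalize (Rle_abs (ln hi)) (Rabs_pos (ln lo)) (Rabs_pos (ln hi))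
      (Rle_abs (- ln lo)); rewrite Rabs_Ropp; intros; lra. }
  unfold Rpower; assert (E : (a - a') * ln x <= Rabs (a - a') * L).
  { eapply Rle_trans; [ apply Rle_abs | rewrite Rabs_mult ].
    apply Rmult_le_compat_l; [ apply Rabs_pos | exact HL ]. }
  destruct E as [E| ->]; [ left; apply exp_increasing, E | lra ].
Qed.

Lemma compact_range_pos D : compact_range D -> forall x, D x -> 0 < x.
Proof. intros [lo [hi [H1 H2]]] x Hx; specialize (H2 x Hx); lra. Qed.

Lemma derivs_O_compact_0 (D : R -> Prop) f : compact_range D ->
  (exists M, forall x, D x -> Cmod (f x) <= M) -> derivs_O D 0 0 f.
Proof.
  intros HD [M HM]; apply derivs_O_0; exists M; intros x Hx.
  rewrite Rpower_O, Rmult_1_r by (eapply compact_range_pos; eassumption); apply HM, Hx.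
Qed.

Lemma derivs_O_compact_S (D : R -> Prop) r f f' : compact_range D ->
  (exists M, forall x, D x -> Cmod (f x) <= M) ->
  (forall x, D x -> is_Cderive f x (f' x)) -> derivs_O D r 0 f' -> derivs_O D (S r) 0 f.
Proof.
  intros HD [M HM] Hd Hf; apply derivs_O_S with f';
    [ | exact Hd | eapply derivs_O_any; eassumption ].
  exists M; intros x Hx.
  rewrite Rpower_O, Rmult_1_r by (eapply compact_range_pos; eassumption); apply HM, Hx.
Qed.

Lemma derivs_O_compact_mult (D : R -> Prop) r f g :
  derivs_O D r 0 f -> derivs_O D r 0 g -> derivs_O D r 0 (fun x => f x * g x)%C.
Proof. intros F G; rewrite <- (Rplus_0_l 0); apply derivs_O_mult; assumption. Qed.

(** Induction through (1/f)' = - f' (1/f)^2, whose right side involves only bounds of one order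
    less. *)
Lemma derivs_O_compact_inv (D : R -> Prop) (f : R -> R) (delta : R) : compact_range D -> 0 < delta ->
  (forall x, D x -> delta <= f x) -> forall r,
  derivs_O D r 0 (fun x => RtoC (f x)) -> derivs_O D r 0 (fun x => RtoC (/ f x)).
Proof.
  intros HD Hdl Hf.
  assert (B : exists M, forall x, D x -> Cmod (RtoC (/ f x)) <= M).
  { exists (/ delta); intros x Hx; specialize (Hf x Hx).
    rewrite Cmod_R, Rabs_pos_eq by (left; apply Rinv_0_lt_compat; lra).
    apply Rinv_le_contravar; lra. }
  induction r; intros H; [ apply derivs_O_compact_0; assumption | ].
  assert (IH := IHr (derivs_O_pred _ _ _ _ H)).
  destruct H as [C0 [HC [_ [f' [Hd Hs]]]]].
  apply derivs_O_compact_S with (fun x => (-1) * (f' x * (RtoC (/ f x) * RtoC (/ f x))))%C;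
    [ exact HD | exact B | | ].
  - intros x Hx; destruct (Hd x Hx) as [D1 D2]; specialize (Hf x Hx).
    (* The derivative supplied by the hypothesis is complex-valued; it is real because [f] is. *)
    assert (E2 : Im (f' x) = 0).
    { rewrite <- (is_derive_unique _ _ _ D2); simpl; apply Derive_const. }
    assert (E : f' x = RtoC (Re (f' x))) by (apply C_eq; [ reflexivity | exact E2 ]).
    eapply is_Cderive_eq; [ apply is_Cderive_RtoC, is_derive_inv; [ exact D1 | lra ] | ].
    rewrite E, <- !RtoC_mult; simpl Re; f_equal.
    field; lra.
  - apply derivs_O_scal, derivs_O_compact_mult; [ | apply derivs_O_compact_mult; exact IH ].
    apply derivs_O_any with (0 - 1); [ exact HD | exists C0; split; assumption ].
Qed.

(** For M > 0 this has M - 1 continuous derivatives, which supplies the finite smoothness of the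
    cutoff. *)
Definition truncated_pow (M : nat) (t : R) : R := Rmax t 0 ^ M.

Lemma truncated_pow_ge0 M t : 0 <= truncated_pow M t.
Proof. apply pow_le, Rmax_r. Qed.

Lemma truncated_pow_neg M t : t <= 0 -> truncated_pow (S M) t = 0.
Proof. intros H; unfold truncated_pow; rewrite Rmax_right by exact H; simpl; ring. Qed.

Lemma is_derive_truncated_pow M t :
  is_derive (truncated_pow (S (S M))) t (INR (S (S M)) * truncated_pow (S M) t).
Proof.
  destruct (Rtotal_order t 0) as [L|[ -> |L]].
  - rewrite truncated_pow_neg, Rmult_0_r by lra.
    apply is_derive_ext_loc with (fun _ => 0); [ | apply @is_derive_const ].
    apply (locally_open (fun y => y < 0)); [ apply open_lt | | exact L ].
    intros y Hy; rewrite truncated_pow_neg by lra; reflexivity.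
  - rewrite (truncated_pow_neg M 0), Rmult_0_r by lra.
    apply is_derive_Reals; intros eps He.
    exists (mkposreal _ (Rmin_pos eps 1 He Rlt_0_1)); simpl; intros h Nh Hh.
    assert (H1 : Rabs h < eps) by (eapply Rlt_le_trans; [ exact Hh | apply Rmin_l ]).
    assert (H2 : Rabs h < 1) by (eapply Rlt_le_trans; [ exact Hh | apply Rmin_r ]).
    rewrite (truncated_pow_neg (S M) 0), Rplus_0_l, !Rminus_0_r by lra.
    destruct (Rle_lt_dec h 0) as [N|P].
    + rewrite truncated_pow_neg by exact N; unfold Rdiv; rewrite Rmult_0_l, Rabs_R0; exact He.
    + unfold truncated_pow; rewrite Rmax_left by lra.
      replace (h ^ S (S M) / h) with (h * h ^ M) by (simpl; field; lra).
      rewrite Rabs_pos_eq in H1, H2 by lra.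
      assert (B : h ^ M <= 1) by (rewrite <- (pow1 M); apply pow_incr; lra).
      assert (B0 : 0 <= h ^ M) by (apply pow_le; lra).
      rewrite Rabs_pos_eq by nra; nra.
  - apply is_derive_ext_loc with (fun y => y ^ S (S M)).
    + apply (locally_open (fun y => 0 < y)); [ apply open_gt | | exact L ].
      intros y Hy; unfold truncated_pow; rewrite Rmax_left by lra; reflexivity.
    + unfold truncated_pow; rewrite Rmax_left by lra.
      auto_derive; [ exact I | simpl; ring ].
Qed.

Lemma derivs_O_truncated_pow (D : R -> Prop) (u v : R) : compact_range D ->
  forall r M, (r < M)%nat -> derivs_O D r 0 (fun x => RtoC (truncated_pow M (u * x + v))).
Proof.
  intros HD.
  assert (B : forall M, exists K, forall x, D x -> Cmod (RtoC (truncated_pow M (u * x + v))) <= K).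
  { intros M; destruct HD as [lo [hi [H1 H2]]].
    exists ((Rabs u * hi + Rabs v) ^ M); intros x Hx; specialize (H2 x Hx).
    rewrite Cmod_R, Rabs_pos_eq by apply truncated_pow_ge0.
    apply pow_incr; split; [ apply Rmax_r | ].
    assert (P1 := Rabs_pos u); assert (P2 := Rabs_pos v).
    apply Rmax_lub; [ | nra ].
    generalize (Rle_abs u) (Rle_abs v); intros; nra. }
  induction r; intros M HM; [ apply derivs_O_compact_0; auto | ].
  destruct M as [|[|M]]; [ lia | lia | ].
  apply derivs_O_compact_S with (fun x : R =>
    RtoC u * RtoC (INR (S (S M)) * truncated_pow (S M) (u * x + v))%R)%C;
    [ exact HD | apply B | | ].
  - intros x _; apply (is_Cderive_comp (fun t => RtoC (truncated_pow (S (S M)) t))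
      (fun x => u * x + v)).
    + apply is_Cderive_RtoC, is_derive_truncated_pow.
    + auto_derive; [ exact I | ring ].
  - apply derivs_O_scal.
    destruct (IHr (S M) ltac:(lia)) as [C0 [HC Hs]].
    exists (Cmod (RtoC (INR (S (S M)))) * C0); split;
      [ apply Rmult_le_pos; [ apply Cmod_ge_0 | exact HC ] | ].
    apply (derivs_le_scal D r (RtoC (INR (S (S M))))) in Hs.
    replace (fun x : R => RtoC (INR (S (S M)) * truncated_pow (S M) (u * x + v)))
      with (fun x : R => (RtoC (INR (S (S M))) * RtoC (truncated_pow (S M) (u * x + v)))%C);
      [ exact Hs | ].
    apply functional_extensionality; intros x; symmetry; apply RtoC_mult.
Qed.

Lemma PI_gt_3 : 3 < PI.
Proof. generalize PI2_3_2; lra. Qed.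

(** For M > 0 this is 1 when x <= 2 and 0 when x >= 2 pi - 2. The reflection x -> 2 pi - x exchanges
    the two terms of the denominator, so the cutoff and its reflection add up to 1. *)
Definition cutoff (M : nat) (x : R) : R :=
  truncated_pow M (2 * PI - 2 - x) / (truncated_pow M (2 * PI - 2 - x) + truncated_pow M (x - 2)).

(** On either side of pi, one of the two arguments is at least pi - 2. *)
Lemma cutoff_denominator M x :
  (PI - 2) ^ M <= truncated_pow M (2 * PI - 2 - x) + truncated_pow M (x - 2).
Proof.
  assert (P := PI_gt_3).
  assert (T1 := truncated_pow_ge0 M (2 * PI - 2 - x)); assert (T2 := truncated_pow_ge0 M (x - 2)).
  assert (K : forall t, PI - 2 <= t -> (PI - 2) ^ M <= truncated_pow M t).
  { intros t Ht; apply pow_incr; split; [ lra | eapply Rle_trans; [ exact Ht | apply Rmax_l ] ]. }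
  destruct (Rle_lt_dec x PI) as [L|L].
  - generalize (K (2 * PI - 2 - x) ltac:(lra)); lra.
  - generalize (K (x - 2) ltac:(lra)); lra.
Qed.

Lemma cutoff_denominator_pos M x :
  0 < truncated_pow M (2 * PI - 2 - x) + truncated_pow M (x - 2).
Proof.
  eapply Rlt_le_trans; [ | apply cutoff_denominator ].
  apply pow_lt; generalize PI_gt_3; lra.
Qed.

Lemma cutoff_reflect M x : cutoff M x + cutoff M (2 * PI - x) = 1.
Proof.
  assert (H := cutoff_denominator_pos M x); unfold cutoff.
  replace (2 * PI - 2 - (2 * PI - x)) with (x - 2) by ring.
  replace (2 * PI - x - 2) with (2 * PI - 2 - x) by ring.
  field; lra.
Qed.

Lemma cutoff_left M x : x <= 2 -> cutoff (S M) x = 1.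
Proof.
  intros H; assert (P := cutoff_denominator_pos (S M) x); unfold cutoff.
  rewrite (truncated_pow_neg M (x - 2)) in * by lra; field; lra.
Qed.

Lemma cutoff_right M x : 2 * PI - 2 <= x -> cutoff (S M) x = 0.
Proof.
  intros H; unfold cutoff.
  rewrite (truncated_pow_neg M (2 * PI - 2 - x)) by lra; unfold Rdiv; ring.
Qed.

Lemma derivs_O_cutoff (D : R -> Prop) r M : compact_range D -> (r < M)%nat ->
  derivs_O D r 0 (fun x => RtoC (cutoff M x)).
Proof.
  intros HD HM.
  assert (T1 := derivs_O_truncated_pow D (-1) (2 * PI - 2) HD r M HM).
  assert (T2 := derivs_O_truncated_pow D 1 (-2) HD r M HM).
  assert (E1 : forall x, truncated_pow M (-1 * x + (2 * PI - 2)) = truncated_pow M (2 * PI - 2 - x))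
    by (intros; f_equal; ring).
  assert (E2 : forall x, truncated_pow M (1 * x + -2) = truncated_pow M (x - 2))
    by (intros; f_equal; ring).
  set (W := fun x => truncated_pow M (-1 * x + (2 * PI - 2)) + truncated_pow M (1 * x + -2)).
  assert (TW : derivs_O D r 0 (fun x => RtoC (W x))).
  { generalize (derivs_O_plus _ _ _ _ _ T1 T2); unfold W.
    replace (fun x : R => (RtoC (truncated_pow M (-1 * x + (2 * PI - 2)))
      + RtoC (truncated_pow M (1 * x + -2)))%C)
      with (fun x : R => RtoC (truncated_pow M (-1 * x + (2 * PI - 2)) + truncated_pow M (1 * x + -2)));
      [ tauto | ].
    apply functional_extensionality; intros x; apply RtoC_plus. }
  assert (TI := derivs_O_compact_inv D W ((PI - 2) ^ M) HD
    ltac:(apply pow_lt; generalize PI_gt_3; lra)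
    ltac:(intros x _; unfold W; rewrite E1, E2; apply cutoff_denominator) r TW).
  generalize (derivs_O_compact_mult _ _ _ _ T1 TI).
  replace (fun x : R => (RtoC (truncated_pow M (-1 * x + (2 * PI - 2))) * RtoC (/ W x))%C)
    with (fun x : R => RtoC (cutoff M x)); [ tauto | ].
  apply functional_extensionality; intros x.
  rewrite <- RtoC_mult; unfold W, cutoff; rewrite E1, E2; reflexivity.
Qed.

(** * The summand and its expansion at 0 *)

Definition cot_power (s : C) (x : R) : C :=
  (RtoC (cos (x / 2) / sin (x / 2)) / Rcpow (4 * sin (x / 2) ^ 2) s)%C.

Lemma sin_half_lower_bound (e : R) : 0 < e < 1 ->
  exists d, 0 < d /\ forall x, e < x < 2 * PI - 1 -> d <= sin (x / 2).
Proof.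
  intros He; assert (P := PI_gt_3).
  exists (sin (e / 2)); split; [ apply sin_gt_0; lra | ].
  intros x Hx; destruct (Rle_lt_dec x PI) as [L|L].
  - apply sin_incr_1; lra.
  (* Here pi - x/2 exceeds 1/2 and hence e/2, while it is at most pi/2. *)
  - replace (sin (x / 2)) with (sin (PI - x / 2)) by (rewrite sin_PI_x; reflexivity).
    apply sin_incr_1; lra.
Qed.

(** With k = cot(x/2) and p = (4 sin^2(x/2))^(-s) the system k' = -(1 + k^2)/2, p' = -s k p is
    closed, so bounds on k and p give bounds on all derivatives. *)
Lemma derivs_O_cot_power (s : C) (e : R) : 0 < e < 1 -> forall r,
  derivs_O (fun x => e < x < 2 * PI - 1) r 0 (cot_power s).
Proof.
  intros He; set (D := fun x => e < x < 2 * PI - 1).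
  assert (HD : compact_range D)
    by (exists e, (2 * PI - 1); split; [ lra | unfold D; intros; lra ]).
  destruct (sin_half_lower_bound e He) as [d [Hd Hs]].
  set (k := fun x => cos (x / 2) / sin (x / 2)).
  set (p := fun x => Rcpow (4 * sin (x / 2) ^ 2) (- s)%C).
  assert (Bk : exists M, forall x, D x -> Cmod (RtoC (k x)) <= M).
  { exists (1 * / d); intros x Hx; specialize (Hs x Hx).
    unfold k, Rdiv; rewrite Cmod_R, Rabs_mult, Rabs_inv, (Rabs_pos_eq (sin _)) by lra.
    apply Rmult_le_compat; [ apply Rabs_pos | left; apply Rinv_0_lt_compat; lra
      | apply Rabs_le, COS_bound | apply Rinv_le_contravar; lra ]. }
  assert (Hk : forall r, derivs_O D r 0 (fun x => RtoC (k x))).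
  { induction r; [ apply derivs_O_compact_0; assumption | ].
    apply derivs_O_compact_S with (fun x => RtoC (- / 2) * (1 + RtoC (k x) * RtoC (k x)))%C;
      [ exact HD | exact Bk | | ].
    - intros x Hx; specialize (Hs x Hx).
      eapply is_Cderive_eq; [ apply is_Cderive_RtoC; unfold k | ].
      + apply is_derive_div; [ | | lra ]; auto_derive; try exact I; reflexivity.
      + rewrite <- RtoC_mult, <- RtoC_plus, <- RtoC_mult; f_equal; unfold k.
        change (x * / 2) with (x / 2).
        generalize (sin2_cos2 (x / 2)); unfold Rsqr; intros E.
        field; lra.
    - apply derivs_O_scal, derivs_O_plus;
        [ apply derivs_O_const, compact_range_pos, HD | apply derivs_O_compact_mult; exact IHr ]. }
  assert (Bp : exists M, forall x, D x -> Cmod (p x) <= M).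
  { exists (exp (Rabs (Re s) * (Rabs (ln (4 * d ^ 2)) + Rabs (ln 4)))); intros x Hx.
    specialize (Hs x Hx); assert (S1 := SIN_bound (x / 2)).
    unfold p; rewrite Cmod_Rcpow; unfold Rpower.
    assert (L1 : ln (4 * d ^ 2) <= ln (4 * sin (x / 2) ^ 2)) by (apply ln_le; nra).
    assert (L2 : ln (4 * sin (x / 2) ^ 2) <= ln 4) by (apply ln_le; nra).
    assert (LL : Rabs (ln (4 * sin (x / 2) ^ 2)) <= Rabs (ln (4 * d ^ 2)) + Rabs (ln 4)).
    { apply Rabs_le; generalize (Rle_abs (ln 4)) (Rabs_pos (ln (4 * d ^ 2))) (Rabs_pos (ln 4))
        (Rle_abs (- ln (4 * d ^ 2))); rewrite Rabs_Ropp; intros; lra. }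
    assert (E : Re (- s)%C * ln (4 * sin (x / 2) ^ 2)
      <= Rabs (Re s) * (Rabs (ln (4 * d ^ 2)) + Rabs (ln 4))).
    { eapply Rle_trans; [ apply Rle_abs | rewrite Rabs_mult ].
      change (Re (- s)%C) with (- Re s); rewrite Rabs_Ropp.
      apply Rmult_le_compat_l; [ apply Rabs_pos | exact LL ]. }
    destruct E as [E| ->]; [ left; apply exp_increasing, E | lra ]. }
  assert (Hp : forall r, derivs_O D r 0 p).
  { induction r; [ apply derivs_O_compact_0; assumption | ].
    apply derivs_O_compact_S with (fun x => - s * (RtoC (k x) * p x))%C;
      [ exact HD | exact Bp | | ].
    - intros x Hx; specialize (Hs x Hx).
      eapply is_Cderive_eq; [ unfold p, Rcpow; apply is_Cderive_Cexp, is_Cderive_scal,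
        is_Cderive_RtoC; instantiate (1 := k x) | unfold p, Rcpow; ring ].
      unfold k; auto_derive; [ nra | change (x * / 2) with (x / 2); field; lra ].
    - apply derivs_O_scal, derivs_O_compact_mult; [ apply Hk | exact IHr ]. }
  intros r; replace (cot_power s) with (fun x => (RtoC (k x) * p x)%C).
  - apply derivs_O_compact_mult; [ apply Hk | apply Hp ].
  - apply functional_extensionality; intros x.
    unfold p, cot_power; rewrite Rcpow_opp; reflexivity.
Qed.

(** The argument of L in the k-th term; its negative is the exponent of x in the expansion of the
    summand at 0. *)
Definition exponent (s : C) (k : nat) : C := (1 + 2 * (s - RtoC (INR k)))%C.

Lemma exponent_add (s : C) (m k : nat) :
  (- exponent s (m + k))%C = (- exponent s m + RtoC (INR (2 * k)))%C.
Proof.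
  unfold exponent; rewrite plus_INR, mult_INR, RtoC_plus, RtoC_mult.
  replace (INR 2) with 2 by (simpl; ring); ring.
Qed.

Lemma Re_exponent (s : C) (k : nat) : Re (- exponent s k)%C = 2 * INR k - 1 - 2 * Re s.
Proof. unfold exponent, Re; simpl; ring. Qed.

(** Gives the tail of the expansion, as a power series in x^2, a radius of at least 1/B. The k + 1
    terms of the Cauchy product are absorbed by 2^k. *)
Lemma b_bound (s : C) : exists B, 1 <= B /\ forall k, Cmod (b k s) <= 2 * B ^ k.
Proof.
  set (w := (- (2) * s - 1)%C); set (B := Cmod w + 2).
  assert (Hw := Cmod_ge_0 w).
  assert (HB : 2 <= B) by (unfold B; lra).
  exists (2 * B); split; [ lra | ].
  intros k; rewrite b_laurent_coef; unfold laurent_coef; fold w.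
  rewrite Cmod_mult, Cmod_R, Rabs_pos_eq by lra.
  apply Rmult_le_compat_l; [ lra | ].
  assert (H2 : INR (S k) <= 2 ^ k).
  { clear; induction k; [ simpl; lra | ].
    rewrite S_INR; simpl pow.
    assert (1 <= 2 ^ k) by (apply pow_R1_Rle; lra); lra. }
  assert (HP : 0 < B ^ k) by (apply pow_lt; lra).
  eapply Rle_trans; [ apply Cmod_csum with (M := B ^ k) | ].
  - intros i Hi; rewrite Cmod_mult, <- (Rmult_1_l (B ^ k)).
    apply Rmult_le_compat; try apply Cmod_ge_0; [ apply coef_bound | ].
    eapply Rle_trans; [ apply power_coef_bound; intros; apply coef_bound | ].
    apply Rle_pow; [ change (1 <= B); lra | lia ].
  - rewrite Rpow_mult_distr; nra.
Qed.

(** Multiplication by x^(-2s) turns ((x/2) / sin(x/2))^(2s) into (4 sin^2(x/2))^(-s); all bases are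
    positive reals, so the principal powers multiply. *)
Lemma cot_power_series (s : C) : exists e, 0 < e < 1 /\ forall x, 0 < x < e ->
  Cseries (fun k => b k s * Rcpow x (- exponent s k))%C (cot_power s x).
Proof.
  destruct (b_spec s) as [r [Hr Hs]].
  exists (Rmin r (1 / 2)); split.
  { split; [ apply Rmin_pos; lra | eapply Rle_lt_trans; [ apply Rmin_r | lra ] ]. }
  intros x [Hx0 Hx].
  assert (X1 : x < r) by (eapply Rlt_le_trans; [ exact Hx | apply Rmin_l ]).
  assert (X2 : x < 1 / 2) by (eapply Rlt_le_trans; [ exact Hx | apply Rmin_r ]).
  assert (P := PI_gt_3).
  assert (Hsin : 0 < sin (x / 2)) by (apply sin_gt_0; lra).
  assert (Nx := RtoC_neq_0 x ltac:(lra)).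
  assert (H := proj1 (Cseries_spec _ _) (Hs (RtoC x) Nx ltac:(rewrite Cmod_R, Rabs_pos_eq; lra))).
  apply (Cseries_scal (Rcpow x (- (2 * s)))%C) in H.
  assert (Ex : (RtoC x / 2)%C = RtoC (x / 2)) by (rewrite RtoC_div by lra; reflexivity).
  assert (Es : Csin (RtoC (x / 2)) = RtoC (sin (x / 2))).
  { unfold Csin, Cexp; apply C_eq; simpl; unfold Re, Im; simpl;
      rewrite ?Rmult_0_l, ?Rmult_1_l, ?Rmult_0_r, ?Rplus_0_l, ?Rplus_0_r, ?Rminus_0_r,
        ?Ropp_0, ?Rmult_0_r, ?exp_0, ?cos_neg, ?sin_neg; field. }
  assert (Ec : Ccos (RtoC (x / 2)) = RtoC (cos (x / 2))).
  { unfold Ccos, Cexp; apply C_eq; simpl; unfold Re, Im; simpl;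
      rewrite ?Rmult_0_l, ?Rmult_1_l, ?Rmult_0_r, ?Rplus_0_l, ?Rplus_0_r, ?Rminus_0_r,
        ?Ropp_0, ?Rmult_0_r, ?exp_0, ?cos_neg, ?sin_neg; field. }
  assert (V : (Rcpow x (- (2 * s)) * cot_generating s (RtoC x))%C = cot_power s x).
  { unfold cot_generating, Ccot, cot_power; rewrite Ex, Es, Ec, <- !RtoC_div by lra.
    rewrite Cpower_RtoC by (apply Rdiv_lt_0_compat; lra).
    replace (x / 2 / sin (x / 2)) with (x * / (2 * sin (x / 2))) by (field; lra).
    rewrite Rcpow_mult, Rcpow_inv, Rcpow_opp by (try apply Rinv_0_lt_compat; lra).
    replace (4 * sin (x / 2) ^ 2) with ((2 * sin (x / 2)) * (2 * sin (x / 2))) by ring.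
    rewrite !Rcpow_mult by lra.
    replace (2 * s)%C with (s + s)%C by ring; rewrite !Rcpow_plus.
    assert (Q1 := Cexp_neq_0 (s * RtoC (ln x))%C); fold (Rcpow x s) in Q1.
    assert (Q2 := Cexp_neq_0 (s * RtoC (ln (sin (x / 2))))%C); fold (Rcpow (sin (x / 2)) s) in Q2.
    assert (Q3 := Cexp_neq_0 (s * RtoC (ln 2))%C); fold (Rcpow 2 s) in Q3.
    field; repeat split; assumption. }
  rewrite V in H; eapply Cseries_ext; [ | exact H ].
  intros k; cbv beta; rewrite <- RtoC_pow, <- (Rcpow_nat x (2 * k)) by lra.
  change (exponent s k) with (exponent s (0 + k)); rewrite exponent_add, Rcpow_plus.
  replace (- exponent s 0)%C with (- (2 * s) + - RtoC (INR 1))%C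
    by (unfold exponent; simpl; ring).
  rewrite Rcpow_plus, (Rcpow_opp x (RtoC (INR 1))), (Rcpow_nat x 1), pow_1 by lra.
  field; exact Nx.
Qed.

(** The derivative is 2x times a function of the same kind, so all derivatives are bounded up to 0;
    since e <= 1, bounded implies O(x^(-i)). *)
Lemma derivs_O_CPSeries_sq (e : R) : 0 < e <= 1 -> forall r a, Cradius_gt a (e ^ 2) ->
  derivs_O (fun x => 0 < x < e) r 0 (fun x => CPSeries a (x ^ 2)).
Proof.
  intros He; set (D := fun x => 0 < x < e).
  assert (Dp : forall x, D x -> 0 < x) by (unfold D; intros; lra).
  assert (one : forall r f, derivs_O D r 0 f -> derivs_O D r (0 - 1) f).
  { intros r f; apply derivs_O_weaken with 1; [ lra | ].
    intros x [H1 H2]; rewrite Rpower_O, Rmult_1_l by exact H1.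
    unfold Rminus; rewrite Rplus_0_l, Rpower_Ropp, Rpower_1 by exact H1.
    rewrite <- Rinv_1 at 1; apply Rinv_le_contravar; lra. }
  assert (B0 : forall f M, (forall x, D x -> Cmod (f x) <= M) ->
    exists C0, forall x, D x -> Cmod (f x) <= C0 * Rpower x 0).
  { intros f M H; exists M; intros x Hx; rewrite Rpower_O, Rmult_1_r by apply Dp, Hx; apply H, Hx. }
  assert (lin : forall r, derivs_O D r 0 (fun x => RtoC (2 * x))).
  { assert (B : exists C0, forall x, D x -> Cmod (RtoC (2 * x)) <= C0 * Rpower x 0).
    { apply B0 with 2; intros x [H1 H2]; rewrite Cmod_R, Rabs_pos_eq; lra. }
    destruct r; [ apply derivs_O_0, B | ].
    apply derivs_O_S with (fun _ => RtoC 2); [ exact B | | apply one, derivs_O_const, Dp ].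
    intros x _; apply is_Cderive_RtoC; auto_derive; [ exact I | ring ]. }
  assert (sq : forall x, D x -> Rabs (x ^ 2) <= e ^ 2).
  { intros x [H1 H2]; rewrite Rabs_pos_eq by nra; nra. }
  induction r; intros a Ha;
    (assert (B : exists C0, forall x, D x -> Cmod (CPSeries a (x ^ 2)) <= C0 * Rpower x 0)
      by (destruct (CPSeries_bounded a (e ^ 2)) as [M HM]; [ nra | exact Ha | ];
          apply B0 with M; intros x Hx; apply HM, sq, Hx)).
  - apply derivs_O_0, B.
  - apply derivs_O_S with (fun x => RtoC (2 * x)%R * CPSeries (CPS_derive a) (x ^ 2)%R)%C;
      [ exact B | | ].
    + intros x Hx; apply (is_Cderive_comp (CPSeries a) (fun x => x ^ 2)).
      * apply is_Cderive_CPSeries; eapply Cradius_gt_le; [ apply sq, Hx | exact Ha ].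
      * auto_derive; [ exact I | ring ].
    + apply one, derivs_O_compact_mult; [ apply lin | apply IHr, Cradius_gt_derive, Ha ].
Qed.

Definition remainder (M m : nat) (s : C) (x : R) : C :=
  (cot_power s x * RtoC (cutoff M x) - csum (fun k => b k s * Rcpow x (- exponent s k)) (S m))%C.

Lemma derivs_O_csum D r a (F : nat -> R -> C) n :
  (forall k, (k < n)%nat -> derivs_O D r a (F k)) ->
  derivs_O D r a (fun x => csum (fun k => F k x) n).
Proof.
  induction n; intros H; [ apply derivs_O_zero | simpl ].
  apply (derivs_O_plus D r a (fun x => csum (fun k => F k x) n) (F n));
    [ apply IHn; intros; apply H; lia | apply H; lia ].
Qed.

Lemma derivs_O_minus D r a f g :
  derivs_O D r a f -> derivs_O D r a g -> derivs_O D r a (fun x => f x - g x)%C.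
Proof.
  intros F G; replace (fun x => f x - g x)%C with (fun x => f x + (-1) * g x)%C.
  - apply derivs_O_plus; [ exact F | apply derivs_O_scal, G ].
  - apply functional_extensionality; intros x; ring.
Qed.

Lemma open_interval (a c : R) : forall x, a < x < c -> locally x (fun y => a < y < c).
Proof.
  intros x Hx; apply (locally_open (fun y => a < y < c)); [ | auto | exact Hx ].
  apply open_and; [ apply open_gt | apply open_lt ].
Qed.

Lemma open_ray (a : R) : forall x, a < x -> locally x (fun y => a < y).
Proof.
  intros x Hx; apply (locally_open (fun y => a < y)); [ apply open_gt | auto | exact Hx ].
Qed.

Lemma derivs_O_remainder (r M m : nat) (s : C) : (r < M)%nat ->
  derivs_O (fun x => 0 < x) r (Re (- exponent s (S m))%C) (remainder M m s).
Proof.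
  intros HM; assert (P := PI_gt_3).
  destruct M as [|M]; [ lia | ].
  destruct (cot_power_series s) as [e0 [He0 Hser]].
  destruct (b_bound s) as [B [HB Hb]].
  (* Ensures both that the expansion holds on (0, e) and that e^2 < 1/B. *)
  set (e := Rmin e0 (/ (2 * B))).
  assert (E1 : e <= e0) by apply Rmin_l; assert (E2 : e <= / (2 * B)) by apply Rmin_r.
  assert (He : 0 < e) by (apply Rmin_pos; [ lra | apply Rinv_0_lt_compat; lra ]).
  (* Here the cutoff is 1, and the remainder is the first omitted power of x times a power series in
     x^2. *)
  assert (Near0 : derivs_O (fun x => 0 < x < e) r (Re (- exponent s (S m))%C) (remainder (S M) m s)).
  { assert (Rad : Cradius_gt (fun k => b (S m + k)%nat s) (e ^ 2)).
    { apply Cradius_gt_bounded with (/ B) (2 * B ^ S m).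
      - left; apply Rinv_0_lt_compat; lra.
      - assert (Q : / (2 * B) < / B) by (apply Rinv_lt_contravar; nra).
        nra.
      - intros k; eapply Rle_trans; [ apply Rmult_le_compat_r;
          [ apply pow_le; left; apply Rinv_0_lt_compat; lra | apply Hb ] | ].
        rewrite pow_add, pow_inv; right; field; apply pow_nonzero; lra. }
    replace (Re (- exponent s (S m))%C) with (Re (- exponent s (S m))%C + 0) by ring.
    eapply derivs_O_ext; [ apply open_interval | | apply derivs_O_mult;
      [ apply (derivs_O_Rcpow (fun x => 0 < x < e) r ltac:(intros; lra))
      | apply (derivs_O_CPSeries_sq e ltac:(lra) r _ Rad) ] ].
    intros x Hx; cbv beta; unfold remainder.
    rewrite cutoff_left, Cmult_1_r by lra.
    eapply Cseries_unique; [ | apply (Cseries_tail _ _ (S m)), Hser; lra ].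
    eapply Cseries_ext; [ | apply Cseries_scal, Cseries_CPSeries;
      eapply Cradius_gt_le; [ | exact Rad ]; rewrite Rabs_pos_eq; nra ].
    intros k; cbv beta; rewrite exponent_add, Rcpow_plus, Rcpow_nat, pow_mult, <- RtoC_pow by lra.
    ring. }
  (* The range stays away from 0, from 2 pi and from infinity, so bounded derivatives are enough. *)
  assert (Mid : derivs_O (fun x => e / 2 < x < 2 * PI - 1) r (Re (- exponent s (S m))%C)
    (remainder (S M) m s)).
  { assert (HD : compact_range (fun x => e / 2 < x < 2 * PI - 1))
      by (exists (e / 2), (2 * PI - 1); split; [ lra | intros; lra ]).
    apply derivs_O_any with 0; [ exact HD | ].
    apply derivs_O_minus.
    - apply derivs_O_compact_mult; [ apply derivs_O_cot_power; lra | ].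
      apply derivs_O_cutoff; [ exact HD | exact HM ].
    - apply (derivs_O_csum _ r 0 (fun k x => b k s * Rcpow x (- exponent s k))%C).
      intros k _; apply derivs_O_scal, (derivs_O_any _ _ (Re (- exponent s k)%C)); [ exact HD | ].
      apply derivs_O_Rcpow, compact_range_pos, HD. }
  (* Here the cutoff is 0, and the subtracted powers have exponents below the claimed one, which
     suffices for x >= 1. *)
  assert (Far : derivs_O (fun x => 2 * PI - 2 < x) r (Re (- exponent s (S m))%C)
    (remainder (S M) m s)).
  { eapply derivs_O_ext; [ apply open_ray | | apply (derivs_O_minus _ _ _ (fun _ => RtoC 0)
      (fun x => csum (fun k => b k s * Rcpow x (- exponent s k))%C (S m)));
      [ apply derivs_O_zero | ] ].
    - intros x Hx; unfold remainder; rewrite cutoff_right by lra; ring.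
    - apply (derivs_O_csum _ r _ (fun k x => b k s * Rcpow x (- exponent s k))%C).
      intros k Hk; apply derivs_O_scal.
      apply derivs_O_weaken with (Re (- exponent s k)%C) 1; [ lra | |
        apply derivs_O_Rcpow; intros; lra ].
      intros x Hx; rewrite Rmult_1_l; apply Rle_Rpower; [ lra | ].
      rewrite !Re_exponent; assert (INR k <= INR (S m)) by (apply le_INR; lia); lra. }
  (* The ranges overlap because gluing works with open sets. *)
  apply derivs_O_restrict with (fun x => (0 < x < e \/ e / 2 < x < 2 * PI - 1) \/ 2 * PI - 2 < x).
  { intros x Hx; destruct (Rlt_le_dec x e); [ left; left; lra | ].
    destruct (Rlt_le_dec x (2 * PI - 1)); [ left; right; lra | right; lra ]. }
  assert (dec : forall x a c, {a < x < c} + {~ a < x < c}).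
  { intros x a c; destruct (Rlt_dec a x), (Rlt_dec x c); [ left; lra | right; lra .. ]. }
  apply derivs_O_glue; [ | | apply open_ray | | exact Far ].
  - intros x; destruct (dec x 0 e); [ left; left; assumption | ].
    destruct (dec x (e / 2) (2 * PI - 1)); [ left; right; assumption | right; tauto ].
  - intros x [H|H]; (eapply filter_imp; [ | apply open_interval, H ]); tauto.
  - apply derivs_O_glue; [ intros; apply dec | apply open_interval | apply open_interval
      | exact Near0 | exact Mid ].
Qed.

(** * The discrete L-function *)

Lemma csum_tail_zero (a : nat -> C) n d : (forall i, (n <= i)%nat -> a i = RtoC 0) ->
  csum a (n + d) = csum a n.
Proof.
  intros H; induction d; [ rewrite Nat.add_0_r; reflexivity | ].
  rewrite Nat.add_succ_r; simpl; rewrite IHd, H by lia; ring.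
Qed.

Lemma Cvanishes_finite (a : nat -> C) n : (forall i, (n <= i)%nat -> a i = RtoC 0) -> Cvanishes a.
Proof.
  intros H; apply is_lim_seq_ext_loc with (fun _ => 0); [ | apply is_lim_seq_const ].
  exists n; intros i Hi; rewrite H, Cmod_0 by exact Hi; reflexivity.
Qed.

Lemma Cseries_finite (a : nat -> C) n : (forall i, (n <= i)%nat -> a i = RtoC 0) ->
  Cseries a (csum a n).
Proof.
  intros H.
  apply Cseries_perturb with (b := fun k => match k with O => csum a n | S _ => RtoC 0 end)
    (e := fun k => (csum a (S k) - csum a n)%C).
  - intros k.
    assert (E : csum (fun k => match k with O => csum a n | S _ => RtoC 0 end) (S k) = csum a n).
    { rewrite csum_split_first, csum_const; ring. }
    rewrite E; ring.
  - apply Cvanishes_finite with n; intros i Hi.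
    replace (S i) with (n + (S i - n))%nat by lia; rewrite csum_tail_zero by exact H; ring.
  - apply Cseries_spec, is_series_decr_1.
    change (plus (csum a n) (opp (csum a n))) with (csum a n - csum a n)%C.
    replace (csum a n - csum a n)%C with (RtoC 0) by ring.
    apply Cseries_spec, Cseries_zero.
Qed.

Lemma sum_n_m_csum (f : nat -> C) n : sum_n_m f 1 n = csum (fun i => f (S i)) n.
Proof.
  induction n; [ rewrite sum_n_m_zero by lia; reflexivity | ].
  rewrite sum_n_Sm by lia; rewrite IHn; reflexivity.
Qed.

Lemma sin_half_reflect x : sin ((2 * PI - x) / 2) = sin (x / 2).
Proof. replace ((2 * PI - x) / 2) with (PI - x / 2) by field; apply sin_PI_x. Qed.

Lemma cos_half_reflect x : cos ((2 * PI - x) / 2) = - cos (x / 2).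
Proof.
  replace ((2 * PI - x) / 2) with (- (x / 2) + PI) by field; rewrite neg_cos, cos_neg; reflexivity.
Qed.

Lemma cot_power_reflect s x : cot_power s (2 * PI - x) = (- cot_power s x)%C.
Proof.
  unfold cot_power; rewrite sin_half_reflect, cos_half_reflect.
  replace (- cos (x / 2) / sin (x / 2)) with (- (cos (x / 2) / sin (x / 2)))
    by (unfold Rdiv; ring).
  rewrite RtoC_opp; unfold Cdiv; ring.
Qed.

(* Pairing j with qn - j, where both chi and the summand change sign, replaces
   the weight 1 by twice the cutoff. *)
Lemma discrete_L_cutoff (q n M : nat) (chi : Z -> C) (s : C) :
  (0 < q * n)%nat -> dirichlet_character q chi -> odd_character chi ->
  let lam := INR (q * n) / (2 * PI) in
  discrete_L q n chi s =
  (2 * csum (fun i => chi (Z.of_nat (S i)) * (cot_power s (INR (S i) / lam)%R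
         * RtoC (cutoff M (INR (S i) / lam)%R))) (q * n - 1))%C.
Proof.
  intros HN hchi hodd lam.
  assert (P := PI_gt_3).
  assert (HNr : 0 < INR (q * n)) by (apply lt_0_INR; exact HN).
  assert (Hl : 0 < lam) by (apply Rdiv_lt_0_compat; lra).
  set (N := (q * n)%nat) in *.
  unfold discrete_L; fold N; rewrite sum_n_m_csum.
  set (F := fun i => (chi (Z.of_nat (S i)) * cot_power s (INR (S i) / lam)%R)%C).
  set (phi := fun i => RtoC (cutoff M (INR (S i) / lam))).
  transitivity (csum F (N - 1)).
  { apply csum_ext; intros i Hi; unfold F, cot_power; f_equal.
    assert (HI : 0 < INR (S i) < INR N) by (split; [ apply lt_0_INR | apply lt_INR ]; lia).
    replace (PI * INR (S i) / INR N) with (INR (S i) / lam / 2) by (unfold lam; field; lra).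
    rewrite Cpower_RtoC; [ reflexivity | ].
    assert (0 < sin (INR (S i) / lam / 2)).
    { replace (INR (S i) / lam / 2) with (PI * (INR (S i) / INR N)) by (unfold lam; field; lra).
      assert (Q : 0 < INR (S i) / INR N) by (apply Rdiv_lt_0_compat; lra).
      assert (Q1 : INR (S i) / INR N < 1).
      { apply Rmult_lt_reg_r with (INR N); [ lra | ].
        unfold Rdiv; rewrite Rmult_assoc, Rinv_l, Rmult_1_l, Rmult_1_r; lra. }
      apply sin_gt_0; nra. }
    nra. }
  assert (Refl : csum (fun i => F i * (1 - phi i))%C (N - 1) = csum (fun i => F i * phi i)%C (N - 1)).
  { rewrite csum_rev; apply csum_ext; intros i Hi.
    assert (X : INR (S (N - 1 - 1 - i)) / lam = 2 * PI - INR (S i) / lam).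
    { replace (S (N - 1 - 1 - i)) with (N - S i)%nat by lia.
      rewrite minus_INR by lia; unfold lam; field; lra. }
    unfold F, phi; rewrite X, cot_power_reflect.
    replace (Z.of_nat (S (N - 1 - 1 - i))) with (Z.of_nat (q * n) - Z.of_nat (S i))%Z by (fold N; lia).
    rewrite odd_character_reflect by assumption.
    replace (cutoff M (2 * PI - INR (S i) / lam)) with (1 - cutoff M (INR (S i) / lam))
      by (generalize (cutoff_reflect M (INR (S i) / lam)); lra).
    rewrite RtoC_minus; ring. }
  rewrite (csum_ext F (fun i => F i * phi i + F i * (1 - phi i))%C) by (intros; ring).
  rewrite csum_plus, Refl, (csum_ext (fun i => F i * phi i)%C
    (fun i => chi (Z.of_nat (S i)) * (cot_power s (INR (S i) / lam)%R
      * RtoC (cutoff M (INR (S i) / lam)%R)))%C).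
  - ring.
  - intros i _; unfold F, phi; ring.
Qed.

Theorem mainTheorem1 (q : nat) (chi : Z -> C)
  (hq : (1 < q)%nat)
  (hchi : dirichlet_character q chi)
  (hodd : odd_character chi) :
  (forall k : nat, polynomial_of_degree k (b k)) /\
  (forall (s : C) (m : nat),
     bigO
       (fun n : nat =>
          (discrete_L q n chi s -
           2 * sum_n
                 (fun k : nat =>
                    b k s * dirichlet_L chi (1 + 2 * (s - INR k)) *
                    Cpower (RtoC (INR (q * n) / (2 * PI))%R)
                           (1 + 2 * (s - INR k)))
                 m)%C)
       (fun n : nat =>
          Rpower (INR n) (Re (1 + 2 * (s - INR (m + 1)))%C))).
Proof.
  split; [ exact b_polynomial | intros s m ].
  assert (P := PI_gt_3).
  destruct (exists_character_primitives q chi hq hchi hodd) as [A HA].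
  set (a := Re (- exponent s (S m))%C).
  (* Sufficient for the remainder and also for the powers with k <= m, whose exponents have smaller
     real parts than [a]. *)
  set (r := Z.to_nat (up (a + 2))).
  assert (Hr : a + 2 <= INR r) by apply INR_up_ge.
  destruct (derivs_O_remainder r (S r) m s ltac:(lia)) as [C0 [HC Hrem]]; fold a in Hrem.
  destruct (regularized_sum_bound chi A a r HA ltac:(lra)) as [K [HK Hreg]].
  (* The leading 2 comes from pairing j with qn - j, and lam = (q / (2 pi)) n isolates the power of
     n. From n = 1 on, lam is positive. *)
  exists (2 * (K * (C0 * Rpower (INR q / (2 * PI)) (- a)))), 1%nat; intros n Hn.
  assert (Hq : 0 < INR q) by (apply lt_0_INR; lia).
  assert (Hn0 : 0 < INR n) by (apply lt_0_INR; lia).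
  assert (HN : (0 < q * n)%nat) by (apply Nat.mul_pos_pos; lia).
  assert (HNr : 0 < INR (q * n)) by (apply lt_0_INR; exact HN).
  assert (D := discrete_L_cutoff q n (S r) chi s HN hchi hodd); cbv zeta in D.
  set (lam := INR (q * n) / (2 * PI)) in *.
  assert (Hl : 0 < lam) by (apply Rdiv_lt_0_compat; lra).
  set (g := fun i => (cot_power s (INR (S i) / lam)%R * RtoC (cutoff (S r) (INR (S i) / lam)%R))%C).
  (* For j >= qn the argument is at least 2 pi, where the cutoff vanishes; the finite sum is
     therefore a sum over all j >= 1. *)
  assert (Hg : forall i, (q * n - 1 <= i)%nat -> g i = RtoC 0).
  { intros i Hi; unfold g; rewrite cutoff_right; [ ring | ].
    assert (Hi2 : INR (q * n) <= INR (S i)) by (apply le_INR; lia).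
    apply Rle_trans with (INR (q * n) / lam); [ replace (INR (q * n) / lam)
      with (2 * PI) by (unfold lam; field; lra); lra | ].
    apply Rmult_le_compat_r; [ left; apply Rinv_0_lt_compat, Hl | exact Hi2 ]. }
  set (v := csum (fun i => chi (Z.of_nat (S i)) * g i)%C (q * n - 1)).
  assert (Sg : Cseries (fun j => A r j * bdiffn r g j)%C v).
  { replace r with (r + 0)%nat by lia.
    apply (abel_iter chi A 0 r g v HA); [ exact (Cvanishes_finite g _ Hg) | ].
    eapply Cseries_ext; [ | apply Cseries_finite with (n := (q * n - 1)%nat) ].
    - intros j; cbv beta; rewrite (proj1 HA); reflexivity.
    - intros i Hi; cbv beta; rewrite Hg by exact Hi; ring. }
  (* The power of lam comes from (x / lam)^(-w) = lam^w x^(-w) with w = [exponent s k]. *)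
  set (T := fun k => (b k s * Rcpow lam (exponent s k))%C).
  assert (Sk : forall k, (k < S m)%nat ->
    Cseries (fun j => A r j * bdiffn r (dirichlet_seq (exponent s k)) j)%C
      (dirichlet_L chi (exponent s k))).
  { intros k Hk; rewrite (dirichlet_L_regularized chi A HA).
    apply (regularized_L_spec chi); [ exact HA | ].
    change (- Re (exponent s k)) with (Re (- exponent s k)%C).
    unfold a in Hr; rewrite Re_exponent in *.
    assert (INR k <= INR (S m)) by (apply le_INR; lia); lra. }
  (* By linearity, the functional takes the rescaled remainder to the cutoff sum minus the main
     terms, each of them [T k] times a value of L. *)
  assert (Srem : Cseries (fun j => A r j * bdiffn r (fun i => remainder (S r) m s (INR (S i) / lam)) j)%C
    (v - csum (fun k => T k * dirichlet_L chi (exponent s k)) (S m))%C).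
  { assert (SS : forall p, (p <= S m)%nat ->
      Cseries (fun j => csum (fun k => T k * (A r j * bdiffn r (dirichlet_seq (exponent s k)) j)) p)%C
        (csum (fun k => T k * dirichlet_L chi (exponent s k))%C p)).
    { induction p; intros Hp; [ exact Cseries_zero | ].
      apply Cseries_plus; [ apply IHp; lia | apply Cseries_scal, Sk; lia ]. }
    eapply Cseries_ext; [ | exact (Cseries_minus _ _ _ _ Sg (SS (S m) (le_n _))) ].
    intros j; cbv beta.
    assert (BS : forall p, bdiffn r (fun i => csum (fun k => T k * dirichlet_seq (exponent s k) i)%C p) j
      = csum (fun k => T k * bdiffn r (dirichlet_seq (exponent s k)) j)%C p).
    { induction p.
      - rewrite (bdiffn_ext r _ (fun i => 0 * RtoC 0)%C) by (intros; simpl; ring).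
        rewrite bdiffn_scal; simpl; ring.
      - change (csum ?f (S p)) with (csum f p + f p)%C; cbv beta.
        rewrite <- IHp, <- bdiffn_scal, <- bdiffn_plus; reflexivity. }
    rewrite (bdiffn_ext r (fun i => remainder (S r) m s (INR (S i) / lam))
      (fun i => g i + (-1) * csum (fun k => T k * dirichlet_seq (exponent s k) i) (S m))%C).
    - rewrite bdiffn_plus, bdiffn_scal, BS.
      rewrite (csum_ext (fun k => T k * (A r j * bdiffn r (dirichlet_seq (exponent s k)) j))%C
        (fun k => A r j * (T k * bdiffn r (dirichlet_seq (exponent s k)) j))%C) by (intros; ring).
      rewrite csum_scal; ring.
    - intros i; unfold remainder; fold (g i).
      rewrite (csum_ext (fun k => b k s * Rcpow (INR (S i) / lam) (- exponent s k))%C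
        (fun k => T k * dirichlet_seq (exponent s k) i)%C); [ ring | ].
      intros k _; unfold T, dirichlet_seq, Rdiv.
      rewrite Rcpow_mult, Rcpow_inv, (Rcpow_opp lam)
        by (try apply Rinv_0_lt_compat, Hl; try exact Hl; apply lt_0_INR; lia).
      assert (Q := Cexp_neq_0 (exponent s k * RtoC (ln lam))%C); fold (Rcpow lam (exponent s k)) in Q.
      field; exact Q. }
  (* Scaling preserves x > 0 but not x >= 1, so the restriction comes after it. *)
  assert (Hscale := derivs_le_restrict (fun x => 0 < x) (fun x => 1 <= x) r _ _ _
    ltac:(intros; lra)
    (derivs_le_scale r lam Hl a C0 _ Hrem)).
  destruct (Hreg (C0 * Rpower lam (- a)) _ ltac:(apply Rmult_le_pos; [ exact HC
    | left; apply Rpower_pos ]) Hscale) as [_ [l [Hl1 Hl2]]].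
  rewrite (Cseries_unique _ _ _ Hl1 Srem) in Hl2.
  replace (_ - _)%C with (2 * (v - csum (fun k => T k * dirichlet_L chi (exponent s k)) (S m)))%C.
  - rewrite Cmod_mult, Cmod_R, Rabs_pos_eq by lra.
    replace (Re (1 + 2 * (s - RtoC (INR (m + 1))))%C) with (- a)
      by (unfold a; rewrite Re_exponent, Nat.add_1_r; unfold Re; simpl; ring).
    assert (EL : Rpower lam (- a) = Rpower (INR q / (2 * PI)) (- a) * Rpower (INR n) (- a)).
    { rewrite Rpower_mult_distr; [ | apply Rdiv_lt_0_compat; lra | exact Hn0 ].
      f_equal; unfold lam; rewrite mult_INR; field; lra. }
    rewrite EL in Hl2; lra.
  - change (discrete_L q n chi s = 2 * v)%C in D; rewrite D.
    rewrite sum_n_csum, (csum_ext (fun k => T k * dirichlet_L chi (exponent s k))%C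
      (fun k => b k s * dirichlet_L chi (1 + 2 * (s - RtoC (INR k)))
        * Cpower (RtoC lam) (1 + 2 * (s - RtoC (INR k))))%C); [ ring | ].
    intros k _; unfold T, exponent; rewrite Cpower_RtoC by exact Hl; ring.
Qed.
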